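(* Let $n\ge 1$, $\alpha\in(0,1)$, and let $B_r=B_r(0)\subset\mathbb{R}^n$. Suppose that $u\in C^{2,\alpha}(B_1)$ satisfies the fourth order equation $$\int_{B_1} a^{ij,kl}(D^2u(x))\,u_{ij}(x)\,\eta_{kl}(x)\,dx=0\qquad\text{for all }\eta\in C_0^\infty(B_1).$$ If the equation (equivalently, the coefficient family $a^{ij,kl}$) is regular on an open set $U\subseteq S^{n\times n}$ containing $D^2u(B_1)$, then $u$ is smooth ($C^\infty$) on $B_r$ for every $r<1$.
   Context: $S^{n\times n}$ is the space of real symmetric $n\times n$ matrices; repeated indices are summed from $1$ to $n$; subscripts on $u,\eta$ denote partial derivatives; $C_0^\infty$ denotes smooth compactly supported functions. For a function $G$ on an open subset of $S^{n\times n}$ (whose variable is written $(u_{ij})$), $\partial G/\partial u_{ij}$ denotes the components, symmetric in $i,j$, of the derivative, so that $DG(M)[\xi]=\frac{\partial G}{\partial u_{ij}}(M)\,\xi_{ij}$ for $\xi\in S^{n\times n}$. Given real-valued coefficients $a^{ij,kl}$ ($1\le i,j,k,l\le n$) on an open set $U\subseteq S^{n\times n}$, define, for $M=(M_{pq})\in U$, $$b^{ij,kl}(M)=a^{ij,kl}(M)+\frac{\partial a^{pq,kl}}{\partial u_{ij}}(M)\,M_{pq}.$$ The equation is called regular on $U$ if: (1) the $a^{ij,kl}$ are smooth functions on $U$; (2) there is a constant $\Lambda>0$ with $a^{ij,kl}(M)\xi_{ij}\xi_{kl}\ge\Lambda|\xi|^2$ for all $M\in U$, $\xi\in S^{n\times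 n}$; (3) there is a constant $\Lambda_1>0$ such that either $b^{ij,kl}(M)\xi_{ij}\xi_{kl}\ge\Lambda_1|\xi|^2$ for all $M\in U$, $\xi\in S^{n\times n}$, or $-b^{ij,kl}(M)\xi_{ij}\xi_{kl}\ge\Lambda_1|\xi|^2$ for all $M\in U$, $\xi\in S^{n\times n}$. *)

(* Defs.v *)
From mathcomp Require Import all_boot all_order all_algebra.
From mathcomp Require Import all_classical all_reals all_analysis.

Set Implicit Arguments.
Unset Strict Implicit.
Unset Printing Implicit Defensive.

Import Order.TTheory GRing.Theory Num.Theory.
Import numFieldNormedType.Exports.

Local Open Scope classical_set_scope.
Local Open Scope ring_scope.

(* The library norm on 'rV[R]_n is the max norm; balls and Hoelder quotients
   here use the Euclidean norm. *)
Definition enorm (R : realType) (n : nat) (x : 'rV[R]_n) : R :=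
  Num.sqrt (\sum_i x ord0 i ^+ 2).

Definition eball (R : realType) (n : nat) (r : R) : set 'rV[R]_n :=
  [set x | enorm x < r].

Section lebesgue_tuple.
Context (R : realType).
Local Open Scope ereal_scope.

Notation RT := (measurableTypeR R).

Definition swap_cons (n : nat) (p : n.-tuple RT * RT) : n.+1.-tuple RT :=
  [tuple of p.2 :: p.1].

Lemma measurable_swap_cons (n : nat) :
  measurable_fun [set: n.-tuple RT * RT] (@swap_cons n).
Proof. exact: measurable_cons measurable_snd measurable_fst. Qed.

(* [pushforward m f] with its canonical measure structure, which canonical
   inference cannot find because it depends on a proof of measurability of f. *)
Local Notation pushforward_measure :=
  measure_function_pushforward__canonical__measure_function_Measure.

(* The library has no Lebesgue measure on R^n.  It is built here on the product
   sigma-algebra of n.-tuple R as the n-fold product of the one-dimensional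
   Lebesgue measure, the 0-dimensional one being the unit mass at [tuple]. *)
Fixpoint lebesgue_tuple (n : nat) : {measure set (n.-tuple RT) -> \bar R} :=
  if n is n'.+1 then
    pushforward_measure (lebesgue_tuple n' \x (@lebesgue_measure R))%E
      (@measurable_swap_cons n')
  else dirac ([tuple] : 0.-tuple RT).

Lemma lebesgue_tuple_box (n : nat) (A : 'I_n -> set RT) :
  (forall i, measurable (A i)) ->
  lebesgue_tuple n [set t | forall i, A i (tnth t i)] =
  \prod_(i < n) @lebesgue_measure R (A i).
Proof.
elim: n A => [|n IHn] A mA /=.
  by rewrite big_ord0 diracE mem_set//= => -[].
have mbox : measurable [set t : n.-tuple RT | forall i, A (lift ord0 i) (tnth t i)].
  rewrite (_ : mkset _ =
    \bigcap_(i in [set: 'I_n]) ((fun t => tnth t i) @^-1` A (lift ord0 i))).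
    apply: fin_bigcap_measurable => // i _.
    by rewrite -[X in measurable X]setTI; exact: measurable_tnth.
  by apply/seteqP; split => t /= h i; [move=> _|]; exact: h.
rewrite /pushforward big_ord_recl muleC.
rewrite (_ : _ @^-1` _ =
  [set t : n.-tuple RT | forall i, A (lift ord0 i) (tnth t i)] `*` A ord0).
  rewrite product_measure1E//; congr (_ * _).
  exact: (IHn (fun i => A (lift ord0 i))).
apply/seteqP; split => -[t x] /=.
  move=> h; split => [i|]; last by have := h ord0.
  by have := h (lift ord0 i); rewrite /swap_cons tnthS.
move=> [h h0] i; case: (unliftP ord0 i) => [j ->|-> //].
by rewrite /swap_cons tnthS; exact: h.
Qed.

End lebesgue_tuple.

Definition row_of_tuple (R : realType) (n : nat) (t : n.-tuple R) : 'rV[R]_n :=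
  \row_i tnth t i.

(* \int_D f dx.  In [weak_solution] the integrand is continuous on D with
   compact support in D, hence integrable. *)
Definition rint (R : realType) (n : nat) (D : set 'rV[R]_n) (f : 'rV[R]_n -> R)
    : \bar R :=
  (\int[lebesgue_tuple R n]_(t in [set t | D (row_of_tuple t)])
     (f (row_of_tuple t))%:E)%E.

(* Class C^k on D: all iterated derivatives of order at most k along the
   directions in [dirs] exist on D and are continuous on D.  It is used with
   D open in R^n and [dirs] the coordinate vectors, and with D relatively open
   in the linear subspace [dirs] of symmetric matrices; only the values of f
   on D matter in both cases. *)
Fixpoint ck (R : realType) (V : normedModType R) (dirs D : set V) (k : nat)
    (f : V -> R) : Prop :=
  {within D, continuous f} /\
  if k is k'.+1 then
    forall v, dirs v ->
      (forall x, D x -> derivable f x v) /\ ck dirs D k' (fun x => 'D_v f x)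
  else True.

Definition smooth (R : realType) (V : normedModType R) (dirs D : set V)
    (f : V -> R) : Prop :=
  forall k, ck dirs D k f.

Definition coord_dirs (R : realType) (n : nat) : set 'rV[R]_n :=
  [set delta_mx ord0 i | i in [set: 'I_n]].

Definition smooth_on (R : realType) (n : nat) (D : set 'rV[R]_n)
    (f : 'rV[R]_n -> R) : Prop :=
  smooth (@coord_dirs R n) D f.

(* pd2 i j f is f_ij. *)
Definition pd2 (R : realType) (n : nat) (i j : 'I_n) (f : 'rV[R]_n -> R)
    : 'rV[R]_n -> R :=
  fun x => 'D_(delta_mx ord0 j) (fun y => 'D_(delta_mx ord0 i) f y) x.

Definition hessian (R : realType) (n : nat) (f : 'rV[R]_n -> R) (x : 'rV[R]_n)
    : 'M[R]_n :=
  \matrix_(i, j) pd2 i j f x.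

(* Locally Hoelder continuous: uniformly so on compact subsets of D. *)
Definition holder_on (R : realType) (n : nat) (alpha : R) (D : set 'rV[R]_n)
    (f : 'rV[R]_n -> R) : Prop :=
  forall K : set 'rV[R]_n, compact K -> K `<=` D ->
    exists C : R, forall x y, K x -> K y ->
      `|f x - f y| <= C * enorm (x - y) `^ alpha.

Definition c2_alpha (R : realType) (n : nat) (alpha : R) (D : set 'rV[R]_n)
    (f : 'rV[R]_n -> R) : Prop :=
  ck (@coord_dirs R n) D 2 f /\ forall i j, holder_on alpha D (pd2 i j f).

Definition test_function (R : realType) (n : nat) (D : set 'rV[R]_n)
    (eta : 'rV[R]_n -> R) : Prop :=
  [/\ smooth_on [set: 'rV[R]_n] eta,
      compact (closure [set x | eta x != 0]) &
      closure [set x | eta x != 0] `<=` D].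

Definition symm (R : realType) (n : nat) : set 'M[R]_n := [set M | M^T = M].

Definition open_in_symm (R : realType) (n : nat) (U : set 'M[R]_n) : Prop :=
  exists V : set 'M[R]_n, open V /\ U = V `&` @symm R n.

(* dsym i j G is dG/du_ij.  The coefficients g_ij, symmetric in i and j, with
   DG(M)[xi] = g_ij xi_ij for symmetric xi are obtained by taking for xi the
   symmetric part of the (i, j) matrix unit. *)
Definition dsym (R : realType) (n : nat) (i j : 'I_n) (G : 'M[R]_n -> R)
    : 'M[R]_n -> R :=
  fun M => 'D_(2%:R^-1 *: (delta_mx i j + delta_mx j i)) G M.

(* a i j k l M is a^{ij,kl}(M); only its values for M in U are relevant. *)
Definition coeffs (R : realType) (n : nat) : Type :=
  'I_n -> 'I_n -> 'I_n -> 'I_n -> 'M[R]_n -> R.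

Definition bcoeffs (R : realType) (n : nat) (a : coeffs R n) : coeffs R n :=
  fun i j k l M =>
    a i j k l M + \sum_p \sum_q dsym i j (a p q k l) M * M p q.

Definition qform (R : realType) (n : nat) (c : coeffs R n) (M xi : 'M[R]_n)
    : R :=
  \sum_i \sum_j \sum_k \sum_l c i j k l M * xi i j * xi k l.

Definition sqnorm (R : realType) (n : nat) (xi : 'M[R]_n) : R :=
  \sum_i \sum_j xi i j ^+ 2.

Definition regular (R : realType) (n : nat) (U : set 'M[R]_n)
    (a : coeffs R n) : Prop :=
  [/\ forall i j k l, smooth (@symm R n) U (a i j k l),
      exists Lambda : R, 0 < Lambda /\
        forall M xi, U M -> symm xi -> Lambda * sqnorm xi <= qform a M xi &
      exists Lambda1 : R, 0 < Lambda1 /\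
        ((forall M xi, U M -> symm xi ->
            Lambda1 * sqnorm xi <= qform (bcoeffs a) M xi) \/
         (forall M xi, U M -> symm xi ->
            Lambda1 * sqnorm xi <= - qform (bcoeffs a) M xi))].

Definition weak_solution (R : realType) (n : nat) (a : coeffs R n)
    (D : set 'rV[R]_n) (u : 'rV[R]_n -> R) : Prop :=
  forall eta : 'rV[R]_n -> R, test_function D eta ->
    rint D (fun x => \sum_i \sum_j \sum_k \sum_l
      a i j k l (hessian u x) * pd2 i j u x * pd2 k l eta x) = 0%E.

(* Main.v *)
Require Import Defs.
From HB Require Import structures.
From mathcomp Require Import all_boot all_order all_algebra.
From mathcomp Require Import all_classical all_reals all_analysis measurable_realfun.
From mathcomp Require Import ring lra zify.

Set Implicit Arguments.
Unset Strict Implicit.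
Unset Printing Implicit Defensive.

Import Order.TTheory GRing.Theory Num.Def Num.Theory.
Import numFieldNormedType.Exports.

Local Open Scope classical_set_scope.
Local Open Scope ring_scope.

(* The difference quotient v of u in a coordinate direction solves an equation
   whose flux, on the ball of radius rho around any point x, differs by
   O(rho^alpha) from an elliptic contraction of D^2 v with constant coefficients
   (the mean of b along a segment of Hessians).  For such an equation the
   Caccioppoli inequality bounds D^2 of w in L^2 by w itself, and the second
   difference of w with step s by s^2 D^2 w; alternating the two, the L^2 norm on
   a ball of radius R of a difference of order 2m of D^2 v is at most
   (s/R)^(2m) sup |D^2 v| plus the flux error.  For 4m > n, this and the Hoelder
   continuity of D^2 v give a small pointwise bound, which passes to differences
   of lower order and finally to D^2 v(x + s e_i) - D^2 v(x).  Absorption then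
   yields a Schauder estimate, uniform in the step of the difference quotient,
   without Sobolev spaces or compactness; so D^3 u exists and is Hoelder
   continuous.  Now the equation can be differentiated: the first derivatives of u
   solve linear equations with coefficients b(D^2 u), to which the same estimate
   applies, and induction on the order of differentiability concludes. *)

(** The equation is used in divergence form: its flux is plus or minus the sum of
    [a i j k l M * M i j], whose derivative along symmetric directions is plus or minus b, with the
    sign that makes it elliptic. A constant flux integrates to zero against second derivatives of
    test functions, so after freezing coefficients at a point only the deviation of the flux from a
    constant plus a linear function of the Hessian has to be estimated. The obstacle is that energy
    gives an L^2 bound on a ball of radius M t with M large, whereas a pointwise bound at scale t is
    wanted: the passage costs the volume ratio, of order M^n. Differences of a solution solve the
    differenced equation with the same constant coefficients, so each round gains M^-4 for the
    squared norm, and n + 1 rounds outweigh the loss. Absorption needs some finite Hoelder constant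
    to start from; for a difference quotient of step h it is of order 1/h, which is harmless because
    it does not enter the result. The lower order quantity in the estimate is the sup of first
    derivatives, which for a difference quotient is controlled by second derivatives of the function
    itself. *)

Ltac nneg :=
  repeat match goal with
  | |- is_true (0 <= ?a * ?b)%R => apply: mulr_ge0
  | |- is_true (0 <= ?a + ?b)%R => apply: addr_ge0
  | |- is_true (0 <= ?a ^+ 2)%R => exact: sqr_ge0
  | |- is_true (0 <= ?a ^+ _)%R => apply: exprn_ge0
  | |- is_true (0 <= ?a^-1)%R => rewrite invr_ge0
  | |- is_true (0 <= `|_|)%R => exact: normr_ge0
  | |- is_true (0 <= ?n%:R)%R => exact: ler0n
  end; try assumption; try (by []); try (by apply: ltW).

(** * Continuity, the max norm, and Lebesgue measure on tuples *)

Section continuity.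
Context {R : realType} {T : topologicalType}.
Implicit Types f g : T -> R.

Lemma contC (c : R) : continuous (fun _ : T => c).
Proof. exact: cst_continuous. Qed.

Lemma contD f g : continuous f -> continuous g -> continuous (fun x => f x + g x).
Proof. by move=> cf cg x; apply: cvgD; [exact: cf|exact: cg]. Qed.

Lemma contN f : continuous f -> continuous (fun x => - f x).
Proof. by move=> cf x; apply: cvgN; exact: cf. Qed.

Lemma contB f g : continuous f -> continuous g -> continuous (fun x => f x - g x).
Proof. by move=> cf cg; apply: contD => //; exact: contN. Qed.

Lemma contM f g : continuous f -> continuous g -> continuous (fun x => f x * g x).
Proof. by move=> cf cg x; apply: cvgM; [exact: cf|exact: cg]. Qed.

Lemma contX f k : continuous f -> continuous (fun x => f x ^+ k).
Proof.
move=> cf; elim: k => [|k IH]; first exact: contC.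
by under eq_fun do rewrite exprS; exact: contM.
Qed.

Lemma cont_sum (J : Type) (s : seq J) (F : J -> T -> R) :
  (forall j, continuous (F j)) -> continuous (fun x => \sum_(j <- s) F j x).
Proof.
move=> CF; elim: s => [|j s IH].
  by under eq_fun do rewrite big_nil; exact: contC.
by under eq_fun do rewrite big_cons; exact: contD.
Qed.

Lemma cont_comp f (g : R -> R) : continuous g -> continuous f ->
  continuous (fun x => g (f x)).
Proof. by move=> cg cf x; apply: continuous_comp; [exact: cf|exact: cg]. Qed.

Lemma cont_max f g : continuous f -> continuous g -> continuous (fun x => maxr (f x) (g x)).
Proof. by move=> cf cg x; apply: continuous_max; [exact: cf|exact: cg]. Qed.

End continuity.

Section max_norm.
Context {R : realType} {n : nat}.
Implicit Types x y : 'rV[R]_n.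

Lemma normrV_coord x i : `|x ord0 i| <= `|x|.
Proof.
rewrite [leRHS]/normr /= mx_normrE.
by apply/bigmax_geP; right => /=; exists (ord0, i).
Qed.

Lemma normrV_leP x (c : R) : 0 <= c -> (forall i, `|x ord0 i| <= c) -> `|x| <= c.
Proof.
move=> c0 h; rewrite [leLHS]/normr /= mx_normrE.
by apply/bigmax_leP; split => // -[i j] _ /=; rewrite ord1.
Qed.

Lemma normrV_ltP x (c : R) : 0 < c -> (forall i, `|x ord0 i| < c) -> `|x| < c.
Proof.
move=> c0 h; rewrite [ltLHS]/normr /= mx_normrE.
by apply/bigmax_ltP; split => // -[i j] _ /=; rewrite ord1.
Qed.

Lemma normr_delta (i : 'I_n) : `|delta_mx ord0 i : 'rV[R]_n| = 1.
Proof.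
apply/eqP; rewrite eq_le; apply/andP; split.
  apply: normrV_leP => // j; rewrite mxE /=; case: (j == i) => /=;
  by rewrite ?normr1 ?normr0.
by have := normrV_coord (delta_mx ord0 i) i; rewrite mxE !eqxx normr1.
Qed.

Lemma closed_ball_compactrV x (r : R) : compact [set y : 'rV[R]_n | `|y - x| <= r].
Proof.
apply: bounded_closed_compact.
  exists (`|x| + r); split; first exact: num_real.
  move=> M hM y /= yr; apply: le_trans (ltW hM).
  have -> : y = x + (y - x) by rewrite addrC subrK.
  by apply: le_trans (ler_normD _ _) _; rewrite lerD2l.
have -> : [set y : 'rV[R]_n | `|y - x| <= r] = closed_ball_ normr x r.
  by apply/seteqP; split=> y /=; rewrite distrC.
exact: closed_closed_ball_.
Qed.

Lemma bounded_on_ball (f : 'rV[R]_n -> R) x r : continuous f ->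
  exists2 M : R, 0 <= M & forall y, `|y - x| <= r -> `|f y| <= M.
Proof.
move=> cf; have [r0|r0] := ltP r 0.
  exists 0 => // y yr; have := le_lt_trans yr r0.
  by rewrite normr_lt0.
have [|||c _ hc] := @EVT_max_rV R n (fun y => `|f y|) [set y | `|y - x| <= r].
- by exists x => /=; rewrite subrr normr0.
- exact: closed_ball_compactrV.
- apply: continuous_subspaceT => y; apply: continuous_comp; first exact: cf.
  exact: norm_continuous.
- exists `|f c| => // y yr; apply: hc; by rewrite inE.
Qed.

End max_norm.

Section lebesgue_tuple_theory.
Context (R : realType).
Local Notation RT := (measurableTypeR R).
Local Notation mu n := (lebesgue_tuple R n).

Lemma measurable_box n (A : 'I_n -> set RT) : (forall i, measurable (A i)) ->
  measurable [set t : n.-tuple RT | forall i, A i (tnth t i)].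
Proof.
move=> mA; rewrite (_ : mkset _ =
    \bigcap_(i in [set: 'I_n]) ((fun t => tnth t i) @^-1` A i)).
  apply: fin_bigcap_measurable => // i _.
  by rewrite -[X in measurable X]setTI; exact: measurable_tnth.
by apply/seteqP; split => t /= h i; [move=> _|]; exact: h.
Qed.

Definition cubeT n (x : 'rV[R]_n) (r : R) : set (n.-tuple RT) :=
  [set t | forall i, `]x ord0 i - r, x ord0 i + r[%classic (tnth t i)].

Lemma cubeTE n (x : 'rV[R]_n) (r : R) t : 0 < r ->
  cubeT x r t <-> `|row_of_tuple t - x| < r.
Proof.
move=> r0; split=> h.
  apply: normrV_ltP => // i; have := h i; rewrite /= !mxE in_itv /=.
  by rewrite ltr_distl.
move=> i; rewrite /= in_itv /=; rewrite -ltr_distl.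
have := normrV_coord (row_of_tuple t - x) i; rewrite !mxE => /le_lt_trans; exact.
Qed.

Lemma measurable_cubeT n (x : 'rV[R]_n) r : measurable (cubeT x r).
Proof.
apply: (@measurable_box _ (fun i => `]x ord0 i - r, x ord0 i + r[%classic)) => i.
exact: measurable_itv.
Qed.

Lemma mu_cubeT n (x : 'rV[R]_n) r : 0 < r -> mu n (cubeT x r) = ((2 * r) ^+ n)%:E.
Proof.
move=> r0; rewrite (@lebesgue_tuple_box _ _ (fun i => `]x ord0 i - r, x ord0 i + r[%classic)); last by move=> i; exact: measurable_itv.
transitivity (\prod_(i < n) (2 * r)%:E)%E.
  apply: eq_bigr => i _.
  rewrite lebesgue_measure_itv /= lte_fin ltrD2l.
  rewrite (_ : - r < r = true); last lra.
  by rewrite -EFinB; congr EFin; lra.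
by rewrite prodEFin prodr_const card_ord.
Qed.

Lemma sigma_finite_lebesgue_tuple n : sigma_finite setT (mu n).
Proof.
exists (fun k => cubeT (0 : 'rV[R]_n) k.+1%:R).
  apply/seteqP; split => // t _.
  exists (Num.truncn `|row_of_tuple t|) => //.
  by apply/cubeTE; rewrite ?subr0 ?ltr0Sn// truncnS_gt.
move=> k; split; first exact: measurable_cubeT.
by rewrite mu_cubeT ?ltr0Sn// ltry.
Qed.

(** A constant of its own, to which the sigma-finite structure required by Tonelli's theorem can be
    attached. *)
Definition lebn n : set (n.-tuple RT) -> \bar R := mu n.
Arguments lebn n _ : clear implicits.

HB.instance Definition _ n := Measure.on (lebn n).

HB.instance Definition _ n := @Measure_isSigmaFinite.Build _ _ _ (lebn n)
  (@sigma_finite_lebesgue_tuple n).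

Lemma rat_dense_rV n (x : 'rV[R]_n) (e : R) : 0 < e ->
  exists q : 'rV[rat]_n, `|map_mx ratr q - x| < e.
Proof.
move=> e0.
have h i : exists q : rat, `|ratr q - x ord0 i| < e.
  have [|q] := @rat_in_itvoo R (x ord0 i - e) (x ord0 i + e).
    by rewrite ltrD2l; lra.
  by rewrite in_itv /= -ltr_distl => qe; exists q.
have [q hq] := choice h.
exists (\row_i q i); apply: normrV_ltP => // i.
by rewrite !mxE; exact: hq.
Qed.

(** Tuples carry the product sigma-algebra, not a Borel one. An open set is the union of those cubes
    with rational centre and radius 1/(k+1) that it contains, and these are countably many. *)
Lemma measurable_row_open n (O : set 'rV[R]_n) : open O ->
  measurable [set t : n.-tuple RT | O (row_of_tuple t)].
Proof.
move=> oO.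
pose F (p : 'rV[rat]_n * nat) := let x := map_mx ratr p.1 : 'rV[R]_n in
  let r := (p.2.+1%:R^-1 : R) in
  if `[< ball x r `<=` O >] then cubeT x r else set0.
pose G m := if unpickle m is Some p then F p else set0.
have mG m : measurable (G m).
  rewrite /G; case: unpickle => [p|//]; rewrite /F; case: ifP => // _.
  exact: measurable_cubeT.
rewrite (_ : mkset _ = \bigcup_m G m); first exact: bigcupT_measurable.
apply/seteqP; split => t /=.
  move=> /oO /nbhs_ballP[e /= e0 heO].
  have [k ke] : exists k, 2 * (k.+1%:R^-1 : R) < e.
    exists (Num.truncn (2 / e)); rewrite ltr_pdivrMr ?ltr0Sn//.
    by rewrite mulrC -ltr_pdivrMr// truncnS_gt.
  have k0 : (0 : R) < k.+1%:R^-1 by rewrite invr_gt0 ltr0Sn.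
  have [q hq] := rat_dense_rV (row_of_tuple t) k0.
  exists (pickle (q, k)) => //; rewrite /G pickleK /F /=.
  case: asboolP => [_|].
    by apply/cubeTE => //; rewrite distrC.
  case=> y; rewrite -ball_normE /= => hy; apply: heO.
  rewrite -ball_normE /=.
  apply: le_lt_trans ke; rewrite mulr_natl mulr2n.
  apply: le_trans (ler_distD (map_mx ratr q) _ _) _.
  by apply: lerD; rewrite 1?distrC; apply: ltW => //; rewrite distrC.
move=> [m _]; rewrite /G; case: unpickle => [p|//]; rewrite /F.
case: asboolP => // hO /cubeTE h; apply: hO; rewrite -ball_normE /= distrC.
by apply: h; rewrite invr_gt0 ltr0Sn.
Qed.

Lemma measurable_row n (f : 'rV[R]_n -> R) : continuous f ->
  measurable_fun setT (fun t : n.-tuple RT => f (row_of_tuple t)).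
Proof.
move=> /continuousP cf; apply: (measurability _ (RGenOpens.measurableE R)).
move=> _ [_ [a [b ->] <-]]; rewrite setTI.
apply: (@measurable_row_open _ (f @^-1` `]a, b[%classic)).
by apply: cf; exact: interval_open.
Qed.

End lebesgue_tuple_theory.
Arguments lebn R n _ : clear implicits.

(** * Integration of compactly supported functions on R^n *)

Section translation.
Context (R : realType).
Local Notation RT := (measurableTypeR R).

Lemma ge0_integral_shift1 (a : R) (g : R -> R) : continuous g ->
  (forall x, 0 <= g x) ->
  (\int[@lebesgue_measure R]_x (g (x + a))%:E =
   \int[@lebesgue_measure R]_x (g x)%:E)%E.
Proof.
move=> cg g0.
have dE : derive1 (shift a : R -> R) = cst 1.
  by apply/funext => x; rewrite derive1E; exact: (@derive_val _ _ _ _ _ _ _ (is_derive_shift x 1 a)).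
rewrite [RHS](@increasing_ge0_integration_by_substitutionT R (shift a)) //=.
- by apply: eq_integral => x _; rewrite /= dE fctE /= mulr1.
- by move=> x y xy; rewrite ltrD2r.
- by rewrite dE; exact: contC.
- by rewrite dE; exact: is_cvg_cst.
- by rewrite dE; exact: is_cvg_cst.
- by apply/cvgrNyPle => A; near=> x; rewrite -lerBrDr; near: x; apply: nbhs_ninfty_le; exact: num_real.
- by apply/cvgryPge => A; near=> x; rewrite -lerBlDr; near: x; apply: nbhs_pinfty_ge; exact: num_real.
Unshelve. all: by end_near. Qed.

Definition cons_rV n (x : R) (y : 'rV[R]_n) : 'rV[R]_n.+1 :=
  \row_i (if unlift ord0 i is Some j then y ord0 j else x).

Lemma cvg_at_distP (V W : normedModType R) (f : V -> W) (x : V) :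
  f y @[y --> x] --> f x <->
  forall e, 0 < e -> exists2 d, 0 < d & forall y, `|x - y| < d -> `|f x - f y| < e.
Proof.
split=> [/cvgrPdist_lt cf e /cf|h].
  by move=> /nbhs_ballP[d /= d0 hd]; exists d => // y xy; apply: hd; rewrite -ball_normE.
apply/cvgrPdist_lt => e /h[d d0 hd]; apply/nbhs_ballP; exists d => //= y.
by rewrite -ball_normE => /hd.
Qed.

Lemma continuous_shiftr (V : normedModType R) (g : V -> R) (k : V) :
  continuous g -> continuous (fun x => g (x + k)).
Proof.
move=> cg x; apply: (@continuous_comp _ _ _ (fun x : V => x + k)); last exact: cg.
by apply: cvgD; [exact: cvg_id|exact: cvg_cst].
Qed.

Lemma cons_rVB n x x' (y y' : 'rV[R]_n) :
  `|cons_rV x y - cons_rV x' y'| <= maxr `|x - x'| `|y - y'|.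
Proof.
apply: normrV_leP => [|i]; first by rewrite le_max normr_ge0.
rewrite !mxE; case: unliftP => [j _|_]; rewrite le_max ?lexx//.
by apply/orP; right; have := normrV_coord (y - y') j; rewrite !mxE.
Qed.

Lemma continuous_cons_rV n (f : 'rV[R]_n.+1 -> R) : continuous f ->
  (forall y, continuous (fun x => f (cons_rV x y))) /\
  (forall x, continuous (fun y => f (cons_rV x y))).
Proof.
move=> cf; split=> [y x|x y].
  apply: (@continuous_comp _ _ _ (fun x => cons_rV x y)); last exact: cf.
  apply/cvg_at_distP => e e0; exists e => // z xz.
  by apply: le_lt_trans (cons_rVB _ _ _ _) _; rewrite gt_max subrr normr0 e0 xz.
apply: (@continuous_comp _ _ _ (fun y => cons_rV x y)); last exact: cf.
apply/cvg_at_distP => e e0; exists e => // z xz.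
by apply: le_lt_trans (cons_rVB _ _ _ _) _; rewrite gt_max subrr normr0 e0 xz.
Qed.

Lemma row_of_swap_cons n (t : n.-tuple RT) (x : RT) :
  row_of_tuple (swap_cons (t, x)) = cons_rV x (row_of_tuple t).
Proof.
apply/rowP => i; rewrite !mxE /swap_cons /=.
by case: unliftP => [j ->|-> //]; rewrite !mxE tnthS.
Qed.

Lemma ge0_integral_swap_cons n (f : 'rV[R]_n.+1 -> R) : continuous f ->
  (forall x, 0 <= f x) ->
  (\int[lebn R n.+1]_t (f (row_of_tuple t))%:E =
   \int[lebn R n \x (@lebesgue_measure R)]_z
     (f (cons_rV z.2 (row_of_tuple z.1)))%:E)%E.
Proof.
move=> cf f0.
rewrite (_ : lebn R n.+1 = pushforward (lebn R n \x (@lebesgue_measure R))%E (@swap_cons R n)) //.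
rewrite ge0_integral_pushforward //=.
- by rewrite preimage_setT; apply: eq_integral => -[t x] _ /=; rewrite row_of_swap_cons.
- exact: measurable_swap_cons.
- by apply/measurable_EFinP; exact: measurable_row.
- by move=> y _; rewrite lee_fin.
Qed.

Lemma measurable_cons_row n (f : 'rV[R]_n.+1 -> R) : continuous f ->
  measurable_fun setT ((fun z =>
    (f (cons_rV z.2 (row_of_tuple z.1)))%:E) : n.-tuple RT * RT -> \bar R).
Proof.
move=> cf; apply/measurable_EFinP.
have h := measurableT_comp (measurable_row cf) (@measurable_swap_cons R n).
apply: eq_measurable_fun h => -[t x] _ /=.
by rewrite row_of_swap_cons.
Qed.

(** Induction on the dimension through Tonelli: the first coordinate is shifted in a one-dimensional
    inner integral, the remaining ones by the induction hypothesis. Nonnegativity spares any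
    integrability condition. *)
Lemma ge0_integral_row_shift n (f : 'rV[R]_n -> R) (h : 'rV[R]_n) :
  continuous f -> (forall x, 0 <= f x) ->
  (\int[lebn R n]_t (f (row_of_tuple t + h))%:E =
   \int[lebn R n]_t (f (row_of_tuple t))%:E)%E.
Proof.
elim: n f h => [|n IH] f h cf f0.
  by apply: eq_integral => t _; congr (f _)%:E; apply/rowP => -[].
pose a := h ord0 ord0; pose b : 'rV[R]_n := \row_j h ord0 (lift ord0 j).
have hE x y : cons_rV x y + h = cons_rV (x + a) (y + b).
  by apply/rowP => i; rewrite !mxE; case: unliftP => [j ->|->]; rewrite ?mxE.
rewrite (@ge0_integral_swap_cons _ (fun x => f (x + h))) //; last exact: continuous_shiftr.
rewrite ge0_integral_swap_cons //.
rewrite (fubini_tonelli1 _ (measurable_cons_row (continuous_shiftr (k := h) cf))) //.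
rewrite (fubini_tonelli2 _ (measurable_cons_row cf)) //.
rewrite /fubini_F /fubini_G /=.
transitivity (\int[lebn R n]_x \int[@lebesgue_measure R]_y
   (f (cons_rV y (row_of_tuple x + b)))%:E)%E.
  apply: eq_integral => t _.
  under eq_integral do rewrite hE.
  exact: (@ge0_integral_shift1 a (fun y => f (cons_rV y (row_of_tuple t + b)))
    ((continuous_cons_rV cf).1 _)).
have mf : measurable_fun setT ((fun z =>
    (f (cons_rV z.2 (row_of_tuple z.1 + b)))%:E) : n.-tuple RT * RT -> \bar R).
  have := measurable_cons_row (continuous_shiftr (k := cons_rV 0 b) cf).
  apply: eq_measurable_fun => -[t x] _ /=; congr (f _)%:E.
  by apply/rowP => i; rewrite !mxE; case: unliftP => [j _|_]; rewrite ?mxE ?addr0.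
have f0' z : ((0 : \bar R) <= (f (cons_rV z.2 (row_of_tuple z.1 + b)))%:E)%E by rewrite lee_fin.
(* The integrals are exchanged so that the shift by [b] acts in the inner, [n]-dimensional one. *)
have := etrans (esym (fubini_tonelli1 (m1 := lebn R n) (m2 := @lebesgue_measure R) _ mf f0'))
  (fubini_tonelli2 (m1 := lebn R n) (m2 := @lebesgue_measure R) _ mf f0').
rewrite /fubini_F /fubini_G /= => ->.
apply: eq_integral => x _.
exact: (IH (fun y => f (cons_rV x y)) b ((continuous_cons_rV cf).2 _)).
Unshelve. all: by move=> z; rewrite lee_fin. Qed.

End translation.

Section rn_integral.
Context (R : realType) (n : nat).
Local Notation RT := (measurableTypeR R).
Local Notation V := 'rV[R]_n.
Implicit Types f g : V -> R.

(** Within this class integrability is automatic, so linearity, monotonicity and translation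
    invariance of [I] need no further condition. *)
Definition Cc f := continuous f /\ exists M : R, forall x, M <= `|x| -> f x = 0.

Definition I f : R := \int[lebn R n]_t f (row_of_tuple t).

Lemma integrable_Cc f : Cc f ->
  (lebn R n).-integrable setT (EFin \o (fun t : n.-tuple RT => f (row_of_tuple t))).
Proof.
move=> [cf [M hM]].
pose N := `|M| + 1.
have N0 : 0 < N by rewrite ltr_wpDl.
have /integrable_mkcond : (lebn R n).-integrable (cubeT (0 : V) N)
    (EFin \o (fun t : n.-tuple RT => f (row_of_tuple t))).
  apply: measurable_bounded_integrable.
  - exact: measurable_cubeT.
  - by rewrite [X in (X < _)%E]mu_cubeT// ltry.
  - by apply: measurable_funTS; exact: measurable_row.
  - have [B B0 hB] := bounded_on_ball (0 : V) N cf.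
    exists B; split; first exact: num_real.
    move=> x Bx t /cubeTE h; apply: le_trans (ltW Bx); apply: hB.
    exact/ltW/h.
move=> /(_ (measurable_cubeT _ _)); congr (integrable _ _ _).
apply/funext => t; rewrite /patch; case: ifPn => // /negP ht /=.
rewrite hM// leNgt; apply/negP => tM; apply: ht; rewrite inE.
by apply/cubeTE => //; rewrite subr0 (lt_trans tM)// /N (le_lt_trans (ler_norm _))// ltrDl.
Qed.

Lemma Cc0 : Cc (fun=> 0).
Proof. by split; [exact: cst_continuous|exists 0]. Qed.

Lemma CcD f g : Cc f -> Cc g -> Cc (fun x => f x + g x).
Proof.
move=> [cf [M hM]] [cg [N hN]]; split.
  exact: contD.
by exists (maxr M N) => x; rewrite ge_max => /andP[/hM -> /hN ->]; rewrite addr0.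
Qed.

Lemma CcMl f g : Cc f -> continuous g -> Cc (fun x => f x * g x).
Proof.
move=> [cf [M hM]] cg; split.
  exact: contM.
by exists M => x /hM ->; rewrite mul0r.
Qed.

Lemma CcMr f g : continuous f -> Cc g -> Cc (fun x => f x * g x).
Proof.
move=> cf /CcMl /(_ cf); rewrite (_ : (fun x => g x * f x) = (fun x => f x * g x))//.
by apply/funext => x; rewrite mulrC.
Qed.

Lemma CcZ (c : R) f : Cc f -> Cc (fun x => c * f x).
Proof. by move=> Cf; apply: CcMr => //; exact: contC. Qed.

Lemma CcN f : Cc f -> Cc (fun x => - f x).
Proof.
move=> /(CcZ (-1)); rewrite (_ : (fun x => -1 * f x) = (fun x => - f x))//.
by apply/funext => x; rewrite mulN1r.
Qed.

Lemma CcB f g : Cc f -> Cc g -> Cc (fun x => f x - g x).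
Proof. by move=> Cf Cg; apply: CcD => //; exact: CcN. Qed.

Lemma Cc_sum (J : Type) (s : seq J) (F : J -> V -> R) :
  (forall j, Cc (F j)) -> Cc (fun x => \sum_(j <- s) F j x).
Proof.
move=> CF; elim: s => [|j s IH].
  by under eq_fun do rewrite big_nil; exact: Cc0.
by under eq_fun do rewrite big_cons; exact: CcD.
Qed.

Lemma Cc_shift f (h : V) : Cc f -> Cc (fun x => f (x + h)).
Proof.
move=> [cf [M hM]]; split; first exact: continuous_shiftr.
exists (M + `|h|) => x Mx; apply: hM; rewrite -lerBrDr in Mx.
apply: le_trans Mx _; rewrite lerBlDr.
by rewrite -{1}(addrK h x); exact: ler_normB.
Qed.

Lemma ID f g : Cc f -> Cc g -> I (fun x => f x + g x) = I f + I g.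
Proof. by move=> Cf Cg; rewrite /I RintegralD//; exact: integrable_Cc. Qed.

Lemma IZ c f : Cc f -> I (fun x => c * f x) = c * I f.
Proof. by move=> Cf; rewrite /I RintegralZl//; exact: integrable_Cc. Qed.

Lemma IN f : Cc f -> I (fun x => - f x) = - I f.
Proof.
move=> Cf; rewrite -mulN1r -IZ//; congr I.
by apply/funext => x; rewrite mulN1r.
Qed.

Lemma IB f g : Cc f -> Cc g -> I (fun x => f x - g x) = I f - I g.
Proof. by move=> Cf Cg; rewrite ID ?IN//; exact: CcN. Qed.

Lemma I0 : I (fun=> 0) = 0.
Proof.
rewrite (_ : (fun=> 0) = (fun x : V => 0 * 0)); last by apply/funext => x; rewrite mul0r.
by rewrite (IZ _ Cc0) mul0r.
Qed.

Lemma I_sum (J : Type) (s : seq J) (F : J -> V -> R) :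
  (forall j, Cc (F j)) -> I (fun x => \sum_(j <- s) F j x) = \sum_(j <- s) I (F j).
Proof.
move=> CF; elim: s => [|j s IH].
  rewrite big_nil; transitivity (I (fun=> 0)); last exact: I0.
  by congr I; apply/funext => x; rewrite big_nil.
rewrite big_cons -IH -ID//; last exact: Cc_sum.
by congr I; apply/funext => x; rewrite big_cons.
Qed.

Lemma I_le f g : Cc f -> Cc g -> (forall x, f x <= g x) -> I f <= I g.
Proof.
move=> Cf Cg fg; apply: le_Rintegral => //; try exact: integrable_Cc.
Qed.

Lemma I_ge0 f : (forall x, 0 <= f x) -> 0 <= I f.
Proof. by move=> f0; exact: Rintegral_ge0. Qed.

Lemma I_shift f (h : V) : Cc f -> I (fun x => f (x + h)) = I f.
Proof.
move=> Cf; have Cfh := Cc_shift h Cf.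
have pE (g : V -> R) : Cc g ->
    Cc (fun x => maxr (g x) 0).
  move=> [cg [M hM]]; split.
    by apply: cont_max => //; exact: contC.
  by exists M => x /hM ->; rewrite maxxx.
(* Translation invariance is available for nonnegative integrands, hence the split into positive and
   negative parts. *)
have dE (g : V -> R) : Cc g ->
    I g = I (fun x => maxr (g x) 0) - I (fun x => maxr (- g x) 0).
  move=> Cg; rewrite -IB; [|exact: pE|exact/pE/CcN].
  congr I; apply/funext => x.
  by rewrite /maxr oppr_lt0; case: ltgtP => [_|_|->]; rewrite ?subr0 ?sub0r ?opprK ?oppr0.
rewrite (dE _ Cf) (dE _ Cfh); congr (_ - _).
  rewrite /I /Rintegral; congr fine.
  apply: (@ge0_integral_row_shift _ _ (fun x => maxr (f x) 0)).
    exact: (pE _ Cf).1.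
  by move=> x; rewrite le_max lexx orbT.
rewrite /I /Rintegral; congr fine.
apply: (@ge0_integral_row_shift _ _ (fun x => maxr (- f x) 0)).
  exact: (pE _ (CcN Cf)).1.
by move=> x; rewrite le_max lexx orbT.
Qed.

Lemma I_le_cube f x0 (r c : R) : 0 < r -> 0 <= c -> Cc f ->
  (forall x, f x <= c) -> (forall x, r <= `|x - x0| -> f x <= 0) ->
  I f <= c * (2 * r) ^+ n.
Proof.
move=> r0 c0 Cf fc f0.
have -> : c * (2 * r) ^+ n = \int[lebn R n]_(t in cubeT x0 r) c.
  by rewrite Rintegral_cst ?mu_cubeT//; exact: measurable_cubeT.
rewrite Rintegral_mkcond; apply: le_Rintegral => //.
- exact: integrable_Cc.
- rewrite (_ : EFin \o _ = (EFin \o (fun=> c)) \_ (cubeT x0 r)); last first.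
    by apply/funext => t; rewrite /patch /=; case: ifP.
  apply: (integrable_mkcond _ (measurable_cubeT x0 r)).1.
  apply: measurable_bounded_integrable.
  - exact: measurable_cubeT.
  - by rewrite [X in (X < _)%E]mu_cubeT// ltry.
  - exact: measurable_cst.
  - exists `|c|; split; first exact: num_real.
    by move=> x Bx t _; apply: ltW.
- move=> t _; rewrite /patch; case: ifPn => [_|/negP ht]; first exact: fc.
  apply: f0; rewrite leNgt; apply/negP => h; apply: ht; rewrite inE; exact/cubeTE.
Qed.

Lemma I_ge_cube f x0 (r c : R) : 0 < r -> Cc f ->
  (forall x, 0 <= f x) -> (forall x, `|x - x0| < r -> c <= f x) ->
  c * (2 * r) ^+ n <= I f.
Proof.
move=> r0 Cf f0 fc.
have -> : c * (2 * r) ^+ n = \int[lebn R n]_(t in cubeT x0 r) c.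
  by rewrite Rintegral_cst ?mu_cubeT//; exact: measurable_cubeT.
rewrite Rintegral_mkcond; apply: le_Rintegral => //.
- rewrite (_ : EFin \o _ = (EFin \o (fun=> c)) \_ (cubeT x0 r)); last first.
    by apply/funext => t; rewrite /patch /=; case: ifP.
  apply: (integrable_mkcond _ (measurable_cubeT x0 r)).1.
  apply: measurable_bounded_integrable.
  - exact: measurable_cubeT.
  - by rewrite [X in (X < _)%E]mu_cubeT// ltry.
  - exact: measurable_cst.
  - exists `|c|; split; first exact: num_real.
    by move=> x Bx t _; apply: ltW.
- exact: integrable_Cc.
- move=> t _; rewrite /patch; case: ifPn => [/set_mem/cubeTE h|_]; last exact: f0.
  exact/fc/h.
Qed.

End rn_integral.

(** * Calculus along coordinate directions *)

Section calculus.
Context {R : realType}.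

Lemma is_deriveP (V : normedModType R) (f : V -> R) (x v : V) (d : R) :
  is_derive x v f d <->
  forall e, 0 < e -> exists2 r, 0 < r & forall h, h != 0 -> `|h| < r ->
    `|(f (x + h *: v) - f x) / h - d| < e.
Proof.
have E : (fun h : R => h^-1 *: ((f \o shift x) (h *: v) - f x)) =
         (fun h => (f (x + h *: v) - f x) / h).
  by apply/funext => h /=; rewrite [h *: v + x]addrC -[_ *: _]/(_ * _) mulrC.
split=> [fd e e0|H].
  have := @ex_derive _ _ _ _ _ _ _ fd; rewrite /derivable => /cvg_ex[l].
  move=> hl.
  have ld : l = d.
    by rewrite -(@derive_val _ _ _ _ _ _ _ fd) /derive; apply/esym/cvg_lim.
  move: hl; rewrite E ld => /cvgrPdist_lt /(_ _ e0) /nbhs_ballP[r /= r0 hr].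
  exists r => // h h0 hr'; rewrite distrC; apply: hr => //.
  by rewrite -ball_normE /= sub0r normrN.
have cl : (fun h : R => h^-1 *: ((f \o shift x) (h *: v) - f x)) @ 0^' --> d.
  rewrite E; apply/cvgrPdist_lt => e /H[r r0 hr]; apply/nbhs_ballP; exists r => //= h.
  by rewrite -ball_normE /= sub0r normrN => rh h0; rewrite distrC; exact: hr.
apply: DeriveDef; first by apply/cvg_ex; exists d.
exact: cvg_lim cl.
Qed.

Lemma is_derive_line (V : normedModType R) (f : V -> R) (x v : V) (s d : R) :
  is_derive (x + s *: v) v f d -> is_derive s 1 (fun s : R => f (x + s *: v)) d.
Proof.
move=> /is_deriveP h; apply/is_deriveP => e /h[r r0 hr]; exists r => // k k0 kr.
have -> : x + (s + k *: 1) *: v = x + s *: v + k *: v.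
  by rewrite scalerDl addrA -[k *: 1]/(k * 1) mulr1.
exact: hr.
Qed.

Lemma MVT_line (V : normedModType R) (f df : V -> R) (x v : V) (t : R) :
  (forall s, `|s| <= `|t| -> is_derive (x + s *: v) v f (df (x + s *: v))) ->
  exists2 s, `|s| <= `|t| & f (x + t *: v) - f x = t * df (x + s *: v).
Proof.
have pos (y : V) (t' : R) : 0 < t' ->
  (forall s, 0 <= s <= t' -> is_derive (y + s *: v) v f (df (y + s *: v))) ->
  exists2 s, 0 <= s <= t' & f (y + t' *: v) - f y = t' * df (y + s *: v).
  move=> t0 h.
  have gd s : s \in `]0, t'[ -> is_derive s 1 (fun s : R => f (y + s *: v)) (df (y + s *: v)).
    rewrite in_itv /= => /andP[/ltW s0 /ltW s1].
    by apply: is_derive_line; apply: h; rewrite s0 s1.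
  have [|s] := MVT t0 gd.
    apply: derivable_within_continuous => s; rewrite in_itv /= => hs.
    by apply: (@ex_derive _ _ _ _ _ _ _ (is_derive_line (h _ hs))).
  rewrite in_itv /= subr0 scale0r addr0 => /andP[/ltW s0 /ltW s1] E.
  by exists s; [rewrite s0 s1|rewrite E mulrC].
move=> h; have [t0|t0|->] := ltgtP t 0; last 1 first.
- by exists 0; rewrite // mul0r scale0r addr0 subrr.
- have [||s /andP[s0 st] E] := pos (x + t *: v) (- t).
  + by rewrite oppr_gt0.
  + move=> s /andP[s0 st]; rewrite -addrA -scalerDl; apply: h.
    by rewrite (ltr0_norm t0) ler_norml; lra.
  + exists (t + s); first by rewrite (ltr0_norm t0) ler_norml; lra.
    rewrite scalerDl addrA; move: E; rewrite scaleNr addrK => E; lra.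
- have [|s /andP[s0 st] E] := pos x t t0.
    by move=> s /andP[s0 st]; apply: h; rewrite !ger0_norm//; lra.
  by exists s => //; rewrite !ger0_norm//; lra.
Qed.

Lemma unif_cont_compact (V : normedModType R) (f : V -> R) (A : set V) (e : R) :
  continuous f -> compact A -> 0 < e ->
  exists2 d, 0 < d & forall y z, A y -> `|y - z| < d -> `|f y - f z| < e.
Proof.
move=> cf cA e0.
have := (compact_near_coveringP A).1 cA R (0^'+) (fun d y => forall z, `|y - z| < d -> `|f y - f z| < e) _.
case.
  move=> x Ax.
  have /cvg_at_distP /(_ (e / 2)) := cf x.
  case=> [|d d0 hd]; first by rewrite divr_gt0.
  exists (ball x (d / 2), [set r | r < d / 2]) => /=.
    split; first by apply: nbhsx_ballx; rewrite divr_gt0.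
    by apply: nbhs_right_lt; rewrite divr_gt0.
  move=> [y r] [/=]; rewrite -ball_normE /= => xy rd z yz.
  rewrite -(subrK (f x) (f y)) -addrA (le_lt_trans (ler_normD _ _))//.
  have yd : `|x - y| < d by apply: lt_trans xy _; lra.
  have zd : `|x - z| < d.
    rewrite -(subrK y x) -addrA (le_lt_trans (ler_normD _ _))//; lra.
  by have := hd _ yd; have := hd _ zd; rewrite (distrC (f x) (f y)); lra.
move=> d /= d0 hd; exists (d / 2); first by rewrite divr_gt0.
move=> y z Ay; apply: (hd (d / 2)) => //=; last lra.
  by rewrite sub0r normrN gtr0_norm; lra.
Qed.

End calculus.

Section calculus_rV.
Context {R : realType} {n : nat}.
Local Notation V := 'rV[R]_n.
Local Notation e i := (delta_mx ord0 i : V).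

(** By the mean value theorem the quotient is a value of [f1] nearby, and [f1] is uniformly
    continuous. This uniformity replaces dominated convergence whenever a derivative is taken under
    the integral sign. *)
Lemma unif_diff_quotient (f f1 : V -> R) (v : V) (d : R) : Cc f1 ->
  (forall x, is_derive x v f (f1 x)) -> 0 < d ->
  exists2 r, 0 < r & forall x h, h != 0 -> `|h| < r ->
    `|(f (x + h *: v) - f x) / h - f1 x| < d.
Proof.
move=> [cf1 [M hM]] fd d0.
pose N : R := `|M| + 1 + `|v|.
have [r r0 hr] := @unif_cont_compact R _ f1 _ _ cf1 (@closed_ball_compactrV R n 0 N) d0.
have v0 : 0 < `|v| + 1 by rewrite ltr_wpDl.
exists (minr 1 (r / (`|v| + 1))); first by rewrite lt_min ltr01 divr_gt0.
move=> x h h0; rewrite lt_min => /andP[h1 hlt].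
have [s sh ->] := @MVT_line R _ f f1 x v h (fun s _ => fd (x + s *: v)).
rewrite mulrC mulKf//.
have sv : `|s *: v| <= `|v|.
  by rewrite normrZ ler_piMl//; apply: le_trans sh _; exact: ltW.
have [xN|xN] := leP `|x| N.
  rewrite distrC; apply: hr; first by rewrite /= subr0.
  rewrite opprD addrA subrr sub0r normrN normrZ.
  move: hlt; rewrite ltr_pdivlMr//; apply: le_lt_trans.
  by apply: ler_pM => //; rewrite lerDl.
rewrite (hM x); last by apply: le_trans (ltW xN); rewrite /N -addrA; apply: ler_wpDr (ler_norm _); rewrite addr_ge0.
rewrite (hM (x + s *: v)) ?subrr ?normr0//.
have := ler_normB (x + s *: v) (s *: v); rewrite addrK => h2.
by have := ler_norm M; move: xN; rewrite /N; lra.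
Qed.

(** Peano's form of Schwarz's theorem: existence of the derivative in the other order is part of the
    conclusion. Two mean value theorems turn the mixed double difference into [s * t] times a value
    of [fij] near [x]; then [t] tends to 0 before [s] does. *)
Lemma mixed_derivative (f fi fj fij : V -> R) (vi vj x : V) (r : R) : 0 < r ->
  (forall y, `|y - x| < r -> is_derive y vi f (fi y)) ->
  (forall y, `|y - x| < r -> is_derive y vj f (fj y)) ->
  (forall y, `|y - x| < r -> is_derive y vj fi (fij y)) ->
  {for x, continuous fij} ->
  is_derive x vi fj (fij x).
Proof.
move=> r0 di dj dij /cvg_at_distP cij; apply/is_deriveP => d d0.
have [|r1 r10 hr1] := cij (d / 3); first by rewrite divr_gt0.
pose N : R := `|vi| + `|vj| + 1.
have N0 : 0 < N by rewrite ltr_wpDl// addr_ge0.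
pose r2 : R := minr r r1 / N.
have r20 : 0 < r2 by rewrite divr_gt0// lt_min r0.
have near s t : `|s| < r2 -> `|t| < r2 -> `|s *: vi + t *: vj| < minr r r1.
  move=> sr tr; apply: le_lt_trans (ler_normD _ _) _; rewrite !normrZ.
  have -> : minr r r1 = r2 * N by rewrite divfK// gt_eqF.
  apply: (@le_lt_trans _ _ (r2 * `|vi| + r2 * `|vj|)).
    by apply: lerD; apply: ler_wpM2r => //; exact: ltW.
  by rewrite -mulrDr ltr_pM2l// /N ltrDl.
have nearr s t : `|s| < r2 -> `|t| < r2 -> `|x + s *: vi + t *: vj - x| < r.
  move=> sr tr; rewrite -(addrA x) [x + _]addrC addrK.
  by have := near _ _ sr tr; rewrite lt_min => /andP[].
have r2' : `|0 : R| < r2 by rewrite normr0.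
exists r2 => // s s0 sr.
have step (t : R) : t != 0 -> `|t| < r2 ->
   `|(f (x + s *: vi + t *: vj) - f (x + s *: vi) - (f (x + t *: vj) - f x)) / (s * t) - fij x| < d / 3.
  move=> t0 tr.
  have [|s1 s1s E1] := @MVT_line R _ (fun y => f (y + t *: vj) - f y)
     (fun y => fi (y + t *: vj) - fi y) x vi s.
    move=> s1 s1s.
    have s1r := le_lt_trans s1s sr.
    apply: is_deriveB.
      apply/is_deriveP => d' d'0.
      have /is_deriveP /(_ _ d'0)[r' r'0 hr'] := di _ (nearr _ _ s1r tr).
      exists r' => // h h0 hr2.
      by rewrite [_ + h *: vi + _]addrAC; exact: hr'.
    apply: di; have := nearr _ _ s1r r2'; by rewrite scale0r addr0.
  have s1r := le_lt_trans s1s sr.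
  have [|t1 t1t E2] := @MVT_line R _ fi fij (x + s1 *: vi) vj t.
    move=> t1 t1t; apply: dij; apply: nearr => //; exact: le_lt_trans tr.
  have -> : f (x + s *: vi + t *: vj) - f (x + s *: vi) - (f (x + t *: vj) - f x) =
     s * t * fij (x + s1 *: vi + t1 *: vj) by rewrite E1 E2 mulrA.
  rewrite mulrC mulKf ?mulf_neq0// distrC; apply: hr1.
  rewrite distrC -(addrA x) [x + _]addrC addrK.
  by have := near _ _ s1r (le_lt_trans t1t tr); rewrite lt_min => /andP[].
have sp : 0 < `|s| by rewrite normr_gt0.
(* The errors of the quotients along [vj] will be divided by [s], so they are required to be of size
   [|s|]; this is why [t] is chosen after [s]. *)
have d30 : 0 < d / 3 * `|s| / 2 by rewrite !(divr_gt0, mulr_gt0).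
have /is_deriveP /(_ _ d30)[ra ra0 ha] : is_derive (x + s *: vi) vj f (fj (x + s *: vi)).
  by apply: dj; have := nearr _ _ sr r2'; rewrite scale0r addr0.
have /is_deriveP /(_ _ d30)[rb rb0 hb] : is_derive x vj f (fj x).
  by apply: dj; rewrite subrr normr0.
pose t : R := minr r2 (minr ra rb) / 2.
have m0 : 0 < minr r2 (minr ra rb) by rewrite !lt_min r20 ra0.
have t0 : 0 < t by rewrite divr_gt0.
have : `|t| < minr r2 (minr ra rb) by rewrite gtr0_norm// /t; lra.
rewrite !lt_min => /and3P[t2 ta tb].
have tn : t != 0 by rewrite gt_eqF.
have := step t tn t2; have := ha t tn ta; have := hb t tn tb.
set A := _ / t; set B := _ / t; set D := _ / (s * t).
have -> : D = (B - A) / s.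
  rewrite /D /A /B; field; by rewrite s0 tn.
move=> hB hA hD.
have -> : (fj (x + s *: vi) - fj x) / s - fij x =
  ((B - A) / s - fij x) - (B - fj (x + s *: vi)) / s + (A - fj x) / s.
  by field.
have div_lt z : `|z| < d / 3 * `|s| / 2 -> `|z / s| < d / 3.
  rewrite normrM normfV ltr_pdivrMr// => /lt_le_trans; apply.
  by rewrite ler_pdivrMr// ler_peMr// ?mulr_ge0//; lra.
have := div_lt _ hA; have := div_lt _ hB.
move: hD; rewrite !ltr_norml; lra.
Qed.

(** The derivatives are carried as explicit functions, so that those of products, powers and
    differences are computed rather than merely known to exist. *)
Definition C2 (f : V -> R) (f1 : 'I_n -> V -> R) (f2 : 'I_n -> 'I_n -> V -> R) :=
  [/\ continuous f, forall i, continuous (f1 i), forall i j, continuous (f2 i j),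
      forall i x, is_derive x (e i) f (f1 i x) &
      forall i j x, is_derive x (e j) (f1 i) (f2 i j x)].

Lemma C2_sym f f1 f2 : C2 f f1 f2 -> forall i j x, f2 i j x = f2 j i x.
Proof.
move=> [cf c1 c2 d1 d2] i j x.
have h : is_derive x (e i) (f1 j) (f2 i j x).
  apply: (@mixed_derivative f (f1 i) (f1 j) (f2 i j) (e i) (e j) x 1) => //.
  exact: c2.
by rewrite -(@derive_val _ _ _ _ _ _ _ h) (@derive_val _ _ _ _ _ _ _ (d2 j i x)).
Qed.

Lemma is_derive_shiftr (f : V -> R) (x v h : V) (d : R) :
  is_derive (x + h) v f d -> is_derive x v (fun y => f (y + h)) d.
Proof.
move=> /is_deriveP H; apply/is_deriveP => d' /H[r r0 hr]; exists r => // k k0 kr.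
by rewrite addrAC; exact: hr.
Qed.

Definition dif (h : V) (f : V -> R) : V -> R := fun x => f (x + h) - f x.

Lemma C2_dif f f1 f2 h : C2 f f1 f2 ->
  C2 (dif h f) (fun i => dif h (f1 i)) (fun i j => dif h (f2 i j)).
Proof.
move=> [cf c1 c2 d1 d2]; split.
- by apply: contB => //; exact: continuous_shiftr.
- by move=> i; apply: contB => //; exact: continuous_shiftr.
- by move=> i j; apply: contB => //; exact: continuous_shiftr.
- by move=> i x; apply: is_deriveB => //; exact: is_derive_shiftr.
- by move=> i j x; apply: is_deriveB => //; exact: is_derive_shiftr.
Qed.

Lemma C2Z f f1 f2 (c : R) : C2 f f1 f2 ->
  C2 (fun x => c * f x) (fun i x => c * f1 i x) (fun i j x => c * f2 i j x).
Proof.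
move=> [cf c1 c2 d1 d2]; split.
- by apply: contM => //; exact: contC.
- by move=> i; apply: contM => //; exact: contC.
- by move=> i j; apply: contM => //; exact: contC.
- by move=> i x; apply: is_deriveZ.
- by move=> i j x; apply: is_deriveZ.
Qed.

Lemma is_deriveM1 (W : normedModType R) (f g : W -> R) (x v : W) (df dg : R) :
  is_derive x v f df -> is_derive x v g dg ->
  is_derive x v (fun y => f y * g y) (f x * dg + df * g x).
Proof.
by move=> hf hg; apply: is_derive_eq (is_deriveM hf hg) _; rewrite [df * _]mulrC.
Qed.

Lemma C2M f f1 f2 g g1 g2 : C2 f f1 f2 -> C2 g g1 g2 ->
  C2 (fun x => f x * g x) (fun i x => f x * g1 i x + f1 i x * g x)
     (fun i j x => f x * g2 i j x + f1 j x * g1 i x + (f1 i x * g1 j x + f2 i j x * g x)).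
Proof.
move=> [cf c1 c2 d1 d2] [cg k1 k2 b1 b2]; split.
- exact: contM.
- by move=> i; apply: contD; exact: contM.
- by move=> i j; apply: contD; apply: contD; exact: contM.
- by move=> i x; exact: is_deriveM1.
- by move=> i j x; apply: is_deriveD; exact: is_deriveM1.
Qed.

End calculus_rV.

Section integral_estimates.
Context {R : realType} {n : nat}.
Local Notation V := 'rV[R]_n.
Local Notation e i := (delta_mx ord0 i : V).
Implicit Types f g : V -> R.

Lemma I_norm_le f x0 (r c : R) : 0 < r -> 0 <= c -> Cc f ->
  (forall x, `|f x| <= c) -> (forall x, r <= `|x - x0| -> f x = 0) ->
  `|I f| <= c * (2 * r) ^+ n.
Proof.
move=> r0 c0 Cf fc f0; rewrite ler_norml; apply/andP; split; last first.
  apply: (@I_le_cube R n f x0) => // x; first by apply: le_trans (fc x); exact: ler_norm.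
  by move=> /f0 ->.
rewrite lerNl -IN//; apply: (@I_le_cube R n _ x0) => //; first exact: CcN.
- by move=> x; apply: le_trans (fc x); rewrite -normrN; exact: ler_norm.
- by move=> x /f0 ->; rewrite oppr0.
Qed.

Lemma Cc_radius f : Cc f -> exists2 r, 0 < r & forall x, r <= `|x| -> f x = 0.
Proof.
move=> [cf [M hM]]; exists (`|M| + 1); first by rewrite ltr_wpDl.
move=> x h; apply: hM; apply: le_trans h; have := ler_norm M; lra.
Qed.

Lemma Cc_unif_cont f (d : R) : Cc f -> 0 < d ->
  exists2 r, 0 < r & forall x y, `|x - y| < r -> `|f x - f y| < d.
Proof.
move=> Cf d0; have [M M0 hM] := Cc_radius Cf.
have [r r0 hr] := @unif_cont_compact R _ f _ _ Cf.1 (@closed_ball_compactrV R n 0 (M + 1)) d0.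
exists (minr 1 r); first by rewrite lt_min ltr01.
move=> x y; rewrite lt_min => /andP[h1 hlt].
have [xM|xM] := leP `|x| (M + 1); first by apply: hr => //=; rewrite subr0.
rewrite (hM x) ?(hM y) ?subrr ?normr0//; last lra.
by have := ler_normD y (x - y); rewrite addrC subrK; lra.
Qed.

Lemma Cc_bounded f : Cc f -> exists2 B, 0 <= B & forall x, `|f x| <= B.
Proof.
move=> Cf; have [M M0 hM] := Cc_radius Cf.
have [B B0 hB] := bounded_on_ball 0 M Cf.1; exists B => // x.
have [xM|/ltW/hM ->] := leP `|x| M; last by rewrite normr0.
by apply: hB; rewrite subr0.
Qed.

Lemma derive_support f f1 (v x0 : V) (r : R) :
  (forall x, is_derive x v f (f1 x)) -> (forall x, r <= `|x - x0| -> f x = 0) ->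
  forall x, r < `|x - x0| -> f1 x = 0.
Proof.
move=> fd f0 x xr.
have h0 : is_derive x v f 0.
  apply/is_deriveP => d d0.
  have v0 : 0 < `|v| + 1 by rewrite ltr_wpDl.
  exists ((`|x - x0| - r) / (`|v| + 1)); first by rewrite divr_gt0// subr_gt0.
  move=> h hn; rewrite ltr_pdivlMr// => hlt.
  rewrite (f0 x (ltW xr)) f0; first by rewrite !subr0 mul0r normr0.
  have : `|x - x0| <= `|x + h *: v - x0| + `|h *: v|.
    have -> : x - x0 = x + h *: v - x0 - h *: v by rewrite [RHS]addrAC addrK.
    exact: ler_normB.
  by rewrite normrZ; have := normr_ge0 h; nra.
by rewrite -(@derive_val _ _ _ _ _ _ _ (fd x)) (@derive_val _ _ _ _ _ _ _ h0).
Qed.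

Lemma Cc_derive f f1 (v : V) : Cc f -> continuous f1 ->
  (forall x, is_derive x v f (f1 x)) -> Cc f1.
Proof.
move=> Cf c1 fd; split=> //; have [M M0 hM] := Cc_radius Cf.
exists (M + 1) => x xM; apply: (derive_support (x0 := 0) (r := M) fd) => [y|].
  by rewrite subr0 => /hM.
rewrite subr0; lra.
Qed.

(** The difference quotients of [f] have integral 0 by translation invariance, and they converge
    uniformly to [f1] with supports in a fixed cube. *)
Lemma I_derive0 f f1 (v : V) : Cc f -> continuous f1 ->
  (forall x, is_derive x v f (f1 x)) -> I f1 = 0.
Proof.
move=> Cf c1 fd; have Cf1 := Cc_derive Cf c1 fd.
have [M M0 hM] := Cc_radius Cf; have [M1 M10 hM1] := Cc_radius Cf1.
pose N : R := maxr M M1 + `|v| + 1.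
have v0 := normr_ge0 v.
have N1 : M <= maxr M M1 by rewrite le_max lexx.
have N2 : M1 <= maxr M M1 by rewrite le_max lexx orbT.
have N0 : 0 < N by rewrite /N; lra.
apply/eqP; rewrite -normr_le0; apply/ler_addgt0Pr => d d0; rewrite add0r.
have d1 : 0 < d / (2 * N) ^+ n by rewrite divr_gt0// exprn_gt0// mulr_gt0.
have [r r0 hr] := unif_diff_quotient Cf1 fd d1.
pose h : R := minr 1 r / 2.
have m0 : 0 < minr 1 r by rewrite lt_min ltr01.
have h0 : 0 < h by rewrite divr_gt0.
have : `|h| < minr 1 r by rewrite gtr0_norm// /h; lra.
rewrite lt_min => /andP[h1 hlt].
have Cq : Cc (fun x => (f (x + h *: v) - f x) / h).
  apply: CcMl; last exact: contC.
  by apply: CcB => //; exact: Cc_shift.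
have Iq : I (fun x => (f (x + h *: v) - f x) / h) = 0.
  rewrite (_ : (fun x => _) = (fun x => h^-1 * (f (x + h *: v) - f x))); last first.
    by apply/funext => x; rewrite mulrC.
  rewrite IZ; last by apply: CcB => //; exact: Cc_shift.
  by rewrite IB ?I_shift ?subrr ?mulr0//; exact: Cc_shift.
have -> : I f1 = - I (fun x => (f (x + h *: v) - f x) / h - f1 x).
  by rewrite IB// Iq sub0r opprK.
have -> : d = d / (2 * N) ^+ n * (2 * N) ^+ n by rewrite divfK// gt_eqF// exprn_gt0// mulr_gt0.
rewrite normrN; apply: (@I_norm_le _ 0) => //.
- exact: ltW.
- exact: CcB.
- by move=> x; apply/ltW/hr => //; rewrite gt_eqF.
- move=> x; rewrite subr0 => xN.
  have hv : `|h *: v| <= `|v| by rewrite normrZ ler_piMl// ltW.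
  rewrite (hM x) ?(hM1 x) ?(hM (x + h *: v)) ?subrr ?mul0r ?subr0//; move: xN; rewrite /N; try lra.
  by have := ler_normB (x + h *: v) (h *: v); rewrite addrK; lra.
Qed.

Fixpoint Dk (k : nat) (f : V -> R) : Prop :=
  continuous f /\ if k is k'.+1 then
    forall i, exists2 f1, (forall x, is_derive x (e i) f (f1 x)) & Dk k' f1
  else True.

Lemma Dk_cont k f : Dk k f -> continuous f. Proof. by case: k => [|k] []. Qed.

Lemma Dk_ck k f : Dk k f -> ck (@coord_dirs R n) setT k f.
Proof.
elim: k f => [|k IH] f [cf h]; split=> //; try exact: continuous_subspaceT.
move=> _ [i _ <-]; have [f1 d1 D1] := h i; split.
  by move=> x _; exact: (@ex_derive _ _ _ _ _ _ _ (d1 x)).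
rewrite (_ : (fun x => _) = f1); first exact: IH.
by apply/funext => x; exact: (@derive_val _ _ _ _ _ _ _ (d1 x)).
Qed.

Lemma ck_Dk k f : ck (@coord_dirs R n) setT k f -> Dk k f.
Proof.
elim: k f => [|k IH] f [cf h]; split=> //; try exact/continuous_subspace_setT.
move=> i; have [|d1 D1] := h (e i); first by exists i.
exists (fun x => 'D_(e i) f x); last exact: IH.
by move=> x; apply/derivableP/d1.
Qed.

Lemma smooth_onTP f : smooth_on setT f <-> forall k, Dk k f.
Proof. by split=> h k; [apply/ck_Dk/h|apply/Dk_ck/h]. Qed.

Lemma DkS k f : Dk k.+1 f -> Dk k f.
Proof.
elim: k f => [|k IH] f [cf h]; split=> // i.
by have [f1 d1 D1] := h i; exists f1 => //; exact: IH.
Qed.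

Lemma Dk_cst k (c : R) : Dk k (fun=> c).
Proof.
elim: k c => [|k IH] c; split=> //; try exact: contC.
move=> i; exists (fun=> 0); last exact: IH.
by move=> x; exact: is_derive_cst.
Qed.

Lemma DkD k f g : Dk k f -> Dk k g -> Dk k (fun x => f x + g x).
Proof.
elim: k f g => [|k IH] f g [cf hf] [cg hg]; split=> //; try exact: contD.
move=> i; have [f1 df Df] := hf i; have [g1 dg Dg] := hg i.
exists (fun x => f1 x + g1 x); last exact: IH.
by move=> x; exact: is_deriveD.
Qed.

Lemma DkM k f g : Dk k f -> Dk k g -> Dk k (fun x => f x * g x).
Proof.
elim: k f g => [|k IH] f g Hf Hg; first by split=> //; apply: contM; [case: Hf|case: Hg].
split; first by apply: contM; [case: Hf|case: Hg].
move=> i; have [f1 df Df] := Hf.2 i; have [g1 dg Dg] := Hg.2 i.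
exists (fun x => f x * g1 x + f1 x * g x); first by move=> x; exact: is_deriveM1.
by apply: DkD; apply: IH => //; exact: DkS.
Qed.

Lemma Dk_prod k (J : Type) (s : seq J) (F : J -> V -> R) :
  (forall j, Dk k (F j)) -> Dk k (fun x => \prod_(j <- s) F j x).
Proof.
move=> CF; elim: s => [|j s IH].
  by under eq_fun do rewrite big_nil; exact: Dk_cst.
by under eq_fun do rewrite big_cons; exact: DkM.
Qed.

End integral_estimates.

(** * A smooth flat function *)

Section bump.
Context {R : realType}.

Lemma poly_expRN_bounded (P : {poly R}) :
  exists2 C : R, 0 <= C & forall x, 0 <= x -> `|P.[x]| * expR (- x) <= C.
Proof.
have mono (m : nat) (x : R) : 0 <= x -> x ^+ m * expR (- x) <= m`!%:R.
  move=> x0; rewrite expRN ler_pdivrMr ?expR_gt0//.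
  case: m => [|m]; first by rewrite expr0 fact0 mul1r; have := expR_ge1Dx x; lra.
  have := @expR_ge1Dxn R x m x0; set F := (m.+1`!%:R : R).
  have F0 : 0 < F by rewrite ltr0n fact_gt0.
  move=> h; rewrite mulrC -ler_pdivrMr//; lra.
exists (\sum_(i < size P) `|P`_i| * i`!%:R).
  by apply: sumr_ge0 => i _; rewrite mulr_ge0.
move=> x x0; rewrite horner_coef.
apply: (@le_trans _ _ ((\sum_(i < size P) `|P`_i * x ^+ i|) * expR (- x))).
  by apply: ler_wpM2r; [exact: expR_ge0|exact: ler_norm_sum].
rewrite mulr_suml; apply: ler_sum => i _.
rewrite normrM -mulrA; apply: ler_wpM2l => //.
by rewrite ger0_norm ?exprn_ge0//; exact: mono.
Qed.

(** For [P = 1] this is exp(-1/t). The polynomial factor makes the family stable under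
    differentiation: the derivative of P(1/t) exp(-1/t) has the same form with polynomial X^2 (P -
    P'). *)
Definition flat (P : {poly R}) (t : R) : R :=
  if 0 < t then P.[t^-1] * expR (- t^-1) else 0.

Lemma flat_derive (P : {poly R}) (t : R) : is_derive t 1 (flat P) (flat ('X^2 * (P - P^`())) t).
Proof.
have [t0|t0|->] := ltgtP t 0.
- have -> : flat ('X^2 * (P - P^`())) t = 0 by rewrite /flat ltNge (ltW t0).
  apply: (@near_eq_is_derive _ _ _ (fun=> 0)).
  apply: filterS (lt_nbhsl t0) => s s0.
  by rewrite /flat ltNge (ltW s0).
- apply: (@near_eq_is_derive _ _ _ (fun s : R => P.[s^-1] * expR (- s^-1))).
    by apply: filterS (lt_nbhsr t0) => s s0; rewrite /flat s0.
  have dinv : is_derive t 1 (fun s : R => s^-1) (- t ^- 2).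
    apply: is_derive_eq; first by apply: (@is_deriveV R id t 1 1); rewrite gt_eqF.
    by rewrite /= -[_ *: _]/(_ * _) mulr1.
  have dP := @is_derive1_comp R (horner P) (fun s => s^-1) t _ _ _ dinv.
  have dN : is_derive t 1 (fun s : R => - s^-1) (- - t ^- 2) by exact: is_deriveN.
  have dE := @is_derive1_comp R expR (fun s => - s^-1) t _ _ _ dN.
  apply: is_derive_eq (is_deriveM (dP _ (is_derive_poly _ _)) (dE _ (is_derive_expR _))) _.
  rewrite /flat t0 !hornerE /= -!/(_ * _) /GRing.scale /=.
  have : t != 0 by rewrite gt_eqF.
  move=> tn; field.
  done.
- apply/is_deriveP => d d0.
  (* The factor ['X^2] yields a bound C t^2 on the function itself, hence C t on its quotient at
     0. *)
  have [C C0 hC] := poly_expRN_bounded (P * 'X^2).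
  have C1 : 0 < C + 1 by lra.
  exists (d / (C + 1)); first by rewrite divr_gt0.
  move=> h h0; rewrite ltr_pdivlMr// => hr.
  rewrite /flat ltxx !subr0 add0r -[h *: 1]/(h * 1) mulr1.
  case: (ltP 0 h) => hp; last by rewrite mul0r normr0.
  have hi : 0 <= h^-1 by rewrite invr_ge0 ltW.
  have := hC _ hi; rewrite hornerM hornerXn normrM [`|_ ^+ 2|]ger0_norm ?exprn_ge0//.
  rewrite 2!normrM (ger0_norm hi) (ger0_norm (expR_ge0 _)).
  move: hr; rewrite (gtr0_norm hp) => hr.
  set A := `|_|; set E := expR _ => hA.
  have -> : A * E / h = (A * h^-1 ^+ 2 * E) * h by field.
  have E0 : 0 <= A * h^-1 ^+ 2 * E
    by apply: mulr_ge0; [apply: mulr_ge0; [exact: normr_ge0|exact: exprn_ge0]|exact: expR_ge0].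
  by nra.
Qed.

End bump.

(** * Mollification and weak equations *)

Section chain.
Context {R : realType}.

Lemma is_derive_lineP (V : normedModType R) (f : V -> R) (x v : V) (d : R) :
  is_derive x v f d <-> is_derive (0 : R) 1 (fun s : R => f (x + s *: v)) d.
Proof.
split=> [fd|/is_deriveP h]; first by apply: is_derive_line; rewrite scale0r addr0.
apply/is_deriveP => d' /h[r r0 hr]; exists r => // k k0 kr.
by have := hr k k0 kr; rewrite add0r -[k *: 1]/(k * 1) mulr1 scale0r addr0.
Qed.

Lemma is_derive_comp1 (V : normedModType R) (p : R -> R) (g : V -> R) (x v : V)
    (dp dg : R) :
  is_derive (g x) 1 p dp -> is_derive x v g dg ->
  is_derive x v (fun y => p (g y)) (dp * dg).
Proof.
move=> pd /is_derive_lineP gd; apply/is_derive_lineP.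
apply: (@is_derive1_comp R p (fun s : R => g (x + s *: v))) => //.
by rewrite scale0r addr0.
Qed.

Lemma is_derive1_continuous (p dp : R -> R) :
  (forall t : R, is_derive t 1 p (dp t)) -> continuous p.
Proof.
move=> pd t; apply/differentiable_continuous/derivable1_diffP.
exact: (@ex_derive _ _ _ _ _ _ _ (pd t)).
Qed.

End chain.

Section mollifier.
Context {R : realType} {n : nat}.
Local Notation V := 'rV[R]_n.
Local Notation e i := (delta_mx ord0 i : V).
Implicit Types f g eta phi : V -> R.

Lemma cont_coord (i : 'I_n) : continuous (fun x : V => x ord0 i).
Proof. exact: coord_continuous. Qed.

Lemma is_derive_coord (x : V) (i j : 'I_n) :
  is_derive x (e j) (fun y : V => y ord0 i) (i == j)%:R.
Proof.
apply/is_deriveP => d d0; exists 1 => // h h0 _.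
by rewrite !mxE eqxx /= [x ord0 i + _]addrC addrK mulrC mulKf// subrr normr0.
Qed.

Lemma Dk_flat k P (i : 'I_n) (c s : R) : Dk k (fun x : V => flat P (c + s * x ord0 i)).
Proof.
have caff : continuous (fun x : V => c + s * x ord0 i).
  by apply: contD; [exact: contC|apply: contM; [exact: contC|exact: cont_coord]].
elim: k P => [|k IH] P.
  split=> //; apply: cont_comp => //.
  exact: is_derive1_continuous (flat_derive P).
split; first by apply: cont_comp => //; exact: is_derive1_continuous (flat_derive P).
move=> j; exists (fun x : V => flat ('X^2 * (P - P^`())) (c + s * x ord0 i) * (s * (i == j)%:R)).
  move=> x; apply: is_derive_comp1; first exact: flat_derive.
  rewrite -[X in is_derive _ _ _ X]add0r.
  by apply: is_deriveD; apply: is_deriveZ; exact: is_derive_coord.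
by apply: DkM; [exact: IH|exact: Dk_cst].
Qed.

(** The kernel is a product over coordinates of flat functions of 1 + x_i/d and 1 - x_i/d, which
    vanishes once some |x_i| reaches d. A lower bound on the cube of half the radius makes its
    integral positive, so it can be normalised. *)
Lemma mollifier_exists (d : R) : 0 < d ->
  exists phi : V -> R, [/\ forall k, Dk k phi, Cc phi, forall x, 0 <= phi x,
    forall x, d <= `|x| -> phi x = 0 & I phi = 1].
Proof.
move=> d0.
pose p (x : V) : R := \prod_(i < n) (flat 1 (1 + d^-1 * x ord0 i) * flat 1 (1 + (- d^-1) * x ord0 i)).
have pD k : Dk k p by apply: Dk_prod => i; apply: DkM; exact: Dk_flat.
have flat0 (t : R) : 0 <= flat 1 t.
  by rewrite /flat; case: ifP => // _; rewrite hornerC mul1r expR_ge0.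
have p0 x : 0 <= p x by apply: prodr_ge0 => i _; exact: mulr_ge0.
have ps x : d <= `|x| -> p x = 0.
  move=> dx; have [i hi] : exists i, d <= `|x ord0 i|.
    apply: contrapT => /forallNP h.
    suff : `|x| < d by rewrite ltNge dx.
    apply: normrV_ltP => // i; rewrite ltNge; apply/negP; exact: h.
  rewrite /p (bigD1 i) //=.
  suff -> : flat 1 (1 + d^-1 * x ord0 i) * flat 1 (1 + (- d^-1) * x ord0 i) = 0 by rewrite mul0r.
  move: hi; rewrite ler_normr => /orP[hi|hi].
    rewrite [X in _ * X](_ : _ = 0) ?mulr0// /flat ifF//; apply/negbTE; rewrite -leNgt.
    by rewrite mulNr subr_le0 -ler_pdivrMl ?invr_gt0// invrK mulr1.
  rewrite [X in X * _](_ : _ = 0) ?mul0r// /flat ifF//; apply/negbTE; rewrite -leNgt.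
  by rewrite addrC -lerBrDr sub0r lerNr -mulrN -ler_pdivrMl ?invr_gt0// invrK mulr1.
have Cp : Cc p by split; [exact: Dk_cont (pD 0%N)|exists d].
have plow x : `|x| < d / 2 -> (expR (-2) * expR (-2)) ^+ n <= p x.
  move=> xd; rewrite -[X in _ ^+ X]card_ord -prodr_const.
  apply: ler_prod => i _; rewrite mulr_ge0 ?expR_ge0//=.
  have : `|x ord0 i| < d / 2 by apply: le_lt_trans xd; exact: normrV_coord.
  rewrite ltr_norml => /andP[h1 h2].
  have low (t : R) : 1 / 2 <= t -> expR (-2) <= flat 1 t.
    move=> t2; have t0 : 0 < t by lra.
    rewrite /flat t0 hornerC mul1r ler_expR lerN2.
    by rewrite -[t^-1]mul1r ler_pdivrMr//; lra.
  have dx : d^-1 * x ord0 i <= 1 / 2 by rewrite ler_pdivrMl// ; lra.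
  have dx' : - (1 / 2) <= d^-1 * x ord0 i by rewrite ler_pdivlMl//; lra.
  by apply: ler_pM; rewrite ?expR_ge0//; apply: low; rewrite ?mulNr; lra.
have Ip : 0 < I p.
  have d2 : 0 < d / 2 by rewrite divr_gt0.
  apply: lt_le_trans (I_ge_cube (x0 := 0) d2 Cp p0 _); last first.
    by move=> x; rewrite subr0; exact: plow.
  by rewrite mulr_gt0// exprn_gt0// mulr_gt0// expR_gt0.
exists (fun x : V => (I p)^-1 * p x); split.
- by move=> k; apply: DkM => //; exact: Dk_cst.
- exact: CcZ.
- by move=> x; rewrite mulr_ge0// invr_ge0 ltW.
- by move=> x /ps ->; rewrite mulr0.
- by rewrite IZ// mulVf// gt_eqF.
Qed.

(** The kernel is phi(y - x) and not phi(x - y), so no evenness of [phi] is involved; the price is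
    the minus sign in [moll_derive]. *)
Definition moll phi g (x : V) : R := I (fun y => phi (y - x) * g y).

Lemma Cc_moll phi g x : continuous phi -> Cc g -> Cc (fun y => phi (y - x) * g y).
Proof. by move=> cp Cg; apply: CcMr => //; exact: (@continuous_shiftr R V phi (- x)). Qed.

Lemma moll_kernel_close phi1 phi2 g (c : R) : continuous phi1 -> continuous phi2 ->
  Cc g -> 0 < c -> exists2 d, 0 < d & forall x x',
  (forall y, `|phi1 (y - x) - phi2 (y - x')| <= d) ->
  `|I (fun y => phi1 (y - x) * g y) - I (fun y => phi2 (y - x') * g y)| < c.
Proof.
move=> c1 c2 Cg c0; have [B B0 hB] := Cc_bounded Cg.
have [M M0 hM] := Cc_radius Cg.
have M2 : 0 < (2 * M) ^+ n by rewrite exprn_gt0// mulr_gt0.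
have BM : 0 < (B + 1) * (2 * M) ^+ n by rewrite mulr_gt0//; lra.
exists (c / 2 / ((B + 1) * (2 * M) ^+ n)); first by rewrite !divr_gt0.
set d := _ / _ => x x' hd.
have d0 : 0 < d by rewrite !divr_gt0.
rewrite -IB; [|exact: Cc_moll..].
apply: (@le_lt_trans _ _ (d * (B + 1) * (2 * M) ^+ n)); last first.
  rewrite -mulrA /d divfK ?gt_eqF//; lra.
apply: (@I_norm_le _ _ _ 0) => //.
- by apply: mulr_ge0; [exact: ltW|lra].
- by apply: CcB; exact: Cc_moll.
- move=> y; rewrite -mulrBl normrM; apply: ler_pM => //.
  by have := hB y; lra.
- by move=> y; rewrite subr0 => /hM ->; rewrite !mulr0 subrr.
Qed.

Lemma moll_derive phi phi1 g i : Cc phi -> Cc phi1 -> Cc g ->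
  (forall x, is_derive x (e i) phi (phi1 x)) ->
  forall x, is_derive x (e i) (moll phi g) (moll (fun y => - phi1 y) g x).
Proof.
move=> Cp Cp1 Cg pd x; apply/is_deriveP => c c0.
have [B B0 hB] := Cc_bounded Cg; have [M M0 hM] := Cc_radius Cg.
have M2 : 0 < (2 * M) ^+ n by rewrite exprn_gt0// mulr_gt0.
have BM : 0 < (B + 1) * (2 * M) ^+ n by rewrite mulr_gt0//; lra.
have dd0 : 0 < c / 2 / ((B + 1) * (2 * M) ^+ n) by rewrite !divr_gt0.
have [r r0 hr] := unif_diff_quotient Cp1 pd dd0.
exists r => // h h0 hlt; rewrite /moll.
have cN : continuous (fun y => - phi1 y) by apply: contN; exact: Cp1.1.
have Cq : Cc (fun y => h^-1 * (phi (y - (x + h *: e i)) * g y - phi (y - x) * g y)).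
  by apply: CcZ; apply: CcB; apply: Cc_moll => //; exact: Cp.1.
rewrite [_ / h]mulrC -IB; [|by apply: Cc_moll => //; exact: Cp.1..].
rewrite -IZ; last by apply: CcB; apply: Cc_moll => //; exact: Cp.1.
rewrite -IB//; last by apply: (Cc_moll x cN Cg).
apply: (@le_lt_trans _ _ (c / 2 / ((B + 1) * (2 * M) ^+ n) * (B + 1) * (2 * M) ^+ n)); last first.
  rewrite -mulrA divfK ?gt_eqF//; lra.
apply: (@I_norm_le _ _ _ 0) => //.
- by apply: mulr_ge0; [exact: ltW|lra].
- by apply: CcB => //; apply: (Cc_moll x cN Cg).
- move=> y; rewrite -mulrBl mulrA -mulrBl normrM; apply: ler_pM => //; last first.
    by have := hB y; lra.
  have hN : - h != 0 by rewrite oppr_eq0.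
  have := hr (y - x) (- h) hN; rewrite normrN => /(_ hlt) /ltW.
  have -> : y - (x + h *: e i) = y - x + - h *: e i by rewrite opprD addrA scaleNr.
  rewrite -normrN; congr (`|_| <= _).
  by rewrite invrN; ring.
- by move=> y; rewrite subr0 => /hM ->; rewrite !mulr0 subrr mulr0 subrr.
Qed.

Lemma cont_moll phi g : Cc phi -> Cc g -> continuous (moll phi g).
Proof.
move=> Cp Cg x; apply/cvg_at_distP => c c0.
have [d d0 hd] := moll_kernel_close Cp.1 Cp.1 Cg c0.
have [r r0 hr] := Cc_unif_cont Cp d0.
exists r => // y xy; apply: hd => z; apply/ltW/hr.
by rewrite opprB addrC addrA subrK distrC.
Qed.

Lemma Dk_moll k phi g : (forall k, Dk k phi) -> Cc phi -> Cc g -> Dk k (moll phi g).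
Proof.
elim: k phi => [|k IH] phi Dp Cp Cg; first by split=> //; exact: cont_moll.
split; first exact: cont_moll.
move=> i; have [_ /(_ i)[phi1 pd D1]] := Dp k.+1.
have Cp1 : Cc phi1 by exact: Cc_derive Cp (Dk_cont D1) pd.
exists (moll (fun y => - phi1 y) g); first exact: moll_derive.
apply: IH => //; last exact: CcN.
move=> m; have [_ /(_ i)[phi2 pd2 D2]] := Dp m.+1.
have -> : phi1 = phi2.
  apply/funext => y.
  by rewrite -(@derive_val _ _ _ _ _ _ _ (pd y)) (@derive_val _ _ _ _ _ _ _ (pd2 y)).
have := DkM (Dk_cst m (-1)) D2; rewrite (_ : (fun x => -1 * _) = (fun y => - phi2 y))//.
by apply/funext => y; rewrite mulN1r.
Qed.

Lemma mollE phi g x : Cc phi -> Cc g -> moll phi g x = I (fun y => phi y * g (y + x)).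
Proof.
move=> Cp Cg; rewrite /moll -(I_shift x); last exact: Cc_moll Cp.1 Cg.
by congr I; apply/funext => y; rewrite addrK.
Qed.

(** In [moll_derive] the derivative falls on the kernel, which gives smoothness. Here it falls on
    [g], which makes second derivatives of a mollified test function uniformly close to the original
    ones. *)
Lemma moll_derive2 phi g g1 i : Cc phi -> Cc g -> Cc g1 ->
  (forall x, is_derive x (e i) g (g1 x)) ->
  forall x, is_derive x (e i) (moll phi g) (moll phi g1 x).
Proof.
move=> Cp Cg Cg1 gd x; apply/is_deriveP => c c0.
have [B B0 hB] := Cc_bounded Cp; have [M M0 hM] := Cc_radius Cp.
have M2 : 0 < (2 * M) ^+ n by rewrite exprn_gt0// mulr_gt0.
have BM : 0 < (B + 1) * (2 * M) ^+ n by rewrite mulr_gt0//; lra.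
have dd0 : 0 < c / 2 / ((B + 1) * (2 * M) ^+ n) by rewrite !divr_gt0.
have [r r0 hr] := unif_diff_quotient Cg1 gd dd0.
exists r => // h h0 hlt; rewrite !mollE//.
have CM (f : V -> R) z : continuous f -> Cc (fun y => phi y * f (y + z)).
  by move=> cf; apply: CcMl => //; exact: continuous_shiftr.
have Cg' := Cg.1; have Cg1' := Cg1.1.
rewrite [_ / h]mulrC -IB ?CM//.
rewrite -IZ; last by apply: CcB; exact: CM.
have Cq : Cc (fun y => h^-1 * (phi y * g (y + (x + h *: e i)) - phi y * g (y + x))).
  by apply: CcZ; apply: CcB; exact: CM.
rewrite -IB ?CM//.
apply: (@le_lt_trans _ _ (c / 2 / ((B + 1) * (2 * M) ^+ n) * (B + 1) * (2 * M) ^+ n)); last first.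
  rewrite -mulrA divfK ?gt_eqF//; lra.
apply: (@I_norm_le _ _ _ 0) => //.
- by apply: mulr_ge0; [exact: ltW|lra].
- by apply: CcB => //; exact: CM.
- move=> y; rewrite -mulrBr mulrCA -mulrBr normrM [leRHS]mulrC; apply: ler_pM => //.
    by have := hB y; lra.
  by have := hr (y + x) h h0 hlt; rewrite mulrC addrA => /ltW.
- by move=> y; rewrite subr0 => /hM ->; rewrite !mul0r subrr mulr0 subrr.
all: exact: CM.
Qed.

Lemma moll_close phi g (d c : R) : Cc phi -> Cc g -> (forall x, 0 <= phi x) ->
  (forall x, d <= `|x| -> phi x = 0) -> I phi = 1 ->
  (forall x y, `|x - y| < d -> `|g x - g y| < c) -> forall x, `|moll phi g x - g x| <= c.
Proof.
move=> Cp Cg p0 ps Ip gc x; rewrite mollE//.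
have CM : Cc (fun y => phi y * g (y + x)).
  by apply: CcMl => //; apply: continuous_shiftr; exact: Cg.1.
have cc (y : V) : `|phi y * g (y + x) - g x * phi y| <= c * phi y.
  rewrite [g x * _]mulrC -mulrBr normrM ger0_norm// mulrC.
  have [yd|/ps ->] := ltP `|y| d; last by rewrite !mulr0.
  by apply: ler_wpM2r => //; apply/ltW/gc; rewrite addrK.
rewrite -[g x]mulr1 -Ip -IZ// -IB//; last exact: CcZ.
have Cd : Cc (fun y => phi y * g (y + x) - g x * phi y) by apply: CcB => //; exact: CcZ.
have -> : c = I (fun y => c * phi y) by rewrite IZ// Ip mulr1.
rewrite ler_norml; apply/andP; split; last first.
  by apply: I_le => //; [exact: CcZ|move=> y; apply: le_trans (cc y); exact: ler_norm].
rewrite lerNl -IN//; apply: I_le; [exact: CcN|exact: CcZ|].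
by move=> y; apply: le_trans (cc y); rewrite -normrN; exact: ler_norm.
Qed.

End mollifier.

Section finite_choice.
Context {R : realType}.

(** Together with [finite_upper], this makes radii and bounds uniform in the tensor indices. *)
Lemma finite_lower (J : finType) (P : J -> R -> Prop) :
  (forall j r r', 0 < r' -> r' <= r -> P j r -> P j r') ->
  (forall j, exists2 r, 0 < r & P j r) -> exists2 r, 0 < r & forall j, P j r.
Proof.
move=> mono h.
have h' j : exists r, 0 < r /\ P j r by have [r] := h j; exists r.
have [f hf] := choice h'.
have m0 : 0 < \big[minr/1]_j f j by apply/bigmin_gtP; split => // j _; case: (hf j).
exists (\big[minr/1]_j f j) => // j.
by apply: mono (hf j).2 => //; exact: bigmin_le.
Qed.

Lemma finite_upper (J : finType) (P : J -> R -> Prop) :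
  (forall j r r', r <= r' -> P j r -> P j r') ->
  (forall j, exists r, P j r) -> exists2 r, 0 <= r & forall j, P j r.
Proof.
move=> mono h; have [f hf] := choice h.
exists (\sum_j `|f j|); first exact: sumr_ge0.
move=> j; apply: mono (hf j); rewrite (bigD1 j) //=.
by apply: le_trans (ler_norm _) _; rewrite lerDl; exact: sumr_ge0.
Qed.

End finite_choice.

(** * Weak equations and their test functions *)

Section weak_equations.
Context {R : realType} {n : nat}.
Local Notation V := 'rV[R]_n.
Local Notation e i := (delta_mx ord0 i : V).
Implicit Types (Phi : 'I_n -> 'I_n -> V -> R).

(** The integral runs over the whole space: second derivatives of test functions vanish off [O], so
    the values of [Phi] there do not matter. *)
Definition WE (O : set V) Phi := forall eta, test_function O eta ->
  I (fun x => \sum_k \sum_l Phi k l x * pd2 k l eta x) = 0.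

(* Same as [WE] on a ball, but with test functions that are only C^2, which
   allows powers of cutoffs times the solution. *)
Definition WEc (x0 : V) (r : R) Phi := forall eta eta1 eta2, C2 eta eta1 eta2 ->
  (forall x, r <= `|x - x0| -> eta x = 0) ->
  I (fun x => \sum_k \sum_l Phi k l x * eta2 k l x) = 0.

Lemma pd2_C2 (f : V -> R) f1 f2 i j x : C2 f f1 f2 -> pd2 i j f x = f2 i j x.
Proof.
move=> [_ _ _ d1 d2]; rewrite /pd2.
rewrite (_ : (fun y => _) = f1 i); last first.
  by apply/funext => y; exact: (@derive_val _ _ _ _ _ _ _ (d1 i y)).
exact: (@derive_val _ _ _ _ _ _ _ (d2 i j x)).
Qed.

Lemma Cc_ball (f : V -> R) (x0 : V) r : continuous f -> (forall x, r <= `|x - x0| -> f x = 0) -> Cc f.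
Proof.
move=> cf hf; split=> //; exists (r + `|x0|) => x h; apply: hf.
by have := ler_normD (x - x0) x0; rewrite subrK; lra.
Qed.

Lemma C2_Cc (eta : V -> R) eta1 eta2 x0 r : C2 eta eta1 eta2 ->
  (forall x, r <= `|x - x0| -> eta x = 0) ->
  [/\ Cc eta, forall i, Cc (eta1 i) & forall i j, Cc (eta2 i j)].
Proof.
move=> [c0 c1 c2 d1 d2] h.
have C0 := Cc_ball c0 h.
have C1 i : Cc (eta1 i) by exact: Cc_derive C0 (c1 i) (d1 i).
by split=> // i j; exact: Cc_derive (C1 i) (c2 i j) (d2 i j).
Qed.

Lemma C2_support (eta : V -> R) eta1 eta2 x0 r : C2 eta eta1 eta2 ->
  (forall x, r <= `|x - x0| -> eta x = 0) ->
  forall i j x, r < `|x - x0| -> eta2 i j x = 0.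
Proof.
move=> [c0 c1 c2 d1 d2] h i j x rx.
pose r' : R := (r + `|x - x0|) / 2.
apply: (derive_support (r := r') (d2 i j)); last by rewrite /r'; lra.
move=> y yr; apply: (derive_support (d1 i) h); apply: lt_le_trans yr; rewrite /r'; lra.
Qed.

Lemma Cc_sum2 (F : 'I_n -> 'I_n -> V -> R) : (forall k l, Cc (F k l)) ->
  Cc (fun x => \sum_k \sum_l F k l x).
Proof. by move=> h; apply: Cc_sum => k; exact: Cc_sum. Qed.

(* Mollifying the C^2 test functions extends the weak equation to them. *)
Lemma WE_local (O : set V) Phi Phi' (x0 : V) (r r0 : R) : 0 < r -> r < r0 ->
  (forall x, `|x - x0| <= r0 -> O x) ->
  (forall k l, continuous (Phi' k l)) ->
  (forall k l x, `|x - x0| <= r0 -> Phi' k l x = Phi k l x) ->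
  WE O Phi -> WEc x0 r Phi'.
Proof.
move=> rp rr0 hO cP eP we eta eta1 eta2 C2e supp.
have [Ce C1 C2'] := C2_Cc C2e supp.
have CP k l : Cc (fun x => Phi' k l x * eta2 k l x) by exact: CcMr.
apply/eqP; rewrite -normr_le0; apply/ler_addgt0Pr => c c0; rewrite add0r.
have [B B0 hB] : exists2 B, 0 <= B & forall kl : 'I_n * 'I_n, forall x, `|x - x0| <= r0 -> `|Phi' kl.1 kl.2 x| <= B.
  apply: finite_upper => [kl b b' bb h x xr|kl]; first by apply: le_trans (h x xr) bb.
  by have [b b0 hb] := bounded_on_ball x0 r0 (cP kl.1 kl.2); exists b.
have r00 : 0 < r0 by lra.
have vol0 : 0 < (2 * r0) ^+ n by rewrite exprn_gt0// mulr_gt0.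
(* If the second derivatives move by at most [c / K], the n^2 terms, bounded by [B] and integrated
   over the cube of radius [r0], change the integral by at most [c]. *)
pose K : R := (n%:R * n%:R * B + 1) * (2 * r0) ^+ n.
have n2 : 0 <= n%:R * n%:R * B by rewrite !mulr_ge0.
have K0 : 0 < K by rewrite /K mulr_gt0//; lra.
have cK : 0 < c / K by rewrite divr_gt0.
have [d d0 hd] : exists2 d, 0 < d & forall kl : 'I_n * 'I_n, forall x y, `|x - y| < d ->
    `|eta2 kl.1 kl.2 x - eta2 kl.1 kl.2 y| < c / K.
  apply: finite_lower => [kl s s' s0 ss h x y xy|kl]; first by apply: h; exact: lt_le_trans ss.
  by have [s s0 hs] := Cc_unif_cont (C2' kl.1 kl.2) cK; exists s.
(* The second bound keeps the support of the mollified function inside the ball of radius [r0]. *)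
pose d' := minr d ((r0 - r) / 2).
have d'0 : 0 < d' by rewrite lt_min d0 /= divr_gt0// subr_gt0.
have d'd : d' <= d by rewrite ge_min lexx.
have d'r : d' <= (r0 - r) / 2 by rewrite ge_min lexx orbT.
have [phi [Dphi Cphi phi0 phis Iphi]] := @mollifier_exists R n d' d'0.
have C2m : C2 (moll phi eta) (fun i => moll phi (eta1 i)) (fun i j => moll phi (eta2 i j)).
  have [_ _ _ d1 d2] := C2e; split=> *; try exact: cont_moll.
    exact: moll_derive2.
  exact: moll_derive2.
have moll_supp (g : V -> R) s x : (forall y, s < `|y - x0| -> g y = 0) -> s + d' < `|x - x0| -> moll phi g x = 0.
  move=> gs xs; rewrite /moll -[RHS](I0 R n); congr I; apply/funext => y.
  have [yx|/phis ->] := ltP `|y - x| d'; last by rewrite mul0r.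
  rewrite (gs y) ?mulr0//.
  have := ler_normB (y - x0) (y - x); rewrite opprB addrC addrA subrK; lra.
have test : test_function O (moll phi eta).
  have sub : closure [set x | moll phi eta x != 0] `<=` closed_ball_ normr x0 (r + d').
    rewrite [X in _ `<=` X](closure_id _).1; last exact: closed_closed_ball_.
    apply: closureS => x /=; apply: contraNT; rewrite -ltNge distrC => h; apply/eqP.
    by apply: (moll_supp eta r) => // y yr; apply: supp; exact: ltW.
  split.
  - by apply/smooth_onTP => k; exact: Dk_moll.
  - apply: (@subclosed_compact _ _ [set y | `|y - x0| <= r + d']); first exact: closed_closure.
      exact: closed_ball_compactrV.
    by move=> y /sub; rewrite /= /closed_ball_ /= distrC.
  - by move=> y /sub; rewrite /closed_ball_ /= distrC => h; apply: hO; lra.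
have we0 := we _ test.
have m0 k l x : r0 <= `|x - x0| -> moll phi (eta2 k l) x = 0.
  move=> xr; apply: (moll_supp _ r); last by lra.
  by move=> y yr; exact: (C2_support C2e supp).
have e0 k l x : r0 <= `|x - x0| -> eta2 k l x = 0.
  by move=> xr; apply: (C2_support C2e supp); lra.
have {}we0 : I (fun x => \sum_k \sum_l Phi' k l x * moll phi (eta2 k l) x) = 0.
  rewrite -[RHS]we0; congr I; apply/funext => x; apply: eq_bigr => k _; apply: eq_bigr => l _.
  rewrite (pd2_C2 k l x C2m); have [xr|/ltW xr] := leP `|x - x0| r0; first by rewrite eP.
  by rewrite m0// !mulr0.
have Cm k l : Cc (moll phi (eta2 k l)).
  by apply: (@Cc_ball _ x0 r0); [exact: cont_moll|exact: m0].
rewrite -[X in `|X|]subr0 -[X in _ - X]we0 -IB; [|apply: Cc_sum2 => k l; exact: CcMr..].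
have -> : c = c / K * (n%:R * n%:R * B + 1) * (2 * r0) ^+ n.
  by rewrite -mulrA -/K divfK// gt_eqF.
apply: (@I_norm_le _ _ _ x0) => //.
- by rewrite mulr_ge0 ?(ltW cK)//; lra.
- by apply: CcB; apply: Cc_sum2 => k l; exact: CcMr.
- move=> x; rewrite -sumrB.
  have [xr|/ltW xr] := leP `|x - x0| r0; last first.
    rewrite big1 ?normr0; first by rewrite mulr_ge0 ?(ltW cK)//; lra.
    by move=> k _; rewrite -sumrB big1// => l _; rewrite m0// e0// !mulr0 subrr.
  apply: le_trans (ler_norm_sum _ _ _) _.
  apply: (@le_trans _ _ (\sum_(k < n) \sum_(l < n) B * (c / K))).
    apply: ler_sum => k _; rewrite -sumrB; apply: le_trans (ler_norm_sum _ _ _) _.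
    apply: ler_sum => l _; rewrite -mulrBr normrM; apply: ler_pM => //; first exact: (hB (k, l)).
    rewrite distrC; apply: (@moll_close R n phi _ d') => // y z yz.
    by apply: (hd (k, l)); exact: lt_le_trans d'd.
  rewrite !sumr_const !card_ord -[leLHS]mulr_natl -[X in _ * X <= _]mulr_natl.
  have := ltW cK; lra.
- move=> x xr; rewrite -sumrB big1// => k _; rewrite -sumrB big1// => l _.
  by rewrite m0// e0// !mulr0 subrr.
Qed.

(** The translation is moved onto the test function, which must remain supported in the ball; hence
    the loss of [|h|] in the radius. *)
Lemma WEc_dif x0 r Phi h : (forall k l, continuous (Phi k l)) ->
  WEc x0 r Phi -> WEc x0 (r - `|h|) (fun k l => dif h (Phi k l)).
Proof.
move=> cP we eta eta1 eta2 C2e supp; have [Ce C1 C2'] := C2_Cc C2e supp.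
have shifted : I (fun x => \sum_k \sum_l Phi k l x * eta2 k l (x - h)) = 0.
  apply: (we (fun x => eta (x - h)) (fun i x => eta1 i (x - h)) (fun i j x => eta2 i j (x - h))).
    have [c0 c1 c2 d1 d2] := C2e; split.
    - exact: continuous_shiftr.
    - by move=> i; exact: continuous_shiftr.
    - by move=> i j; exact: continuous_shiftr.
    - by move=> i x; exact: is_derive_shiftr.
    - by move=> i j x; exact: is_derive_shiftr.
  move=> x xr; apply: supp; rewrite lerBlDr.
  apply: le_trans xr _; have -> : x - x0 = x - h - x0 + h by rewrite addrAC subrK.
  exact: ler_normD.
have unshifted : I (fun x => \sum_k \sum_l Phi k l x * eta2 k l x) = 0.
  by apply: we C2e _ => x xr; apply: supp; have := normr_ge0 h; lra.
have Cp k l : Cc (fun x => Phi k l x * eta2 k l x) by exact: CcMr.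
have Cp' k l : Cc (fun x => Phi k l (x + h) * eta2 k l x).
  by apply: CcMr => //; exact: continuous_shiftr.
transitivity (I (fun x => \sum_k \sum_l Phi k l (x + h) * eta2 k l x) -
   I (fun x => \sum_k \sum_l Phi k l x * eta2 k l x)).
  rewrite -IB; [|exact: Cc_sum2..].
  congr I; apply/funext => x; rewrite -sumrB; apply: eq_bigr => k _.
  by rewrite -sumrB; apply: eq_bigr => l _; rewrite -mulrBl.
rewrite unshifted subr0 -[RHS]shifted.
rewrite -[RHS](I_shift h); last first.
  apply: Cc_sum2 => k l; apply: CcMr => //.
  exact: (@Cc_shift R n (eta2 k l) (- h)).
by congr I; apply/funext => x /=; rewrite addrK.
Qed.

Lemma WEc_le x0 x1 (r r1 : R) Phi : (forall x, r1 <= `|x - x0| -> r <= `|x - x1|) ->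
  WEc x0 r1 Phi -> WEc x1 r Phi.
Proof.
by move=> h we eta eta1 eta2 C2e supp; apply: we C2e _ => x /h; exact: supp.
Qed.

(** Second derivatives of a compactly supported function have integral 0. This is what allows the
    constants [Phi0] of a frozen flux to be subtracted. *)
Lemma WEc_cst x0 r (Phi0 : 'I_n -> 'I_n -> R) : WEc x0 r (fun k l _ => Phi0 k l).
Proof.
move=> eta eta1 eta2 C2e supp; have [Ce C1 C2'] := C2_Cc C2e supp.
rewrite I_sum; last by move=> k; apply: Cc_sum => l; exact: CcZ.
rewrite big1// => k _; rewrite I_sum; last by move=> l; exact: CcZ.
rewrite big1// => l _; rewrite IZ//.
have -> : I (eta2 k l) = 0; last by rewrite mulr0.
by case: C2e => _ _ c2 _ d2; exact: (@I_derive0 _ _ (eta1 k) _ (e l)).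
Qed.

Lemma WEcB x0 r Phi Phi' : (forall k l, continuous (Phi k l)) ->
  (forall k l, continuous (Phi' k l)) -> WEc x0 r Phi -> WEc x0 r Phi' ->
  WEc x0 r (fun k l x => Phi k l x - Phi' k l x).
Proof.
move=> cP cP' we we' eta eta1 eta2 C2e supp; have [Ce C1 C2'] := C2_Cc C2e supp.
transitivity (I (fun x => \sum_k \sum_l Phi k l x * eta2 k l x) -
   I (fun x => \sum_k \sum_l Phi' k l x * eta2 k l x)).
  rewrite -IB; [|by apply: Cc_sum2 => k l; exact: CcMr..].
  congr I; apply/funext => x; rewrite -sumrB; apply: eq_bigr => k _.
  by rewrite -sumrB; apply: eq_bigr => l _; rewrite -mulrBl.
by rewrite (we _ _ _ C2e supp) (we' _ _ _ C2e supp) subrr.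
Qed.

Lemma WEcZ x0 r Phi (c : R) : (forall k l, continuous (Phi k l)) ->
  WEc x0 r Phi -> WEc x0 r (fun k l x => c * Phi k l x).
Proof.
move=> cP we eta eta1 eta2 C2e supp; have [Ce C1 C2'] := C2_Cc C2e supp.
transitivity (c * I (fun x => \sum_k \sum_l Phi k l x * eta2 k l x)).
  rewrite -IZ; last by apply: Cc_sum2 => k l; exact: CcMr.
  congr I; apply/funext => x; rewrite mulr_sumr; apply: eq_bigr => k _.
  by rewrite mulr_sumr; apply: eq_bigr => l _; rewrite mulrA.
by rewrite (we _ _ _ C2e supp) mulr0.
Qed.

End weak_equations.

(** * Caccioppoli inequality *)

Section positive_part.
Context {R : realType}.

Lemma sqr_normr (x : R) : `|x| ^+ 2 = x ^+ 2.
Proof. exact: real_normK (num_real x). Qed.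

Lemma pos_part_derive (m : nat) (t : R) :
  is_derive t 1 (fun t => maxr t 0 ^+ m.+2) (m.+2%:R * maxr t 0 ^+ m.+1).
Proof.
have [t0|t0|->] := ltgtP t 0.
- rewrite expr0n /= mulr0.
  have h : \near t, cst 0 t = (fun t : R => maxr t 0 ^+ m.+2) t.
    by apply: filterS (lt_nbhsl t0) => s s0; rewrite /= max_r ?ltW// expr0n.
  exact: near_eq_is_derive h (is_derive_cst _ _ _).
- have h : \near t, (fun t => t ^+ m.+2) t = (fun t : R => maxr t 0 ^+ m.+2) t.
    by apply: filterS (lt_nbhsr t0) => s s0; rewrite /= max_l ?ltW.
  apply: near_eq_is_derive h _.
  have H := @is_deriveX R _ (fun t : R => t) m.+2 t 1 1 (is_derive_id _ _).
  rewrite (_ : (fun t0 : R => t0 ^+ m.+2) = (fun t : R => t) ^+ m.+2); last first.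
    by apply/funext => s; rewrite exprfctE.
  by apply: is_derive_eq H _; rewrite -[_ *: _]/(_ * _) mulr1.
- rewrite expr0n /= mulr0; apply/is_deriveP => d d0.
  exists (minr 1 d); first by rewrite lt_min ltr01.
  move=> h h0; rewrite lt_min => /andP[h1 hd].
  rewrite add0r -[h *: 1]/(h * 1) mulr1 maxxx expr0n /= !subr0 exprSr -mulrA normrM.
  have m1 : `|maxr h 0| <= `|h| by rewrite /maxr; case: ifP; rewrite ?normr0.
  have A : `|maxr h 0 ^+ m.+1| <= `|h|.
    rewrite normrX exprS -[leRHS]mulr1; apply: ler_pM => //.
    by apply: exprn_ile1 => //; apply: le_trans m1 _; exact: ltW.
  have B : `|maxr h 0 / h| <= 1.
    by rewrite normrM normfV ler_pdivrMr ?normr_gt0// mul1r.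
  by apply: le_lt_trans hd; rewrite -[leRHS]mulr1; apply: ler_pM.
Qed.

Lemma pos_part_cont (m : nat) : continuous (fun t : R => maxr t 0 ^+ m).
Proof. by apply: contX; apply: cont_max; [move=> x; exact: cvg_id|exact: contC]. Qed.

Definition pp (m : nat) (t : R) := maxr t 0 ^+ m.

Lemma pp_ge0 m t : 0 <= pp m t.
Proof. by rewrite exprn_ge0// le_max lexx orbT. Qed.

Lemma pp_le m t c : 0 <= c -> t <= c -> pp m t <= c ^+ m.
Proof.
move=> c0 tc; apply: lerXn2r; rewrite ?nnegrE ?le_max ?lexx ?orbT//.
by rewrite ge_max tc.
Qed.

Lemma pp0 m t : t <= 0 -> pp m.+1 t = 0.
Proof. by move=> t0; rewrite /pp max_r// expr0n. Qed.

End positive_part.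

(** * An explicit C^2 cutoff *)

Section cutoff_rV.
Context {R : realType} {n : nat}.
Local Notation V := 'rV[R]_n.
Local Notation e i := (delta_mx ord0 i : V).

Lemma C2_ext (f : V -> R) f1 f2 g1 g2 : C2 f f1 f2 ->
  (forall i x, f1 i x = g1 i x) -> (forall i j x, f2 i j x = g2 i j x) -> C2 f g1 g2.
Proof.
move=> h e1 e2; have -> : g1 = f1 by apply/funext => i; apply/funext => x.
by have -> : g2 = f2 by apply/funext => i; apply/funext => j; apply/funext => x.
Qed.

Variables (x0 : V) (r : R).
Let z i (x : V) := (x ord0 i - x0 ord0 i) / r.
Let u (x : V) := 1 - (\sum_i pp 3 (z i x ^+ 2 - 1)) / 27.

(** Cubes of positive parts are C^2 with explicit derivatives. Where all |z_i| are at most 1 the sum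
    in [u] vanishes and the cutoff is 1; once some |z_i| is at least 2, the term (z_i^2 - 1)^3 is at
    least 27, so [u] is nonpositive and the cutoff is 0. *)
Definition cutoff (x : V) : R := pp 3 (u x).

Let u1 i (x : V) := - (3 * pp 2 (z i x ^+ 2 - 1) * (2 * z i x / r)) / 27.
Let u2 i (x : V) := - (6 * pp 1 (z i x ^+ 2 - 1) * (2 * z i x / r) * (2 * z i x / r) +
   3 * pp 2 (z i x ^+ 2 - 1) * (2 / r / r)) / 27.

Definition cut1 i (x : V) : R := 3 * pp 2 (u x) * u1 i x.
Definition cut2 i j (x : V) : R :=
  6 * pp 1 (u x) * u1 j x * u1 i x + 3 * pp 2 (u x) * ((i == j)%:R * u2 i x).

Let z_derive i j x : is_derive x (e j) (z i) ((i == j)%:R / r).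
Proof.
rewrite /z (_ : (fun x : V => _) = (fun x : V => r^-1 * (x ord0 i - x0 ord0 i))); last first.
  by apply/funext => y; rewrite mulrC.
have -> : (i == j)%:R / r = r^-1 * ((i == j)%:R - 0) by rewrite subr0 mulrC.
apply: is_deriveZ; apply: is_deriveB; exact: is_derive_coord.
Qed.

Let z2_derive i j x : is_derive x (e j) (fun x => z i x ^+ 2 - 1) ((i == j)%:R * (2 * z i x / r)).
Proof.
have -> : (i == j)%:R * (2 * z i x / r) = (z i x * ((i == j)%:R / r) + (i == j)%:R / r * z i x) - 0.
  by rewrite subr0; ring.
apply: is_deriveB.
rewrite (_ : (fun x => _) = (fun x => z i x * z i x)); last by apply/funext => y; rewrite expr2.
exact: is_deriveM1.
Qed.

Let u_derive j x : is_derive x (e j) u (u1 j x).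
Proof.
rewrite /u (_ : (fun x => _) = (fun x : V => 1 - 27^-1 * (\sum_i pp 3 (z i x ^+ 2 - 1)))); last first.
  by apply/funext => y; rewrite mulrC.
have -> : u1 j x = 0 - 27^-1 * (\sum_i (3 * pp 2 (z i x ^+ 2 - 1) * ((i == j)%:R * (2 * z i x / r)))).
  rewrite (bigD1 j) //= eqxx mul1r big1 ?addr0 ?sub0r; first by rewrite /u1; ring.
  by move=> i /negbTE ->; rewrite mul0r mulr0.
apply: is_deriveB; apply: is_deriveZ.
rewrite (_ : (fun x => _) = \sum_(i < n) (fun x : V => pp 3 (z i x ^+ 2 - 1))); last first.
  by apply/funext => y; rewrite fct_sumE.
apply: is_derive_sum => i; apply: is_derive_comp1; last exact: z2_derive.
exact: (pos_part_derive 1).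
Qed.

Let pp_cont m : continuous (@pp R m).
Proof. exact: pos_part_cont. Qed.

Let z_cont i : continuous (z i).
Proof.
by apply: contM; [apply: contB; [exact: cont_coord|exact: contC]|exact: contC].
Qed.

Let z2_cont i : continuous (fun x => z i x ^+ 2 - 1).
Proof. by apply: contB; [exact: contX|exact: contC]. Qed.

Let u_cont : continuous u.
Proof.
apply: contB; [exact: contC|apply: contM; [|exact: contC]].
by apply: cont_sum => i; apply: cont_comp.
Qed.

Let zr_cont i : continuous (fun x => 2 * z i x / r).
Proof. by apply: contM; [apply: contM => //; exact: contC|exact: contC]. Qed.

Let u1_cont i : continuous (u1 i).
Proof.
apply: contM; [apply: contN; apply: contM => //|exact: contC].
by apply: contM; [exact: contC|apply: cont_comp].
Qed.

Let u2_cont i : continuous (u2 i).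
Proof.
apply: contM; [apply: contN; apply: contD|exact: contC].
  do 2 apply: contM => //.
  by apply: contM; [exact: contC|apply: cont_comp].
apply: contM; last exact: contC.
by apply: contM; [exact: contC|apply: cont_comp].
Qed.

Let u1_derive i j x : is_derive x (e j) (u1 i) ((i == j)%:R * u2 i x).
Proof.
rewrite /u1 (_ : (fun x => _) = (fun x => (- (6 / 27 / r)) * (pp 2 (z i x ^+ 2 - 1) * z i x))); last first.
  by apply/funext => y; ring.
have -> : (i == j)%:R * u2 i x = (- (6 / 27 / r)) * (pp 2 (z i x ^+ 2 - 1) * ((i == j)%:R / r) +
   (2 * pp 1 (z i x ^+ 2 - 1) * ((i == j)%:R * (2 * z i x / r))) * z i x).
  by rewrite /u2; ring.
apply: is_deriveZ; apply: is_deriveM1; last exact: z_derive.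
apply: is_derive_comp1; last exact: z2_derive.
exact: (pos_part_derive 0).
Qed.

Lemma C2_cut : C2 cutoff cut1 cut2.
Proof.
split.
- exact: cont_comp.
- move=> i; apply: contM => //; apply: contM; [exact: contC|exact: cont_comp].
- move=> i j; apply: contD.
    do 2 apply: contM => //.
    by apply: contM; [exact: contC|exact: cont_comp].
  apply: contM; first by apply: contM; [exact: contC|exact: cont_comp].
  by apply: contM => //; exact: contC.
- move=> i x; apply: is_derive_comp1 => //; exact: (pos_part_derive 1).
- move=> i j x.
  rewrite /cut1 (_ : (fun x => _) = (fun x => 3 * (pp 2 (u x) * u1 i x))); last first.
    by apply/funext => y; rewrite mulrA.
  have -> : cut2 i j x = 3 * (pp 2 (u x) * ((i == j)%:R * u2 i x) + 2 * pp 1 (u x) * u1 j x * u1 i x).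
    by rewrite /cut2; ring.
  apply: is_deriveZ; apply: is_deriveM1 => //.
  by apply: is_derive_comp1 => //; exact: (pos_part_derive 0).
Qed.

Hypothesis r0 : 0 < r.

Let S0 x : 0 <= \sum_i pp 3 (z i x ^+ 2 - 1).
Proof. by apply: sumr_ge0 => i _; exact: pp_ge0. Qed.

Let u_le1 x : u x <= 1.
Proof. by have := S0 x; rewrite /u; lra. Qed.

Lemma cut_ge0 x : 0 <= cutoff x. Proof. exact: pp_ge0. Qed.

Lemma cut_le1 x : cutoff x <= 1.
Proof. by rewrite /cutoff -(expr1n R 3); exact: pp_le. Qed.

Let z_le i x c : `|x - x0| <= c * r -> `|z i x| <= c.
Proof.
move=> h; rewrite /z normrM normfV (gtr0_norm r0) ler_pdivrMr//.
by apply: le_trans h; have := normrV_coord (x - x0) i; rewrite !mxE.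
Qed.

Lemma cut_eq1 x : `|x - x0| <= r -> cutoff x = 1.
Proof.
move=> xr; rewrite /cutoff /u big1 ?mul0r ?subr0; first by rewrite /pp max_l// expr1n.
move=> i _; apply: pp0; have := @z_le i x 1; rewrite mul1r => /(_ xr).
by rewrite -sqr_normr => h; have := normr_ge0 (z i x); nra.
Qed.

Let u_le0 x : 2 * r <= `|x - x0| -> u x <= 0.
Proof.
move=> xr; have [i hi] : exists i, 2 * r <= `|(x - x0) ord0 i|.
  apply: contrapT => /forallNP h.
  suff : `|x - x0| < 2 * r by rewrite ltNge xr.
  by apply: normrV_ltP => [|i]; [rewrite mulr_gt0|rewrite ltNge; apply/negP; exact: h].
have zi : 2 <= `|z i x|.
  by rewrite /z normrM normfV (gtr0_norm r0) ler_pdivlMr//; move: hi; rewrite !mxE.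
have p27 : 27 <= pp 3 (z i x ^+ 2 - 1).
  have t3 : 3 <= z i x ^+ 2 - 1 by rewrite -sqr_normr; nra.
  rewrite /pp max_l; last lra.
  have -> : (27 : R) = 3 ^+ 3 by ring.
  by apply: lerXn2r => //; rewrite nnegrE; lra.
rewrite /u (bigD1 i) //=.
have : 0 <= \sum_(j < n | j != i) pp 3 (z j x ^+ 2 - 1).
  by apply: sumr_ge0 => j _; exact: pp_ge0.
by move=> h; lra.
Qed.

Lemma cut_eq0 x : 2 * r <= `|x - x0| -> cutoff x = 0.
Proof. by move=> /u_le0 h; exact: pp0. Qed.

Lemma cut1_eq0 i x : 2 * r <= `|x - x0| -> cut1 i x = 0.
Proof. by move=> /u_le0 h; rewrite /cut1 pp0// mulr0 mul0r. Qed.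

Lemma cut2_eq0 i j x : 2 * r <= `|x - x0| -> cut2 i j x = 0.
Proof. by move=> /u_le0 h; rewrite /cut2 !pp0// !mulr0 !mul0r addr0. Qed.

Lemma Cc_cut : Cc cutoff.
Proof. by apply: (@Cc_ball _ _ _ x0 (2 * r)); [case: C2_cut|exact: cut_eq0]. Qed.

Let ru1_le i x : `|x - x0| <= 2 * r -> `|r * u1 i x| <= 4.
Proof.
move=> xr; have zi := z_le i xr.
have p9 : pp 2 (z i x ^+ 2 - 1) <= 3 ^+ 2.
  by apply: pp_le => //; rewrite -sqr_normr; have := normr_ge0 (z i x); nra.
have pg := @pp_ge0 R 2 (z i x ^+ 2 - 1).
have -> : r * u1 i x = - (6 / 27) * pp 2 (z i x ^+ 2 - 1) * z i x.
  by rewrite /u1; field; rewrite gt_eqF.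
rewrite 2!normrM normrN (ger0_norm pg) [`|6 / 27|]ger0_norm; last lra.
by have := normr_ge0 (z i x); nra.
Qed.

Let r2u2_le i x : `|x - x0| <= 2 * r -> `|r ^+ 2 * u2 i x| <= 15.
Proof.
move=> xr; have zi := z_le i xr.
have t3 : z i x ^+ 2 - 1 <= 3.
  by rewrite -sqr_normr; have := normr_ge0 (z i x); nra.
have p9 : pp 2 (z i x ^+ 2 - 1) <= 3 ^+ 2 by exact: pp_le.
have p3 : pp 1 (z i x ^+ 2 - 1) <= 3 ^+ 1 by exact: pp_le.
have pg := @pp_ge0 R 2 (z i x ^+ 2 - 1).
have pg1 := @pp_ge0 R 1 (z i x ^+ 2 - 1).
have -> : r ^+ 2 * u2 i x = - ((24 * pp 1 (z i x ^+ 2 - 1) * `|z i x| ^+ 2 + 6 * pp 2 (z i x ^+ 2 - 1)) / 27).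
  by rewrite /u2 sqr_normr; field; rewrite gt_eqF.
have zz : `|z i x| ^+ 2 <= 4 by have := normr_ge0 (z i x); nra.
have z0 : 0 <= `|z i x| ^+ 2 by rewrite exprn_ge0.
have A : pp 1 (z i x ^+ 2 - 1) * `|z i x| ^+ 2 <= 12 by nra.
have A0 : 0 <= pp 1 (z i x ^+ 2 - 1) * `|z i x| ^+ 2 by rewrite mulr_ge0.
by rewrite normrN ger0_norm; rewrite -mulrA; lra.
Qed.

(** The rescaled first and second derivatives are at most 3 * 4 and 6 * 16 + 3 * 15. The crude value
    15^2 bounds both, so that a single constant enters the Caccioppoli inequality. *)
Lemma cut1_le i x : `|r * cut1 i x| <= 15 ^+ 2.
Proof.
have [xr|/ltW xr] := leP `|x - x0| (2 * r); last first.
  by rewrite (cut1_eq0 i xr) mulr0 normr0 exprn_ge0 ?ler0n.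
have h := ru1_le i xr; have p1 := pp_le 2 (@ler01 R) (u_le1 x); have p0 := pp_ge0 2 (u x).
rewrite expr1n in p1.
have -> : r * cut1 i x = 3 * pp 2 (u x) * (r * u1 i x) by rewrite /cut1; ring.
rewrite 2!normrM (ger0_norm p0) normr_nat; have := normr_ge0 (r * u1 i x); nra.
Qed.

Lemma cut2_le i j x : `|r ^+ 2 * cut2 i j x| <= 15 ^+ 2.
Proof.
have [xr|/ltW xr] := leP `|x - x0| (2 * r); last first.
  by rewrite (cut2_eq0 i j xr) mulr0 normr0 exprn_ge0 ?ler0n.
have hi := ru1_le i xr; have hj := ru1_le j xr; have h2 := r2u2_le i xr.
have p1 := pp_le 2 (@ler01 R) (u_le1 x); have p0 := pp_ge0 2 (u x).
have q1 := pp_le 1 (@ler01 R) (u_le1 x); have q0 := pp_ge0 1 (u x).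
rewrite !expr1n in p1 q1.
have -> : r ^+ 2 * cut2 i j x = 6 * pp 1 (u x) * ((r * u1 j x) * (r * u1 i x)) +
  3 * pp 2 (u x) * ((i == j)%:R * (r ^+ 2 * u2 i x)) by rewrite /cut2; ring.
apply: le_trans (ler_normD _ _) _.
have A : `|(r * u1 j x) * (r * u1 i x)| <= 16.
  by rewrite normrM; have := normr_ge0 (r * u1 j x); have := normr_ge0 (r * u1 i x); nra.
have B : `|(i == j)%:R * (r ^+ 2 * u2 i x)| <= 15.
  by case: (i == j); rewrite ?mul1r ?mul0r ?normr0//; lra.
rewrite [X in X + _]normrM [X in _ + X]normrM.
rewrite (ger0_norm (mulr_ge0 (ler0n R 6) q0)) (ger0_norm (mulr_ge0 (ler0n R 3) p0)).
have A0 := normr_ge0 ((r * u1 j x) * (r * u1 i x)).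
have B0 := normr_ge0 ((i == j)%:R * (r ^+ 2 * u2 i x)).
have P1 : pp 1 (u x) * `|(r * u1 j x) * (r * u1 i x)| <= 16 by nra.
have P2 : pp 2 (u x) * `|(i == j)%:R * (r ^+ 2 * u2 i x)| <= 15 by nra.
lra.
Qed.

End cutoff_rV.

Section caccioppoli_algebra.
Context {R : realType}.

Lemma sqr_sum_le (J : finType) (x : J -> R) :
  (\sum_j x j) ^+ 2 <= #|J|%:R * \sum_j x j ^+ 2.
Proof.
have [J0|J0] := eqVneq #|J| 0%N.
  have h (j : J) : False by have := fintype0 j; rewrite J0.
  by rewrite !big1 ?expr0n ?mulr0// => j; case: (h j).
have N0 : 0 < #|J|%:R :> R by rewrite ltr0n lt0n.
set s := \sum_j x j; set N : R := #|J|%:R.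
have : 0 <= \sum_j (x j - s / N) ^+ 2 by apply: sumr_ge0 => j _; exact: sqr_ge0.
have -> : \sum_j (x j - s / N) ^+ 2 = \sum_j x j ^+ 2 - s ^+ 2 / N.
  transitivity (\sum_j (x j ^+ 2 - 2 * (s / N) * x j + (s / N) ^+ 2)).
    by apply: eq_bigr => j _; ring.
  rewrite big_split /= sumrB -mulr_sumr -/s sumr_const -[_ *+ _]mulr_natl -/N.
  by field; rewrite gt_eqF.
by rewrite subr_ge0 ler_pdivrMr// mulrC.
Qed.

(** With [p] a cutoff, the second derivatives of p^4 v are p^4 w + p^2 N, where N involves only v,
    its gradient and derivatives of p. Young's inequality pays for the products of the flux with p^2
    N, and of G with p^4 w: the terms in w and in the contraction B get the small weight [d], the
    others a weight of order 1/d. *)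
Lemma cacc_entry (p F B G w vk vl v sk sl skl a g M S d : R) :
  0 <= p -> p <= 1 -> F = B - G -> `|G| <= g -> B ^+ 2 <= M * S ->
  `|sk| <= a -> `|sl| <= a -> `|skl| <= a -> 0 < d ->
  - (F * (4 * p ^+ 3 * (sl * vk + sk * vl) + (12 * p ^+ 2 * sk * sl + 4 * p ^+ 3 * skl) * v)
     - G * p ^+ 4 * w) <=
  d * (p ^+ 4 * w ^+ 2) + 2 * d * p ^+ 4 * (M * S) +
  (2 * d + (1 + 48 * a ^+ 2 + 3 * (12 * a ^+ 2 + 4 * a) ^+ 2) / (4 * d)) *
  (g ^+ 2 + (p ^+ 2 * vk ^+ 2 + p ^+ 2 * vl ^+ 2) + v ^+ 2).
Proof.
move=> p0 p1 -> Gg BS ska sla skla d0.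
have a0 : 0 <= a by apply: le_trans ska.
have sq (s : R) : `|s| <= a -> s ^+ 2 <= a ^+ 2.
  by move=> h; rewrite -sqr_normr; apply: lerXn2r.
set c := 12 * a ^+ 2 + 4 * a.
set m := 12 * sk * sl + 4 * p * skl.
set N := 4 * p * (sl * vk + sk * vl) + m * v.
have mc : m ^+ 2 <= c ^+ 2.
  rewrite -sqr_normr; apply: lerXn2r; rewrite ?nnegrE//.
    by rewrite /c addr_ge0 ?mulr_ge0 ?sqr_ge0.
  apply: le_trans (ler_normD _ _) _; apply: lerD.
    rewrite -mulrA normrM normr_nat ler_pM2l ?ltr0n// normrM expr2.
    exact: ler_pM.
  rewrite -mulrA normrM normr_nat ler_pM2l ?ltr0n// normrM (ger0_norm p0).
  by rewrite -[leRHS]mul1r; apply: ler_pM.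
have sk2 := sq _ ska; have sl2 := sq _ sla.
have N2 : N ^+ 2 <= 48 * a ^+ 2 * (p ^+ 2 * vk ^+ 2 + p ^+ 2 * vl ^+ 2) + 3 * c ^+ 2 * v ^+ 2.
  have A1 : sl ^+ 2 * (p * vk) ^+ 2 <= a ^+ 2 * (p * vk) ^+ 2 by apply: ler_wpM2r => //; exact: sqr_ge0.
  have A2 : sk ^+ 2 * (p * vl) ^+ 2 <= a ^+ 2 * (p * vl) ^+ 2 by apply: ler_wpM2r => //; exact: sqr_ge0.
  have A3 : m ^+ 2 * v ^+ 2 <= c ^+ 2 * v ^+ 2 by apply: ler_wpM2r => //; exact: sqr_ge0.
  have T (x y z : R) : (x + y + z) ^+ 2 <= 3 * (x ^+ 2 + y ^+ 2 + z ^+ 2).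
    have := sqr_ge0 (x - y); have := sqr_ge0 (x - z); have := sqr_ge0 (y - z); lra.
  have := T (4 * p * sl * vk) (4 * p * sk * vl) (m * v).
  have -> : 4 * p * sl * vk + 4 * p * sk * vl + m * v = N by rewrite /N; ring.
  lra.
have G2 : G ^+ 2 <= g ^+ 2.
  by rewrite -sqr_normr; apply: lerXn2r => //; rewrite nnegrE; apply: le_trans Gg.
have F2 : (B - G) ^+ 2 <= 2 * (M * S) + 2 * g ^+ 2.
  by have := sqr_ge0 (B + G); lra.
have p4 : p ^+ 4 <= 1 by exact: exprn_ile1.
have p40 : 0 <= p ^+ 4 by exact: exprn_ge0.
have di : 0 < (4 * d)^-1 by rewrite invr_gt0 mulr_gt0.
have Y1 : - ((B - G) * (p ^+ 2 * N)) <= d * (p ^+ 4 * (B - G) ^+ 2) + N ^+ 2 / (4 * d).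
  have -> : d * (p ^+ 4 * (B - G) ^+ 2) + N ^+ 2 / (4 * d) =
     (2 * d * p ^+ 2 * (B - G) + N) ^+ 2 / (4 * d) - (B - G) * (p ^+ 2 * N).
    by field; rewrite gt_eqF.
  have : 0 <= (2 * d * p ^+ 2 * (B - G) + N) ^+ 2 / (4 * d).
    by rewrite mulr_ge0 ?sqr_ge0// ltW.
  lra.
have Y2 : G * p ^+ 4 * w <= d * (p ^+ 4 * w ^+ 2) + p ^+ 4 * G ^+ 2 / (4 * d).
  have -> : d * (p ^+ 4 * w ^+ 2) + p ^+ 4 * G ^+ 2 / (4 * d) =
     p ^+ 4 * (2 * d * w - G) ^+ 2 / (4 * d) + G * p ^+ 4 * w.
    by field; rewrite gt_eqF.
  have : 0 <= p ^+ 4 * (2 * d * w - G) ^+ 2 / (4 * d).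
    apply: mulr_ge0; last exact: ltW.
    by apply: mulr_ge0 => //; exact: sqr_ge0.
  lra.
have Z1 : d * (p ^+ 4 * (B - G) ^+ 2) <= 2 * d * p ^+ 4 * (M * S) + 2 * d * g ^+ 2.
  have h1 : p ^+ 4 * (B - G) ^+ 2 <= p ^+ 4 * (2 * (M * S) + 2 * g ^+ 2) by apply: ler_wpM2l.
  have h2 : p ^+ 4 * (2 * g ^+ 2) <= 2 * g ^+ 2.
    by rewrite -[leRHS]mul1r; apply: ler_wpM2r => //; rewrite mulr_ge0// sqr_ge0.
  have h3 : p ^+ 4 * (B - G) ^+ 2 <= 2 * p ^+ 4 * (M * S) + 2 * g ^+ 2 by lra.
  by have := ler_wpM2l (ltW d0) h3; lra.
have Z2 : p ^+ 4 * G ^+ 2 / (4 * d) <= g ^+ 2 / (4 * d).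
  apply: ler_wpM2r; first exact: ltW.
  by rewrite -[leRHS]mul1r; apply: ler_pM => //; exact: sqr_ge0.
have Z3 : N ^+ 2 / (4 * d) <= (48 * a ^+ 2 * (p ^+ 2 * vk ^+ 2 + p ^+ 2 * vl ^+ 2) + 3 * c ^+ 2 * v ^+ 2) / (4 * d).
  by apply: ler_wpM2r => //; exact: ltW.
have -> : - ((B - G) * (4 * p ^+ 3 * (sl * vk + sk * vl) + (12 * p ^+ 2 * sk * sl + 4 * p ^+ 3 * skl) * v)
     - G * p ^+ 4 * w) = - ((B - G) * (p ^+ 2 * N)) + G * p ^+ 4 * w.
  by rewrite /N /m; ring.
set Q := p ^+ 2 * vk ^+ 2 + p ^+ 2 * vl ^+ 2 in Z3 *.
have Q0 : 0 <= Q by rewrite /Q addr_ge0// mulr_ge0// sqr_ge0.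
have v0 := sqr_ge0 v; have g0 := sqr_ge0 g; have c0 := sqr_ge0 c; have a20 := sqr_ge0 a.
set i := (4 * d)^-1 in di Y1 Y2 Z2 Z3 *.
have W1 : 0 <= d * Q by rewrite mulr_ge0// ltW.
have W2 : 0 <= d * v ^+ 2 by rewrite mulr_ge0// ltW.
have iQ : 0 <= i * Q by rewrite mulr_ge0// ltW.
have iv : 0 <= i * v ^+ 2 by rewrite mulr_ge0// ltW.
have ig : 0 <= i * g ^+ 2 by rewrite mulr_ge0// ltW.
have X1 := mulr_ge0 c0 iQ; have X2 := mulr_ge0 c0 ig; have X3 := mulr_ge0 a20 ig; have X4 := mulr_ge0 a20 iv.
lra.
Qed.

(** The bracket is the k-th partial derivative of p^2 v v_k and so integrates to zero: the gradient
    is interpolated between v and a small multiple of the second derivatives. *)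
Lemma cacc_grad (p vk v sk wkk a d : R) : `|sk| <= a -> 0 < d ->
  p ^+ 2 * vk ^+ 2 <= 2 * (2 * p * sk * v * vk + p ^+ 2 * vk ^+ 2 + p ^+ 2 * v * wkk)
    + 2 * d * (p ^+ 4 * wkk ^+ 2) + (4 * a ^+ 2 + (2 * d)^-1) * v ^+ 2.
Proof.
move=> ska d0.
have s2 : sk ^+ 2 * v ^+ 2 <= a ^+ 2 * v ^+ 2.
  apply: ler_wpM2r; first exact: sqr_ge0.
  by rewrite -sqr_normr; apply: lerXn2r => //; rewrite nnegrE; apply: le_trans ska.
have h1 := sqr_ge0 (p * vk + 2 * sk * v).
have di : 0 < (2 * d)^-1 by rewrite invr_gt0 mulr_gt0.
have h2 : 0 <= 2 * d * (p ^+ 4 * wkk ^+ 2) + (2 * d)^-1 * v ^+ 2 + 2 * (p ^+ 2 * v * wkk).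
  have -> : 2 * d * (p ^+ 4 * wkk ^+ 2) + (2 * d)^-1 * v ^+ 2 + 2 * (p ^+ 2 * v * wkk) =
    (2 * d)^-1 * (2 * d * p ^+ 2 * wkk + v) ^+ 2 by field; rewrite gt_eqF.
  by rewrite mulr_ge0 ?sqr_ge0// ltW.
lra.
Qed.

Section contraction.
Context {n : nat}.
Implicit Types (b : 'I_n -> 'I_n -> 'I_n -> 'I_n -> R) (w : 'I_n -> 'I_n -> R).

Definition contr b w k l : R := \sum_i \sum_j b i j k l * w i j.

Definition sqs w : R := \sum_k \sum_l w k l ^+ 2.

(** The estimates depend on [b] through [lam] and [Lam] alone, which makes them uniform over all
    frozen coefficients. Positivity is asked on symmetric arrays, as Hessians are symmetric. *)
Definition ellip (lam Lam : R) b :=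
  (forall w, (forall i j, w i j = w j i) ->
     lam * sqs w <= \sum_k \sum_l contr b w k l * w k l) /\
  forall i j k l, `|b i j k l| <= Lam.

Lemma sqs_ge0 w : 0 <= sqs w.
Proof. by apply: sumr_ge0 => k _; apply: sumr_ge0 => l _; exact: sqr_ge0. Qed.

Lemma sqs_ge w k l : w k l ^+ 2 <= sqs w.
Proof.
rewrite /sqs (bigD1 k) //= (bigD1 l) //= -addrA lerDl addr_ge0//.
  by apply: sumr_ge0 => j _; exact: sqr_ge0.
by apply: sumr_ge0 => i _; apply: sumr_ge0 => j _; exact: sqr_ge0.
Qed.

Lemma sqs_diag w : \sum_k w k k ^+ 2 <= sqs w.
Proof.
apply: ler_sum => k _; rewrite (bigD1 k) //= lerDl.
by apply: sumr_ge0 => l _; exact: sqr_ge0.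
Qed.

Lemma contr_sqr lam Lam b w k l : ellip lam Lam b ->
  contr b w k l ^+ 2 <= (n%:R * n%:R * Lam ^+ 2) * sqs w.
Proof.
move=> [_ bL]; rewrite /contr pair_big /=.
apply: le_trans (sqr_sum_le _) _.
rewrite card_prod !card_ord natrM -[leRHS]mulrA; apply: ler_wpM2l; first by rewrite mulr_ge0.
rewrite /sqs pair_big /= mulr_sumr; apply: ler_sum => ij _.
rewrite exprMn; apply: ler_wpM2r; first exact: sqr_ge0.
have bk := bL ij.1 ij.2 k l.
have L0 : 0 <= Lam by apply: le_trans bk.
by rewrite -[leLHS]sqr_normr; apply: lerXn2r; rewrite ?nnegrE.
Qed.

(** The integrand of the Caccioppoli inequality. After integration the first sum vanishes by the
    equation and the sum with factor [K1] because it is a divergence, so only [g] and [v] remain on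
    the right. *)
Lemma cacc_pointwise (lam Lam a : R) : 0 < lam ->
  exists K1, exists2 K2, 0 <= K2 & forall b p s s2 v v1 w G g,
  ellip lam Lam b -> 0 <= p -> p <= 1 -> (forall i j, w i j = w j i) ->
  (forall k, `|s k| <= a) -> (forall k l, `|s2 k l| <= a) ->
  (forall k l, `|G k l| <= g) ->
  lam / 2 * (p ^+ 4 * sqs w) <=
  \sum_k \sum_l (contr b w k l - G k l) *
    (p ^+ 4 * w k l + (4 * p ^+ 3 * (s l * v1 k + s k * v1 l) +
       (12 * p ^+ 2 * s k * s l + 4 * p ^+ 3 * s2 k l) * v)) +
  K1 * \sum_k (2 * p * s k * v * v1 k + p ^+ 2 * v1 k ^+ 2 + p ^+ 2 * v * w k k) +
  K2 * (g ^+ 2 + v ^+ 2).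
Proof.
move=> lam0.
pose M : R := n%:R * n%:R * Lam ^+ 2.
have n0 : 0 <= n%:R :> R by [].
have M0 : 0 <= M by rewrite /M; nneg.
have n2M : 0 <= n%:R * n%:R * M by nneg.
(* Half of [lam] is available for absorption: [d] uses one quarter for the Young terms, and [d']
   below the other quarter for the gradient terms. *)
pose d : R := lam / (4 * (1 + 2 * (n%:R * n%:R * M))).
have d0 : 0 < d by rewrite divr_gt0// mulr_gt0//; lra.
have dE : d + 2 * d * (n%:R * n%:R * M) = lam / 4.
  by rewrite /d; field; rewrite gt_eqF//; lra.
pose C0 : R := 2 * d + (1 + 48 * a ^+ 2 + 3 * (12 * a ^+ 2 + 4 * a) ^+ 2) / (4 * d).
have C00 : 0 <= C0.
  by rewrite /C0; nneg.
have nC0 : 0 <= n%:R * C0 by rewrite mulr_ge0.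
pose d' : R := lam / (4 * (4 * (n%:R * C0) + 1)).
have d'0 : 0 < d' by rewrite divr_gt0// mulr_gt0//; lra.
have d'E : 4 * (n%:R * C0) * d' <= lam / 4.
  have : 4 * (n%:R * C0) * d' + d' = lam / 4 by rewrite /d'; field; rewrite gt_eqF//; lra.
  lra.
pose Cd : R := 4 * a ^+ 2 + (2 * d')^-1.
have Cd0 : 0 <= Cd.
  by rewrite /Cd; nneg.
exists (4 * (n%:R * C0)).
exists (C0 * (n%:R * n%:R) + 2 * (n%:R * C0) * (n%:R * Cd)); first by nneg.
move=> b p s s2 v v1 w G g eb p0 p1 wsym sa s2a Gg.
pose N k l : R := 4 * p ^+ 3 * (s l * v1 k + s k * v1 l) +
       (12 * p ^+ 2 * s k * s l + 4 * p ^+ 3 * s2 k l) * v.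
pose E k l : R := (contr b w k l - G k l) * N k l - G k l * p ^+ 4 * w k l.
have p40 : 0 <= p ^+ 4 by exact: exprn_ge0.
have S0 := sqs_ge0 w.
have h1 : lam * (p ^+ 4 * sqs w) <=
  \sum_k \sum_l (contr b w k l - G k l) * (p ^+ 4 * w k l + N k l) + \sum_k \sum_l (- E k l).
  rewrite -big_split /=.
  apply: (@le_trans _ _ (p ^+ 4 * \sum_k \sum_l contr b w k l * w k l)).
    by have := ler_wpM2l p40 (eb.1 w wsym); rewrite [p ^+ 4 * (lam * _)]mulrCA.
  rewrite mulr_sumr le_eqVlt; apply/orP; left; apply/eqP; apply: eq_bigr => k _.
  rewrite mulr_sumr -big_split /=; apply: eq_bigr => l _.
  by rewrite /E; ring.
have h2 : \sum_k \sum_l (- E k l) <= (d + 2 * d * (n%:R * n%:R * M)) * (p ^+ 4 * sqs w) +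
   C0 * (n%:R * n%:R * g ^+ 2 + 2 * n%:R * (\sum_k p ^+ 2 * v1 k ^+ 2) + n%:R * n%:R * v ^+ 2).
  apply: (@le_trans _ _ (\sum_k \sum_l (d * (p ^+ 4 * w k l ^+ 2) + 2 * d * p ^+ 4 * (M * sqs w) +
      C0 * (g ^+ 2 + (p ^+ 2 * v1 k ^+ 2 + p ^+ 2 * v1 l ^+ 2) + v ^+ 2)))).
    apply: ler_sum => k _; apply: ler_sum => l _.
    apply: (@cacc_entry p _ (contr b w k l) (G k l) (w k l) (v1 k) (v1 l) v (s k) (s l)
      (s2 k l) a g M (sqs w) d) => //.
    exact: contr_sqr eb.
  have cst (c : R) : \sum_(k < n) \sum_(l < n) c = n%:R * n%:R * c.
    rewrite (eq_bigr (fun=> n%:R * c)) => [|k _]; first by rewrite sumr_const card_ord -[LHS]mulr_natl mulrA.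
    by rewrite sumr_const card_ord -[LHS]mulr_natl.
  have sumk (f : 'I_n -> R) : \sum_(k < n) \sum_(l < n) f k = n%:R * \sum_k f k.
    by rewrite mulr_sumr; apply: eq_bigr => k _; rewrite sumr_const card_ord -[LHS]mulr_natl.
  have suml (f : 'I_n -> R) : \sum_(k < n) \sum_(l < n) f l = n%:R * \sum_k f k.
    by rewrite exchange_big sumk.
  have -> : \sum_k \sum_l (d * (p ^+ 4 * w k l ^+ 2) + 2 * d * p ^+ 4 * (M * sqs w) +
      C0 * (g ^+ 2 + (p ^+ 2 * v1 k ^+ 2 + p ^+ 2 * v1 l ^+ 2) + v ^+ 2)) =
    \sum_k \sum_l (d * (p ^+ 4 * w k l ^+ 2)) + \sum_(k < n) \sum_(l < n) (2 * d * p ^+ 4 * (M * sqs w)) +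
    (\sum_(k < n) \sum_(l < n) (C0 * g ^+ 2) + (\sum_(k < n) \sum_(l < n) (C0 * (p ^+ 2 * v1 k ^+ 2)) +
      \sum_(k < n) \sum_(l < n) (C0 * (p ^+ 2 * v1 l ^+ 2))) + \sum_(k < n) \sum_(l < n) (C0 * v ^+ 2)).
    rewrite -!big_split /=; apply: eq_bigr => k _; rewrite -!big_split /=.
    by apply: eq_bigr => l _; rewrite !mulrDr.
  rewrite !cst sumk suml -!mulr_sumr.
  have -> : \sum_k \sum_l (d * (p ^+ 4 * w k l ^+ 2)) = d * (p ^+ 4 * sqs w).
    rewrite /sqs !mulr_sumr; apply: eq_bigr => k _.
    by rewrite !mulr_sumr.
  lra.
have h3 : \sum_k p ^+ 2 * v1 k ^+ 2 <=
  2 * \sum_k (2 * p * s k * v * v1 k + p ^+ 2 * v1 k ^+ 2 + p ^+ 2 * v * w k k) +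
  2 * d' * (p ^+ 4 * sqs w) + n%:R * (Cd * v ^+ 2).
  apply: (@le_trans _ _ (\sum_k (2 * (2 * p * s k * v * v1 k + p ^+ 2 * v1 k ^+ 2 + p ^+ 2 * v * w k k)
    + 2 * d' * (p ^+ 4 * w k k ^+ 2) + Cd * v ^+ 2))).
    by apply: ler_sum => k _; exact: cacc_grad.
  rewrite [leLHS]big_split [X in X + _ <= _]big_split /= -[X in X + _ + _ <= _]mulr_sumr -[X in _ + X + _ <= _]mulr_sumr.
  rewrite [X in _ + X <= _]sumr_const card_ord -[X in _ + X <= _]mulr_natl.
  rewrite lerD2r lerD2l; apply: ler_wpM2l; first by rewrite mulr_ge0// ltW.
  by rewrite -mulr_sumr; apply: ler_wpM2l => //; exact: sqs_diag.
rewrite dE in h2.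
have T0 : 0 <= p ^+ 4 * sqs w by rewrite mulr_ge0.
have h4 := ler_wpM2l (mulr_ge0 (ler0n R 2) nC0) h3.
have h5 := ler_wpM2r T0 d'E.
rewrite -/N in h1 *.
have g0 := sqr_ge0 g; have v0 := sqr_ge0 v.
have X1 : 0 <= 2 * (n%:R * C0) * (n%:R * Cd) * g ^+ 2 by nneg.
rewrite -/(N _ _).
set A := \sum_k \sum_l _ in h1 *.
set D := \sum_k (2 * _ * _ * _ * _ + _ + _) in h3 h4 *.
set P := \sum_k p ^+ 2 * v1 k ^+ 2 in h2 h3 h4.
lra.
Qed.

End contraction.
End caccioppoli_algebra.

Section energy.
Context {R : realType} {n : nat}.
Local Notation V := 'rV[R]_n.
Local Notation e i := (delta_mx ord0 i : V).

Lemma cut_mono (x0 x : V) (r r' : R) : 0 < r -> 2 * r <= r' -> cutoff x0 r x <= cutoff x0 r' x.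
Proof.
move=> r0 rr; have [xr|/ltW xr] := leP `|x - x0| r'.
  by rewrite (cut_eq1 _ xr) ?cut_le1//; lra.
by rewrite (cut_eq0 r0) ?cut_ge0//; lra.
Qed.

Lemma cont_cut (x0 : V) (r : R) : continuous (cutoff x0 r).
Proof. by case: (C2_cut x0 r). Qed.

Lemma cont_sqs (V2 : 'I_n -> 'I_n -> V -> R) : (forall i j, continuous (V2 i j)) ->
  continuous (fun x => sqs (fun i j => V2 i j x)).
Proof. by move=> c2; apply: cont_sum => k; apply: cont_sum => l; exact: contX. Qed.

Lemma cont_contr b (V2 : 'I_n -> 'I_n -> V -> R) k l : (forall i j, continuous (V2 i j)) ->
  continuous (fun x => contr b (fun i j => V2 i j x) k l).
Proof.
move=> c2; apply: cont_sum => i; apply: cont_sum => j.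
by apply: contM => //; exact: contC.
Qed.

Lemma C2_pow4 (p : V -> R) p1 p2 : C2 p p1 p2 ->
  C2 (fun x => p x ^+ 4) (fun i x => 4 * p x ^+ 3 * p1 i x)
     (fun i j x => 12 * p x ^+ 2 * p1 i x * p1 j x + 4 * p x ^+ 3 * p2 i j x).
Proof.
move=> h; have h2 := C2M h h; have h4 := C2M h2 h2.
rewrite (_ : (fun x => p x ^+ 4) = (fun x => p x * p x * (p x * p x))); last first.
  by apply/funext => x; ring.
by apply: C2_ext h4 _ _ => *; ring.
Qed.

Lemma cacc (lam Lam : R) : 0 < lam -> exists2 K, 0 <= K &
  forall b (x0 : V) r f f1 f2 (G : 'I_n -> 'I_n -> V -> R) g,
  ellip lam Lam b -> 0 < r -> C2 f f1 f2 -> (forall k l, continuous (G k l)) ->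
  (forall k l x, `|x - x0| <= 4 * r -> `|G k l x| <= g) ->
  WEc x0 (4 * r) (fun k l x => contr b (fun i j => f2 i j x) k l - G k l x) ->
  I (fun x => cutoff x0 r x * sqs (fun i j => f2 i j x)) <=
  K * (r^-1 ^+ 4 * I (fun x => cutoff x0 (4 * r) x * f x ^+ 2) + g ^+ 2 * I (cutoff x0 (4 * r))).
Proof.
move=> lam0; have [K1 [K2 K20 H]] := @cacc_pointwise R n lam Lam (15 ^+ 2) lam0.
exists (2 / lam * K2); first by nneg; rewrite ltW.
move=> b x0 r f f1 f2 G g eb r0 C2f cG Gg we.
have p0 : 0 < 2 * r by rewrite mulr_gt0.
(* The cutoff in the test function has radius 2r: it equals 1 wherever the cutoff of radius [r]
   lives, and vanishes off the ball of radius 4r on which the equation holds. *)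
set p := 2 * r in p0 *.
have C2p := C2_cut x0 p.
have C2e := C2M (C2_pow4 C2p) C2f.
pose eta2 i j x := cutoff x0 p x ^+ 4 * f2 i j x +
  4 * cutoff x0 p x ^+ 3 * cut1 x0 p j x * f1 i x +
  (4 * cutoff x0 p x ^+ 3 * cut1 x0 p i x * f1 j x +
   (12 * cutoff x0 p x ^+ 2 * cut1 x0 p i x * cut1 x0 p j x +
    4 * cutoff x0 p x ^+ 3 * cut2 x0 p i j x) * f x).
have {}C2e : C2 (fun x => cutoff x0 p x ^+ 4 * f x) _ eta2 := C2e.
have supp x : 4 * r <= `|x - x0| -> cutoff x0 p x ^+ 4 * f x = 0.
  by move=> xr; rewrite (cut_eq0 p0) ?expr0n ?mul0r// /p; lra.
have IT := we _ _ _ C2e supp.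
have [Ce _ Ce2] := C2_Cc C2e supp.
have [cf cf1 cf2 df1 df2] := C2f.
have [cp cp1 cp2 dp1 dp2] := C2p.
have Cp : Cc (cutoff x0 p) by exact: Cc_cut.
have r40 : 0 < 4 * r by rewrite mulr_gt0.
have CX : Cc (cutoff x0 (4 * r)) by exact: Cc_cut.
pose T x := \sum_k \sum_l (contr b (fun i j => f2 i j x) k l - G k l x) * eta2 k l x.
have CT : Cc T.
  apply: Cc_sum2 => k l; apply: CcMr => //; apply: contB => //; exact: cont_contr.
(* The partial derivative announced in [cacc_grad], in the form delivered by the product rule; its
   integral is zero. *)
pose D k x := cutoff x0 p x * cutoff x0 p x * (f x * f2 k k x + f1 k x * f1 k x) +
   (cutoff x0 p x * cut1 x0 p k x + cut1 x0 p k x * cutoff x0 p x) * (f x * f1 k x).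
have dD k x : is_derive x (e k) (fun x => cutoff x0 p x * cutoff x0 p x * (f x * f1 k x)) (D k x).
  by apply: is_deriveM1; exact: is_deriveM1.
have CpD k : Cc (fun x => cutoff x0 p x * cutoff x0 p x * (f x * f1 k x)).
  by apply: CcMl; [exact: CcMl|exact: contM].
have cD k : continuous (D k).
  apply: contD; apply: contM.
  - exact: contM.
  - by apply: contD; exact: contM.
  - by apply: contD; exact: contM.
  - exact: contM.
have ID0 k : I (D k) = 0 by exact: I_derive0 (CpD k) (cD k) (dD k).
have CD k : Cc (D k) by exact: Cc_derive (CpD k) (cD k) (dD k).
pose U x := cutoff x0 (4 * r) x * (g ^+ 2 + (f x / p ^+ 2) ^+ 2).
have CU : Cc U.
  apply: CcMl => //; apply: contD; first exact: contC.
  by apply: contX; apply: contM => //; exact: contC.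
have CS : Cc (fun x => cutoff x0 r x * sqs (fun i j => f2 i j x)).
  by apply: CcMl; [exact: Cc_cut|exact: cont_sqs].
have key x : lam / 2 * (cutoff x0 r x * sqs (fun i j => f2 i j x)) <=
    T x + K1 / p ^+ 2 * \sum_k D k x + K2 * U x.
  have [xr|/ltW xr] := leP `|x - x0| (4 * r).
    apply: (@le_trans _ _ (lam / 2 * (cutoff x0 p x ^+ 4 * sqs (fun i j => f2 i j x)))).
      apply: ler_wpM2l; first by rewrite divr_ge0// ltW.
      apply: ler_wpM2r; first exact: sqs_ge0.
      have [xr1|/ltW xr1] := leP `|x - x0| (2 * r).
        by rewrite (cut_eq1 _ xr1)// expr1n; exact: cut_le1.
      by rewrite (cut_eq0 r0 xr1); apply: exprn_ge0; exact: cut_ge0.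
    (* The pointwise inequality is applied at unit scale: derivatives of the cutoff are multiplied
       by powers of [p], while [f] and its gradient are divided by p^2 and p, so the Hessian is
       unchanged. *)
    have := H b (cutoff x0 p x) (fun k => p * cut1 x0 p k x) (fun k l => p ^+ 2 * cut2 x0 p k l x)
       (f x / p ^+ 2) (fun k => f1 k x / p) (fun i j => f2 i j x) (fun k l => G k l x) g eb
       (cut_ge0 _ _ _) (cut_le1 _ _ _) (fun i j => C2_sym C2f i j x)
       (fun k => cut1_le x0 p0 k x) (fun k l => cut2_le x0 p0 k l x) (fun k l => Gg k l x xr).
    have -> : U x = g ^+ 2 + (f x / p ^+ 2) ^+ 2 by rewrite /U (cut_eq1 _ xr) ?mul1r.
    have -> : T x = \sum_k \sum_l (contr b (fun i j => f2 i j x) k l - G k l x) *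
      (cutoff x0 p x ^+ 4 * f2 k l x +
       (4 * cutoff x0 p x ^+ 3 * (p * cut1 x0 p l x * (f1 k x / p) + p * cut1 x0 p k x * (f1 l x / p)) +
        (12 * cutoff x0 p x ^+ 2 * (p * cut1 x0 p k x) * (p * cut1 x0 p l x) +
         4 * cutoff x0 p x ^+ 3 * (p ^+ 2 * cut2 x0 p k l x)) * (f x / p ^+ 2))).
      apply: eq_bigr => k _; apply: eq_bigr => l _; congr (_ * _); rewrite /eta2.
      by field; rewrite gt_eqF.
    have -> : K1 / p ^+ 2 * \sum_k D k x = K1 * \sum_k (2 * cutoff x0 p x * (p * cut1 x0 p k x) *
       (f x / p ^+ 2) * (f1 k x / p) + cutoff x0 p x ^+ 2 * (f1 k x / p) ^+ 2 +
       cutoff x0 p x ^+ 2 * (f x / p ^+ 2) * f2 k k x).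
      rewrite -mulrA mulr_sumr; congr (_ * _); apply: eq_bigr => k _; rewrite /D.
      by field; rewrite gt_eqF.
    by [].
  rewrite (cut_eq0 r0); last by lra.
  have -> : T x = 0.
    apply: big1 => k _; apply: big1 => l _.
    by rewrite /eta2 (cut_eq0 p0) ?(cut1_eq0 p0)// ?expr0n /= ?(mul0r, mulr0, addr0)// /p; lra.
  have -> : \sum_k D k x = 0.
    apply: big1 => k _.
    by rewrite /D (cut_eq0 p0) ?(cut1_eq0 p0)// ?(mul0r, mulr0, addr0)// /p; lra.
  rewrite mul0r !mulr0 !add0r; apply: mulr_ge0 => //; apply: mulr_ge0; first exact: cut_ge0.
  by nneg.
have CDs : Cc (fun x => \sum_k D k x) by exact: Cc_sum.
have CR : Cc (fun x => T x + K1 / p ^+ 2 * \sum_k D k x + K2 * U x).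
  by apply: CcD; [apply: CcD => //; exact: CcZ|exact: CcZ].
have := I_le (CcZ (lam / 2) CS) CR key.
rewrite IZ//; set J := I (fun x => cutoff x0 r x * _).
rewrite ID; [|by apply: CcD => //; exact: CcZ|exact: CcZ].
rewrite ID//; last exact: CcZ.
rewrite (IZ _ CDs) (I_sum _ CD) big1// mulr0 addr0 [I T]IT add0r (IZ _ CU).
have -> : I U = g ^+ 2 * I (cutoff x0 (4 * r)) + p^-1 ^+ 4 * I (fun x => cutoff x0 (4 * r) x * f x ^+ 2).
  have Cff : Cc (fun x => cutoff x0 (4 * r) x * f x ^+ 2) by apply: CcMl => //; exact: contX.
  rewrite -!IZ// -ID; [|exact: CcZ..].
  by congr I; apply/funext => x; rewrite /U; field; rewrite gt_eqF.
have If0 : 0 <= I (fun x => cutoff x0 (4 * r) x * f x ^+ 2).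
  by apply: I_ge0 => x; rewrite mulr_ge0 ?sqr_ge0// cut_ge0.
set A := I _ in If0 *; set B := I _.
have pr : p^-1 ^+ 4 * A <= r^-1 ^+ 4 * A.
  apply: ler_wpM2r => //; apply: lerXn2r; [by rewrite nnegrE invr_ge0 ltW|by rewrite nnegrE invr_ge0 ltW|].
  rewrite lef_pV2 ?posrE//; rewrite /p; lra.
move=> h.
have -> : J = 2 / lam * (lam / 2 * J) by field; rewrite gt_eqF.
rewrite -[leRHS]mulrA; apply: ler_wpM2l; first by rewrite divr_ge0// ltW.
by apply: le_trans h _; apply: ler_wpM2l => //; lra.
Qed.

End energy.

(** * Schauder estimate from finite differences *)

Section differences.
Context {R : realType} {n : nat}.
Local Notation V := 'rV[R]_n.
Local Notation e i := (delta_mx ord0 i : V).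

Lemma cont_dif (f : V -> R) h : continuous f -> continuous (dif h f).
Proof. by move=> cf; apply: contB => //; exact: continuous_shiftr. Qed.

Lemma cont_iter_dif (f : V -> R) h k : continuous f -> continuous (iter k (dif h) f).
Proof. by move=> cf; elim: k => //= k IH; exact: cont_dif. Qed.

Lemma C2_iter_dif (f : V -> R) f1 f2 h k : C2 f f1 f2 ->
  C2 (iter k (dif h) f) (fun i => iter k (dif h) (f1 i)) (fun i j => iter k (dif h) (f2 i j)).
Proof. by move=> H; elim: k => //= k IH; exact: C2_dif. Qed.

Lemma dif_comm (f : V -> R) h z : dif h (dif z f) = dif z (dif h f).
Proof. by apply/funext => x; rewrite /dif [x + h + z]addrAC; ring. Qed.

Lemma iter_dif_comm (f : V -> R) h z k :
  iter k (dif h) (dif z f) = dif z (iter k (dif h) f).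
Proof. by elim: k => //= k ->; exact: dif_comm. Qed.

Lemma iter_dif_bound (f : V -> R) h k x (B : R) :
  (forall y, `|y - x| <= k%:R * `|h| -> `|f y| <= B) ->
  `|iter k (dif h) f x| <= 2 ^+ k * B.
Proof.
elim: k f B => [|k IH] f B hB.
  by rewrite expr0 mul1r; apply: hB; rewrite subrr normr0 mul0r.
rewrite iterSr exprSr -mulrA; apply: IH => y yx.
apply: le_trans (ler_normB _ _) _.
have A : `|f (y + h)| <= B.
  apply: hB; rewrite addrAC; apply: le_trans (ler_normD _ _) _.
  by rewrite -natr1 mulrDl mul1r lerD2r.
have C : `|f y| <= B.
  by apply: hB; apply: le_trans yx _; rewrite ler_wpM2r// ler_nat.
lra.
Qed.

Lemma iter_dif_osc (f : V -> R) h k x z (B : R) :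
  (forall y, `|y - x| <= k%:R * `|h| -> `|f (y + z) - f y| <= B) ->
  `|iter k (dif h) f (x + z) - iter k (dif h) f x| <= 2 ^+ k * B.
Proof. by move=> hB; rewrite -[X in `|X|]/(dif z _ x) -iter_dif_comm; exact: iter_dif_bound. Qed.

Lemma WEc_iter_dif x0 r (Phi : 'I_n -> 'I_n -> V -> R) h k :
  (forall k l, continuous (Phi k l)) -> WEc x0 r Phi ->
  WEc x0 (r - k%:R * `|h|) (fun i j => iter k (dif h) (Phi i j)).
Proof.
move=> cP we; elim: k => [|k IH] /=; first by rewrite mul0r subr0.
have := WEc_dif (h := h) _ IH; rewrite -natr1 mulrDl mul1r opprD addrA; apply.
by move=> i j; exact: cont_iter_dif.
Qed.

Lemma dif_contr b (f2 G : 'I_n -> 'I_n -> V -> R) k l h m :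
  iter m (dif h) (fun x => contr b (fun i j => f2 i j x) k l - G k l x) =
  (fun x => contr b (fun i j => iter m (dif h) (f2 i j) x) k l - iter m (dif h) (G k l) x).
Proof.
elim: m => //= m ->; apply/funext => x; rewrite /dif /contr opprD addrACA; congr (_ + _).
  rewrite -sumrB; apply: eq_bigr => i _; rewrite -sumrB; apply: eq_bigr => j _.
  by rewrite mulrBr.
by rewrite opprB addrC opprK.
Qed.

Lemma dif_telescope (f : V -> R) (h x : V) N :
  f (x + h *+ N) - f x = \sum_(p < N) dif h f (x + h *+ p).
Proof.
elim: N => [|N IH]; first by rewrite big_ord0 mulr0n addr0 subrr.
by rewrite big_ord_recr /= -IH /dif mulrSr addrA; ring.
Qed.

Lemma dif_dif_split (f : V -> R) (h x : V) N :
  dif (h *+ N) (dif (h *+ N) f) x =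
  \sum_(p < N) \sum_(q < N) dif h (dif h f) (x + h *+ (p + q)).
Proof.
rewrite -[LHS]/(dif (h *+ N) f (x + h *+ N) - dif (h *+ N) f x).
rewrite (dif_telescope (dif (h *+ N) f)); apply: eq_bigr => p _.
rewrite dif_comm -[LHS]/(dif h f (x + h *+ p + h *+ N) - dif h f (x + h *+ p)).
rewrite (dif_telescope (dif h f)); apply: eq_bigr => q _.
by rewrite mulrnDr addrA.
Qed.

Lemma MVT_dif2 (f : V -> R) f1 f2 i (s : R) x : C2 f f1 f2 ->
  exists2 z, `|z| <= 2 * `|s| & dif (s *: e i) (dif (s *: e i) f) x = s ^+ 2 * f2 i i (x + z).
Proof.
move=> C2f; have [_ _ _ d1 d2] := C2f.
have [_ _ _ D1 _] := C2_dif (s *: e i) C2f.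
have [a as1 E1] := @MVT_line R V _ _ x (e i) s (fun t _ => D1 i (x + t *: e i)).
have [b bs E2] := @MVT_line R V _ _ (x + a *: e i) (e i) s (fun t _ => d2 i i (x + a *: e i + t *: e i)).
exists (a *: e i + b *: e i).
  by apply: le_trans (ler_normD _ _) _; rewrite !normrZ normr_delta; lra.
by rewrite {1}/dif E1 {1}/dif E2 addrA; ring.
Qed.

(** The continuous argument writes the second difference as an average of f_ii. Here it is split
    into M^2 second differences of step t/M, each equal to (t/M)^2 times a nearby value of f_ii;
    Cauchy-Schwarz and translation invariance then give the bound up to an error [c]. *)
Lemma I_dif2 (f : V -> R) f1 f2 i (x0 : V) (r t : R) : C2 f f1 f2 -> 0 < t -> t <= r ->
  I (fun x => cutoff x0 r x * dif (t *: e i) (dif (t *: e i) f) x ^+ 2) <=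
  t ^+ 4 * I (fun x => cutoff x0 (4 * r) x * f2 i i x ^+ 2).
Proof.
move=> C2f t0 tr; have [cf _ c2 _ _] := C2f.
have r0 : 0 < r by lra.
have cc := @cont_cut R n.
have Cr s : 0 < s -> Cc (cutoff x0 s) by exact: Cc_cut.
have Ir : 0 <= I (cutoff x0 r) by apply: I_ge0 => x; exact: cut_ge0.
have r40 : 0 < 4 * r by lra.
apply/ler_addgt0Pr => c c0.
pose d : R := c / (t ^+ 4 * I (cutoff x0 r) + 1).
have t40 : 0 < t ^+ 4 by exact: exprn_gt0.
have d0 : 0 < d by rewrite divr_gt0// ltr_wpDl// mulr_ge0// ltW.
have cg : continuous (fun x => f2 i i x ^+ 2) by exact: contX.
have [s s0 hs] := unif_cont_compact cg (@closed_ball_compactrV R n x0 (4 * r)) d0.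
(* The step is so fine that the point supplied by the mean value theorem, at distance at most twice
   the step, changes f_ii^2 by less than [d]. *)
have [N hN] : exists N : nat, 2 * (t / N.+1%:R) < s.
  exists (Num.truncn (2 * t / s)); rewrite mulrA ltr_pdivrMr ?ltr0Sn//.
  by rewrite [s * _]mulrC -ltr_pdivrMr// truncnS_gt.
set M := N.+1 in hN; have M0 : 0 < M%:R :> R by rewrite ltr0Sn.
pose u : R := t / M%:R; have u0 : 0 < u by rewrite divr_gt0.
have uM : (u *: e i) *+ M = t *: e i.
  by rewrite -scaler_nat scalerA /u mulrC divfK// gt_eqF.
pose h : V := u *: e i.
have hM (p q : 'I_M) : `|h *+ (p + q)| <= 2 * t.
  rewrite normrMn /h normrZ normr_delta mulr1 gtr0_norm// -[leLHS]mulr_natr.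
  have -> : 2 * t = u * (2 * M%:R) by rewrite /u; field; rewrite gt_eqF.
  rewrite ler_pM2l// -natrM ler_nat mul2n -addnn leq_add// ltnW//.
have cW (p : V) : continuous (fun x : V => f2 i i (x + p) ^+ 2).
  by apply: (@continuous_shiftr R V (fun x => f2 i i x ^+ 2)).
have CcW (p : V) : Cc (fun x => cutoff x0 r x * f2 i i (x + p) ^+ 2) by apply: CcMl => //; exact: Cr.
have key x : cutoff x0 r x * dif (t *: e i) (dif (t *: e i) f) x ^+ 2 <=
   t ^+ 4 / (M%:R * M%:R) * (\sum_(p < M) \sum_(q < M) cutoff x0 r x * f2 i i (x + h *+ (p + q)) ^+ 2) +
   t ^+ 4 * d * cutoff x0 r x.
  have [xr|/ltW xr] := leP `|x - x0| (2 * r); last first.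
    rewrite (cut_eq0 r0 xr) !mul0r mulr0 addr0 big1 ?mulr0// => p _.
    by apply: big1 => q _; rewrite mul0r.
  rewrite -uM dif_dif_split pair_big /=.
  set S := \sum_p _.
  (* The Cauchy-Schwarz factor M^2 and the M^2 summands of size (t/M)^4 combine to t^4. *)
  have S2 : S ^+ 2 <= M%:R * M%:R * \sum_(p : 'I_M * 'I_M) (u ^+ 4 * (f2 i i (x + h *+ (p.1 + p.2)) ^+ 2 + d)).
    apply: le_trans (sqr_sum_le _) _.
    rewrite card_prod card_ord natrM; apply: ler_wpM2l; first by rewrite mulr_ge0.
    apply: ler_sum => -[p q] _ /=.
    have [z zu ->] := MVT_dif2 i u (x + h *+ (p + q)) C2f.
    rewrite exprMn -exprM; apply: ler_wpM2l; first by rewrite exprn_ge0// ltW.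
    rewrite -/h; have := hs (x + h *+ (p + q)) (x + h *+ (p + q) + z).
    rewrite /= opprD addrA subrr sub0r normrN [`|u|]gtr0_norm// in zu *.
    have nh : `|x + h *+ (p + q) - x0| <= 4 * r.
      by rewrite addrAC; apply: le_trans (ler_normD _ _) _; have := hM p q; lra.
    by move=> /(_ nh (le_lt_trans zu hN)); rewrite ltr_norml => /andP[h1 h2]; lra.
  have -> : t ^+ 4 = u ^+ 4 * M%:R ^+ 4 by rewrite /u; field; rewrite gt_eqF.
  have E : \sum_(p < M) \sum_(q < M) cutoff x0 r x * f2 i i (x + h *+ (p + q)) ^+ 2 =
    cutoff x0 r x * \sum_(p : 'I_M * 'I_M) f2 i i (x + h *+ (p.1 + p.2)) ^+ 2.
    by rewrite pair_big /= mulr_sumr.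
  rewrite E; apply: (@le_trans _ _ (cutoff x0 r x * (M%:R * M%:R *
     \sum_(p : 'I_M * 'I_M) (u ^+ 4 * (f2 i i (x + h *+ (p.1 + p.2)) ^+ 2 + d))))).
    by apply: ler_wpM2l => //; exact: cut_ge0.
  rewrite -mulr_sumr big_split /= sumr_const card_prod card_ord -[d *+ _]mulr_natl natrM.
  rewrite le_eqVlt; apply/orP; left; apply/eqP; field.
  by rewrite gt_eqF.
have CL : Cc (fun x => cutoff x0 r x * dif (t *: e i) (dif (t *: e i) f) x ^+ 2).
  by apply: CcMl; [exact: Cr|apply: contX; do 2 apply: cont_dif].
have CS : Cc (fun x => \sum_(p < M) \sum_(q < M) cutoff x0 r x * f2 i i (x + h *+ (p + q)) ^+ 2).
  by apply: Cc_sum => p; apply: Cc_sum => q.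
apply: le_trans (I_le CL _ key) _.
  by apply: CcD; apply: CcZ => //; exact: Cr.
rewrite ID; [|exact: CcZ|by apply: CcZ; exact: Cr].
rewrite IZ// IZ; last exact: Cr.
apply: lerD; last first.
  rewrite /d; set A := t ^+ 4 * _ in d0 *.
  rewrite mulrAC mulrC -mulrA ler_piMr ?(ltW c0)//.
  rewrite mulrC ler_pdivrMr; last by rewrite ltr_wpDl// mulr_ge0// ltW.
  by rewrite mul1r lerDl.
rewrite -mulrA; apply: ler_wpM2l; first exact: ltW.
rewrite mulrC ler_pdivrMr ?mulr_gt0//.
rewrite I_sum; last by move=> p; apply: Cc_sum => q.
set J := I (fun x => cutoff x0 (4 * r) x * _).
apply: (@le_trans _ _ (\sum_(p < M) \sum_(q < M) J)).
  apply: ler_sum => p _; rewrite I_sum//; apply: ler_sum => q _.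
  rewrite -(I_shift (- (h *+ (p + q))) (CcW _)).
  apply: I_le.
  - exact: (Cc_shift (- (h *+ (p + q))) (CcW (h *+ (p + q)))).
  - by apply: CcMl => //; exact: Cr.
  - move=> x; rewrite subrK; apply: ler_wpM2r; first exact: sqr_ge0.
    have [xr|/ltW xr] := leP `|x - x0| (4 * r).
      by rewrite (cut_eq1 _ xr)// cut_le1.
    rewrite (cut_eq0 r0) ?cut_ge0//.
    have := ler_normD (x - h *+ (p + q) - x0) (h *+ (p + q)).
    have -> : x - h *+ (p + q) - x0 + h *+ (p + q) = x - x0 by rewrite addrAC subrK.
    by have := hM p q; lra.
rewrite !sumr_const !card_ord -[leLHS]mulr_natl -[X in _ * X <= _]mulr_natl.
by rewrite mulrA mulrC.
Qed.

End differences.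

Section energy_iteration.
Context {R : realType} {n : nat}.
Local Notation V := 'rV[R]_n.
Local Notation e i := (delta_mx ord0 i : V).

(** Guarantees that 2m + 2 translations of length at most [r] stay within the ball enlarged by the
    factor 16^(m+1). *)
Lemma double_le_exp m : (m.*2.+2 <= 16 ^ m.+1)%N.
Proof.
elim: m => // m IH; rewrite doubleS expnS.
by apply: (@leq_trans (16 ^ m.+1 + 2)); rewrite ?addn2 ?ltnS//; lia.
Qed.

Lemma sqs_bound (w : 'I_n -> 'I_n -> R) K : (forall k l, `|w k l| <= K) ->
  sqs w <= n%:R * n%:R * K ^+ 2.
Proof.
move=> h; apply: (@le_trans _ _ (\sum_(k < n) \sum_(l < n) K ^+ 2)).
  apply: ler_sum => k _; apply: ler_sum => l _; rewrite -sqr_normr.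
  have := h k l; have := normr_ge0 (w k l); nra.
rewrite !sumr_const !card_ord -[leLHS]mulr_natl -[X in _ * X <= _]mulr_natl.
by rewrite mulrA.
Qed.

(** A round passes from radius r to 4r in the Caccioppoli inequality and to 16r in the second
    difference bound, hence the powers of 16. It gains t^4 from the differences against r^-4 from
    Caccioppoli; the flux term is merely multiplied by a power of 2, as it is differenced along. *)
Lemma energy_iter (lam Lam : R) m : 0 < lam -> exists2 C, 0 <= C &
  forall b (x0 : V) r t i f f1 f2 (G : 'I_n -> 'I_n -> V -> R) g K,
  ellip lam Lam b -> 0 < t -> t <= r -> C2 f f1 f2 -> (forall k l, continuous (G k l)) ->
  WEc x0 (16 ^+ m * 16 * r) (fun k l x => contr b (fun i j => f2 i j x) k l - G k l x) ->
  (forall k l x, `|x - x0| <= 16 ^+ m * 16 * r -> `|G k l x| <= g) ->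
  (forall k l x, `|x - x0| <= 16 ^+ m * 16 * r -> `|f2 k l x| <= K) ->
  I (fun x => cutoff x0 r x * sqs (fun k l => iter m.*2 (dif (t *: e i)) (f2 k l) x)) <=
  C * ((t / r) ^+ (4 * m) * K ^+ 2 + g ^+ 2) * I (cutoff x0 (16 ^+ m * r)).
Proof.
move=> lam0; elim: m => [|m [C C0 IH]].
  exists (n%:R * n%:R); first by nneg.
  move=> b x0 r t i f f1 f2 G g K eb t0 tr C2f cG we Gg fK.
  have r0 : 0 < r by lra.
  rewrite muln0 !expr0 !mul1r /= in we Gg fK *.
  have Cc0' := Cc_cut x0 r0.
  rewrite -IZ//; apply: I_le; [|exact: CcZ|].
    by apply: CcMl => //; apply: cont_sqs; case: C2f.
  move=> x; have [xr|/ltW xr] := leP `|x - x0| (2 * r); last first.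
    by rewrite cut_eq0// mul0r mulr0.
  rewrite mulrC; apply: ler_wpM2r; first exact: cut_ge0.
  apply: le_trans (sqs_bound (K := K) _) _; first by move=> k l; apply: fK; lra.
  apply: ler_wpM2l; first by nneg.
  by rewrite lerDl sqr_ge0.
have [K0 K00 Hc] := @cacc R n lam Lam lam0.
exists (K0 * C + K0 * (2 ^+ m.*2.+2) ^+ 2); first by nneg.
move=> b x0 r t i f f1 f2 G g K eb t0 tr C2f cG we Gg fK.
have r0 : 0 < r by lra.
set h := t *: e i; set k2 := m.*2.+2.
have hn : `|h| = t by rewrite normrZ normr_delta mulr1 gtr0_norm.
have C2h := C2_iter_dif h k2 C2f.
have k2r : k2%:R * t <= 16 ^+ m.+1 * r.
  apply: ler_pM => //; first exact: ltW.
  by rewrite -natrX ler_nat; exact: double_le_exp.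
have p1 : 1 <= 16 ^+ m.+1 :> R by rewrite exprn_ege1// ler1n.
have pr : r <= 16 ^+ m.+1 * r by rewrite ler_peMl// ltW.
have Gh k l x : `|x - x0| <= 4 * r -> `|iter k2 (dif h) (G k l) x| <= 2 ^+ k2 * g.
  move=> xr; apply: iter_dif_bound => y; rewrite hn => yx; apply: Gg.
  have := ler_normD (y - x) (x - x0); rewrite addrA subrK; lra.
have weh : WEc x0 (4 * r) (fun k l x => contr b (fun i j => iter k2 (dif h) (f2 i j) x) k l -
    iter k2 (dif h) (G k l) x).
  have := @WEc_iter_dif _ _ _ _ _ h k2 _ we.
  rewrite (_ : (fun _ _ => _) = (fun k l x => contr b (fun i j => iter k2 (dif h) (f2 i j) x) k l -
    iter k2 (dif h) (G k l) x)); last first.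
    by apply/funext => k; apply/funext => l; exact: dif_contr.
  move=> /(_ _)H; apply: WEc_le (H _); last first.
    by move=> k l; apply: contB => //; apply: cont_contr; case: C2f.
  by move=> x; rewrite hn; lra.
apply: le_trans (Hc b x0 r _ _ _ _ _ eb r0 C2h _ Gh weh) _.
  by move=> k l; exact: cont_iter_dif.
have C2m := C2_iter_dif h m.*2 C2f.
have r4 : t <= 4 * r by lra.
have D2 := I_dif2 i x0 C2m t0 r4.
have t16 : t <= 16 * r by lra.
have E16 : 16 ^+ m * 16 * (16 * r) = 16 ^+ m.+1 * 16 * r by rewrite exprSr; ring.
have := IH b x0 (16 * r) t i f f1 f2 G g K eb t0 t16 C2f cG.
rewrite E16 => /(_ we Gg fK).
rewrite (_ : 16 ^+ m * (16 * r) = 16 ^+ m.+1 * r); last by rewrite exprSr mulrA.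
set J := I (cutoff x0 (16 ^+ m.+1 * r)).
set Q := I (fun x => _ * sqs _) => hQ.
have r160 : 0 < 16 * r by lra.
have J0 : 0 <= J by apply: I_ge0 => x; exact: cut_ge0.
have cmm := C2m; case: cmm => _ _ c2m _ _.
have D3 : I (fun x => cutoff x0 (4 * (4 * r)) x * iter m.*2 (dif h) (f2 i i) x ^+ 2) <= Q.
  apply: I_le.
  - by apply: CcMl; [apply: Cc_cut; lra|exact: contX].
  - by apply: CcMl; [exact: Cc_cut|exact: cont_sqs].
  - move=> x; rewrite mulrA (_ : 4 * 4 * r = 16 * r); last by ring.
    apply: ler_wpM2l; first exact: cut_ge0.
    exact: (sqs_ge (fun k l => iter m.*2 (dif h) (f2 k l) x) i i).
have D4 : I (cutoff x0 (4 * r)) <= J.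
  apply: I_le; [apply: Cc_cut; lra|apply: Cc_cut; rewrite mulr_gt0//; lra|].
  move=> x; apply: cut_mono; first lra.
  have : 16 <= 16 ^+ m.+1 :> R by rewrite exprS ler_peMr// exprn_ege1// ler1n.
  by nra.
have tr1 : (t / r) ^+ 4 <= 1.
  by apply: exprn_ile1; [rewrite divr_ge0// ltW|rewrite ler_pdivrMr// mul1r].
have tr0 : 0 <= t / r by rewrite divr_ge0// ltW.
have A1 : r^-1 ^+ 4 * I (fun x => cutoff x0 (4 * r) x * iter k2 (dif h) f x ^+ 2) <=
    (t / r) ^+ 4 * Q.
  have -> : (t / r) ^+ 4 * Q = r^-1 ^+ 4 * (t ^+ 4 * Q) by field; rewrite gt_eqF.
  apply: ler_wpM2l; first by rewrite exprn_ge0// invr_ge0 ltW.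
  by apply: le_trans D2 _; apply: ler_wpM2l => //; rewrite exprn_ge0// ltW.
have A2 : (2 ^+ k2 * g) ^+ 2 * I (cutoff x0 (4 * r)) <= (2 ^+ k2) ^+ 2 * (g ^+ 2 * J).
  rewrite exprMn -[leLHS]mulrA; apply: ler_wpM2l; first exact: sqr_ge0.
  by apply: ler_wpM2l; first exact: sqr_ge0.
have T4m : (t / (16 * r)) ^+ (4 * m) <= (t / r) ^+ (4 * m).
  have q0 : 0 <= t / (16 * r) by rewrite divr_ge0// ltW.
  have q1 : t / (16 * r) <= t / r.
    by apply: ler_wpM2l; [exact: ltW|rewrite lef_pV2 ?posrE//; lra].
  by apply: lerXn2r; rewrite ?nnegrE.
set P := (t / r) ^+ (4 * m) in T4m.
have P0 : 0 <= P by exact: exprn_ge0.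
have A3 : (t / r) ^+ 4 * Q <= C * ((t / r) ^+ (4 * m.+1) * K ^+ 2 + g ^+ 2) * J.
  apply: (@le_trans _ _ ((t / r) ^+ 4 * (C * (P * K ^+ 2 + g ^+ 2) * J))).
    apply: ler_wpM2l; first exact: exprn_ge0.
    apply: le_trans hQ _; apply: ler_wpM2r => //; apply: ler_wpM2l => //.
    by rewrite lerD2r; apply: ler_wpM2r => //; exact: sqr_ge0.
  rewrite mulnS exprD -/P.
  have -> : (t / r) ^+ 4 * (C * (P * K ^+ 2 + g ^+ 2) * J) =
    C * ((t / r) ^+ 4 * P * K ^+ 2 + (t / r) ^+ 4 * g ^+ 2) * J by ring.
  apply: ler_wpM2r => //; apply: ler_wpM2l => //; rewrite lerD2l.
  by rewrite ler_piMl// sqr_ge0.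
set T := (t / r) ^+ (4 * m.+1) in A3 *.
have T0 : 0 <= T by exact: exprn_ge0.
have KT : 0 <= (2 ^+ k2) ^+ 2 * (T * K ^+ 2 * J) by nneg.
apply: (@le_trans _ _ (K0 * (C * (T * K ^+ 2 + g ^+ 2) * J + (2 ^+ k2) ^+ 2 * (g ^+ 2 * J)))).
  apply: ler_wpM2l => //; apply: lerD => //; exact: le_trans A1 A3.
have -> : (K0 * C + K0 * (2 ^+ k2) ^+ 2) * (T * K ^+ 2 + g ^+ 2) * J =
  K0 * (C * (T * K ^+ 2 + g ^+ 2) * J + (2 ^+ k2) ^+ 2 * (g ^+ 2 * J) + (2 ^+ k2) ^+ 2 * (T * K ^+ 2 * J)) by ring.
by apply: ler_wpM2l => //; rewrite lerDl.
Qed.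

End energy_iteration.

Section powers.
Context {R : realType}.

Lemma ler_powR_base (a : R) x y : 0 <= a -> 0 <= x -> x <= y -> x `^ a <= y `^ a.
Proof.
by move=> a0 x0 xy; apply: ge0_ler_powR; rewrite ?nnegrE//; exact: le_trans xy.
Qed.

Lemma small_powR (a eps : R) : 0 < a -> 0 < eps ->
  exists s, [/\ 0 < s, s <= 1 & s `^ a <= eps].
Proof.
move=> a0 e0; exists (minr 1 (eps `^ a^-1)).
have p0 : 0 < eps `^ a^-1 by exact: powR_gt0.
split; [by rewrite lt_min ltr01|by rewrite ge_min lexx|].
apply: (@le_trans _ _ ((eps `^ a^-1) `^ a)).
  apply: ler_powR_base; rewrite ?ge_min ?lexx ?orbT//; first exact: ltW.
  by rewrite le_min ler01 ltW.
by rewrite -powRrM mulVf ?gt_eqF// powRr1// ltW.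
Qed.

Lemma large_powR (a eps : R) : a < 1 -> 0 < eps ->
  exists K : nat, (0 < K)%N /\ K%:R `^ a <= eps * K%:R.
Proof.
move=> a1 e0; have b0 : 0 < 1 - a by lra.
have [s [s0 s1 hs]] := small_powR b0 e0.
exists (Num.truncn s^-1).+1; split => //; set K := _.+1.
have K0 : 0 < K%:R :> R by rewrite ltr0Sn.
have sK : s^-1 <= K%:R by apply/ltW; exact: truncnS_gt.
have Kb : 0 < K%:R `^ (1 - a) :> R by exact: powR_gt0.
have E : K%:R `^ a * K%:R `^ (1 - a) = K%:R :> R.
  rewrite -powRD; last by apply/implyP => _; rewrite gt_eqF.
  by rewrite (_ : a + (1 - a) = 1) ?powRr1 ?ltW//; ring.
have e1 : 1 <= eps * K%:R `^ (1 - a).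
  apply: (@le_trans _ _ (s `^ (1 - a) * s^-1 `^ (1 - a))).
    rewrite -powRM; [|exact: ltW|by rewrite invr_ge0 ltW].
    by rewrite mulfV ?gt_eqF// powR1.
  apply: ler_pM; rewrite ?powR_ge0//.
  by apply: ler_powR_base => //; rewrite ?invr_ge0 ltW.
rewrite -[X in _ <= _ * X]E mulrCA -[leLHS]mulr1.
by apply: ler_wpM2l => //; exact: powR_ge0.
Qed.

(** The balance of gain and volume in dimension k with k + 1 rounds: a factor 1/M is left over,
    which a large [M] makes as small as desired. *)
Lemma expr_ratio (M : R) (k : nat) : 1 <= M ->
  M^-1 ^+ (4 * k.+1) * M ^+ k <= M^-1.
Proof.
move=> M1; have M0 : 0 < M by lra.
have Mi1 : M^-1 <= 1 by rewrite invf_le1.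
have Mi0 : 0 <= M^-1 by rewrite invr_ge0 ltW.
have E : (4 * k.+1 = (3 * k + 3).+1 + k)%N by lia.
rewrite E exprD -mulrA -exprMn mulVf ?gt_eqF// expr1n mulr1 exprS.
by rewrite ler_piMr// exprn_ile1.
Qed.

End powers.

Section difference_estimate.
Context {R : realType} {n : nat}.
Local Notation V := 'rV[R]_n.
Local Notation e i := (delta_mx ord0 i : V).
Variables (lam Lam alpha : R).
Hypotheses (lam0 : 0 < lam) (alpha0 : 0 < alpha) (alpha1 : alpha < 1).

(* The constant [delta] in front of the Hoelder term is arbitrarily small, at the
   cost of a larger ball and a larger constant in front of the flux error. *)
Definition dif_estimate (p : nat) := forall delta : R, 0 < delta -> exists N C : R,
  [/\ 0 < N, 0 <= C & forall b (x0 : V) t i f f1 f2 (G : 'I_n -> 'I_n -> V -> R) H g,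
  ellip lam Lam b -> 0 < t -> C2 f f1 f2 -> (forall k l, continuous (G k l)) ->
  0 <= H -> 0 <= g ->
  (forall k l x y, `|x - x0| <= N * t -> `|y - x0| <= N * t ->
     `|f2 k l x - f2 k l y| <= H * `|x - y| `^ alpha) ->
  WEc x0 (N * t) (fun k l x => contr b (fun i j => f2 i j x) k l - G k l x) ->
  (forall k l x, `|x - x0| <= N * t -> `|G k l x| <= g) ->
  forall k l, `|iter p (dif (t *: e i)) (f2 k l) x0| <= delta * (H * t `^ alpha) + C * g].

(** Two differences come first: they turn the Hoelder bound into a sup bound 2 H t^alpha on a
    Hessian, to which [energy_iter] applies with m = n + 1 rounds. The resulting mean square bound
    is read off on a tiny cube around [x0], where the iterated difference oscillates little, again
    by the Hoelder bound. *)
Lemma dif_estimate_high : dif_estimate n.+1.*2.+2.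
Proof.
move=> delta delta0; set m := n.+1; set p := m.*2.+2.
have [Ce Ce0 He] := @energy_iter R n lam Lam m lam0.
have ep0 : 0 < delta / 2 ^+ p.+1 by rewrite divr_gt0// exprn_gt0.
(* An iterated difference of order [p] oscillates by at most 2^p H (s t)^alpha over distance s t;
   this [s] makes it at most half of the allowed amount. The cutoff radius is [s / 2] times t
   because a cutoff lives on twice its radius. *)
have [s [s0 s1 hs]] := small_powR alpha0 ep0.
pose tau : R := s / 2; have tau0 : 0 < tau by rewrite divr_gt0.
(* Ratio of the volumes of the large ball and of the tiny cube, apart from the factor M^n. *)
pose kap : R := (2 * 16 ^+ m / tau) ^+ n.
have kap0 : 0 < kap by rewrite exprn_gt0// divr_gt0// mulr_gt0// exprn_gt0.
(* Chosen so that 16 Ce kap / M is at most delta^2: this is the Hoelder part of the energy bound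
   once M^(-4m) M^n has been reduced to 1/M. *)
pose M : R := 1 + 16 * Ce * kap / delta ^+ 2.
have M1 : 1 <= M by rewrite lerDl; nneg; rewrite ?ltW.
have M0 : 0 < M by lra.
pose C2' : R := 32 * Ce * kap * M ^+ n.
have C20 : 0 <= C2' by rewrite /C2'; nneg; rewrite ?ltW.
exists (16 ^+ m * 16 * M + 2), (Num.sqrt C2').
have N0 : 0 < 16 ^+ m * 16 * M by rewrite !mulr_gt0// exprn_gt0.
split; [lra|exact: sqrtr_ge0|].
move=> b x0 t i f f1 f2 G H g eb t0 C2f cG H0 g0 hol we Gg k l.
set h := t *: e i.
have hn : `|h| = t by rewrite normrZ normr_delta mulr1 gtr0_norm.
set N := 16 ^+ m * 16 * M in N0 hol we Gg.
have Nt : (N + 2) * t = N * t + 2 * t by rewrite mulrDl.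
rewrite Nt in hol we Gg.
have ta0 : 0 <= t `^ alpha by exact: powR_ge0.
have C2h := C2_iter_dif h 2 C2f.
have tR : t <= M * t by rewrite ler_peMl// ltW.
have weh : WEc x0 (16 ^+ m * 16 * (M * t)) (fun k l x => contr b (fun i j => iter 2 (dif h) (f2 i j) x) k l -
    iter 2 (dif h) (G k l) x).
  have := @WEc_iter_dif _ _ _ _ _ h 2 _ we.
  rewrite (_ : (fun _ _ => _) = (fun k l x => contr b (fun i j => iter 2 (dif h) (f2 i j) x) k l -
    iter 2 (dif h) (G k l) x)); last first.
    by apply/funext => k'; apply/funext => l'; exact: dif_contr.
  move=> /(_ _)Hh; apply: WEc_le (Hh _); last first.
    by move=> k' l'; apply: contB => //; apply: cont_contr; case: C2f.
  by move=> x; rewrite hn addrK mulrA.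
have Gh k' l' x : `|x - x0| <= 16 ^+ m * 16 * (M * t) -> `|iter 2 (dif h) (G k' l') x| <= 4 * g.
  move=> xr; have -> : 4 = 2 ^+ 2 :> R by ring.
  apply: iter_dif_bound => y; rewrite hn => yx; apply: Gg.
  by have := ler_normD (y - x) (x - x0); rewrite addrA subrK; rewrite mulrA -/N in xr; lra.
have difh x k' l' : `|x - x0| <= N * t + t -> `|dif h (f2 k' l') x| <= H * t `^ alpha.
  move=> xr; rewrite /dif; have := hol k' l' (x + h) x; rewrite [x + h - x]addrAC subrr add0r hn; apply; last by lra.
  by rewrite addrAC; apply: le_trans (ler_normD _ _) _; rewrite hn; lra.
have fK k' l' x : `|x - x0| <= 16 ^+ m * 16 * (M * t) -> `|iter 2 (dif h) (f2 k' l') x| <= 2 * (H * t `^ alpha).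
  rewrite mulrA -/N => xr /=; apply: le_trans (ler_normB _ _) _.
  have A : `|dif h (f2 k' l') (x + h)| <= H * t `^ alpha.
    by apply: difh; rewrite addrAC; apply: le_trans (ler_normD _ _) _; rewrite hn; lra.
  have B : `|dif h (f2 k' l') x| <= H * t `^ alpha by apply: difh; lra.
  lra.
have cG2 k' l' : continuous (iter 2 (dif h) (G k' l')) by exact: cont_iter_dif.
have := He b x0 (M * t) t i _ _ _ _ _ _ eb t0 tR C2h cG2 weh Gh fK.
have Mt0 : 0 < M * t by rewrite mulr_gt0.
have -> : t / (M * t) = M^-1 by field; rewrite !gt_eqF.
set J := I (cutoff x0 _).
set Q := I _ => hQ.
have tt0 : 0 < tau * t by rewrite mulr_gt0.
have J0 : 0 <= J by apply: I_ge0 => x; exact: cut_ge0.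
have r160 : 0 < 16 ^+ m * (M * t) by rewrite mulr_gt0// exprn_gt0.
set c := I (cutoff x0 (tau * t)).
have c0 : 1 * (2 * (tau * t)) ^+ n <= c.
  apply: (I_ge_cube (x0 := x0)) => //; first exact: Cc_cut.
    by move=> x; exact: cut_ge0.
  by move=> x xr; rewrite cut_eq1// ltW.
have cp : 0 < c by apply: lt_le_trans c0; rewrite mul1r exprn_gt0// mulr_gt0.
have Jc : J <= kap * M ^+ n * c.
  apply: (@le_trans _ _ (1 * (2 * (2 * (16 ^+ m * (M * t)))) ^+ n)).
    apply: (@I_le_cube R n _ x0) => //; [by rewrite mulr_gt0|exact: Cc_cut| |].
      by move=> x; exact: cut_le1.
    by move=> x xr; rewrite cut_eq0.
  apply: (@le_trans _ _ (kap * M ^+ n * (1 * (2 * (tau * t)) ^+ n))).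
    rewrite !mul1r /kap -!exprMn le_eqVlt; apply/orP; left; apply/eqP; congr (_ ^+ _).
    by field; rewrite gt_eqF.
  by apply: ler_wpM2l => //; apply: mulr_ge0; [exact: ltW|apply: exprn_ge0; exact: ltW].
pose u x := iter p (dif h) (f2 k l) x.
have cu : continuous u by apply: cont_iter_dif; case: C2f.
have uosc x : `|x - x0| <= s * t -> `|u x0 - u x| <= delta / 2 * (H * t `^ alpha).
  move=> xr; rewrite distrC /u.
  have -> : x = x0 + (x - x0) by rewrite addrC subrK.
  apply: (@le_trans _ _ (2 ^+ p * (H * (s * t) `^ alpha))).
    apply: iter_dif_osc => y; rewrite hn => yx.
    have pN : p%:R * t + t <= N * t.
      have h1 : p%:R <= 16 ^+ m * 16 :> R by rewrite -exprSr -natrX ler_nat double_le_exp.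
      have h2 : p%:R * t <= 16 ^+ m * 1 * t.
        rewrite mulr1; apply: ler_wpM2r; first exact: ltW.
        rewrite -natrX ler_nat /p.
        by rewrite /m; clear; elim: n => // k IH; rewrite doubleS !expnS in IH *; lia.
      have h3 : 1 <= 16 ^+ m :> R by rewrite exprn_ege1// ler1n.
      have h4 : 16 ^+ m * 16 * t <= N * t.
        apply: ler_wpM2r; first exact: ltW.
        by rewrite /N ler_peMr// mulr_ge0// exprn_ge0.
      have h5 : t <= 16 ^+ m * t by rewrite ler_peMl// ltW.
      clear -t0 h2 h4 h5; lra.
    have st : s * t <= t by rewrite ler_piMl// ltW.
    apply: le_trans (hol k l _ _ _ _) _.
    - rewrite addrAC; apply: le_trans (ler_normD _ _) _; clear -yx pN st xr t0; lra.
    - clear -yx pN t0; lra.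
    - rewrite [y + _ - y]addrAC subrr add0r; apply: ler_wpM2l => //.
      by apply: ler_powR_base => //; exact: ltW.
  rewrite (powRM _ (ltW s0) (ltW t0)).
  have hs2 : 2 ^+ p * s `^ alpha <= delta / 2.
    rewrite mulrC -ler_pdivlMr ?exprn_gt0//; apply: le_trans hs _.
    by rewrite exprS invfM mulrA.
  have -> : 2 ^+ p * (H * (s `^ alpha * t `^ alpha)) = (2 ^+ p * s `^ alpha) * (H * t `^ alpha) by ring.
  by apply: ler_wpM2r => //; exact: mulr_ge0.
set X := H * t `^ alpha in uosc fK *.
have X0 : 0 <= X by exact: mulr_ge0.
have CQ : Cc (fun x => cutoff x0 (M * t) x * sqs (fun k l => iter m.*2 (dif h) (iter 2 (dif h) (f2 k l)) x)).
  apply: CcMl; first exact: Cc_cut.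
  by apply: cont_sqs => k' l'; apply: cont_iter_dif; apply: cont_iter_dif; case: C2f.
have Ccc : Cc (cutoff x0 (tau * t)) by exact: Cc_cut.
have upq x : u x ^+ 2 <= sqs (fun k l => iter m.*2 (dif h) (iter 2 (dif h) (f2 k l)) x).
  have -> : u x = iter m.*2 (dif h) (iter 2 (dif h) (f2 k l)) x.
    by rewrite /u -iterD addn2.
  exact: (sqs_ge (fun k l => iter m.*2 (dif h) (iter 2 (dif h) (f2 k l)) x) k l).
have key : u x0 ^+ 2 * c <= 2 * Q + delta ^+ 2 / 2 * X ^+ 2 * c.
  rewrite -IZ// -[X in _ <= 2 * X + _]/Q -IZ// -IZ// -ID; [|exact: CcZ..].
  apply: I_le; [exact: CcZ|by apply: CcD; exact: CcZ|].
  move=> x; have [xr|/ltW xr] := leP `|x - x0| (2 * (tau * t)).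
    have c1 := cut_ge0 x0 (tau * t) x.
    have cle : cutoff x0 (tau * t) x <= cutoff x0 (M * t) x.
      apply: cut_mono => //; rewrite /tau.
      have : s * t <= t by rewrite ler_piMl// ltW.
      clear -tR; lra.
    have ux : u x0 ^+ 2 <= 2 * u x ^+ 2 + delta ^+ 2 / 2 * X ^+ 2.
      have st : `|x - x0| <= s * t by apply: le_trans xr _; rewrite /tau; clear -tR; lra.
      have := uosc x st; have dX : 0 <= delta / 2 * X by rewrite mulr_ge0// divr_ge0// ltW.
      rewrite ler_norml => /andP[v1 v2].
      have : (u x0 - u x) ^+ 2 <= (delta / 2 * X) ^+ 2 by clear -v1 v2 dX; nra.
      have := sqr_ge0 (u x0 - u x - u x).
      clear -tR; lra.
    apply: (@le_trans _ _ (cutoff x0 (tau * t) x * (2 * u x ^+ 2 + delta ^+ 2 / 2 * X ^+ 2))).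
      by rewrite mulrC; apply: ler_wpM2l.
    have := ler_pM c1 (sqr_ge0 (u x)) cle (upq x); clear -tR; lra.
  rewrite (cut_eq0 tt0)// !mulr0 addr0; apply: mulr_ge0 => //.
  by apply: mulr_ge0; [exact: cut_ge0|exact: sqs_ge0].
have fin : u x0 ^+ 2 <= delta ^+ 2 * X ^+ 2 + C2' * g ^+ 2.
  rewrite -(ler_pM2r cp); apply: le_trans key _.
  have MM : M^-1 ^+ (4 * m) * M ^+ n <= M^-1.
    exact: expr_ratio.
  have Mi : 16 * Ce * kap * M^-1 <= delta ^+ 2 / 2 * 2.
    have d20 : 0 < delta ^+ 2 by exact: exprn_gt0.
    rewrite divfK// ler_pdivrMr// /M mulrDr mulr1 mulrCA mulfV ?gt_eqF// mulr1 lerDr; exact: ltW.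
  have Q1 : Q <= Ce * (M^-1 ^+ (4 * m) * (2 * X) ^+ 2 + (4 * g) ^+ 2) * (kap * M ^+ n * c).
    apply: le_trans hQ _; apply: ler_wpM2l => //.
    by apply: mulr_ge0 => //; apply: addr_ge0; nneg; rewrite ?invr_ge0 ?ltW.
  have Z : Ce * kap * c * X ^+ 2 * (M^-1 ^+ (4 * m) * M ^+ n) <= Ce * kap * c * X ^+ 2 * M^-1.
    by apply: ler_wpM2l => //; nneg; rewrite ?ltW.
  have Y : c * X ^+ 2 * (16 * Ce * kap * M^-1) <= c * X ^+ 2 * (delta ^+ 2 / 2 * 2).
    by apply: ler_wpM2l => //; nneg; rewrite ?ltW.
  rewrite /C2'; clear -Q1 Z Y; lra.
have S2 : C2' = Num.sqrt C2' ^+ 2 by rewrite sqr_sqrtr.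
rewrite -/p -/h -[iter _ _ _ _]/(u x0).
set q := Num.sqrt C2' in S2 *; have q0 : 0 <= q by exact: sqrtr_ge0.
have dX : 0 <= delta * X by rewrite mulr_ge0// ltW.
have qg : 0 <= q * g by rewrite mulr_ge0.
rewrite -(ler_sqr (_ : `|u x0| \is Num.nneg)) ?nnegrE ?addr_ge0//.
rewrite sqr_normr; apply: le_trans fin _; rewrite S2.
have := mulr_ge0 dX qg; clear -tR; lra.
Qed.

(* A difference with step K t is a sum of K differences with step t, so a bound
   on the difference of one order more controls the variation of these summands;
   K^alpha <= eps K absorbs the remaining term. *)
Lemma dif_estimate_step j : dif_estimate j.+2 -> dif_estimate j.+1.
Proof.
move=> IH delta delta0.
(* The [j] inner differences cost 2^j, so K^alpha must be below this multiple of K. In turn each of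
   the K summands deviates from the one at [x0] by at most K differences of higher order, whence the
   tolerance delta/(2K) for those. *)
have ep0 : 0 < delta / 2 / 2 ^+ j by rewrite !divr_gt0// exprn_gt0.
have [K [K0 hK]] := large_powR alpha1 ep0.
have Kr : 0 < K%:R :> R by rewrite ltr0n.
have d'0 : 0 < delta / (2 * K%:R) by rewrite divr_gt0// mulr_gt0.
have [N' [C' [N'0 C'0 IH']]] := IH _ d'0.
exists (N' + K%:R + j.+1%:R), (K%:R * C'); split; [by rewrite !addr_gt0|by nneg|].
move=> b x0 t i f f1 f2 G H g eb t0 C2f cG H0 g0 hol we Gg k l.
set h := t *: e i.
have hn : `|h| = t by rewrite normrZ normr_delta mulr1 gtr0_norm.
rewrite !mulrDl in hol we Gg.
have jt : 0 < j.+1%:R * t by rewrite mulr_gt0.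
have Kt : 0 <= K%:R * t by rewrite mulr_ge0// ltW.
have N't : 0 < N' * t by rewrite mulr_gt0.
have hq q : (q <= K)%N -> `|h *+ q| <= K%:R * t.
  move=> qK; rewrite normrMn hn -[leLHS]mulr_natl; apply: ler_wpM2r; first exact: ltW.
  by rewrite ler_nat.
set X := H * t `^ alpha.
have X0 : 0 <= X by rewrite mulr_ge0// powR_ge0.
pose D q x := iter q (dif h) (f2 k l) x.
pose B : R := delta / (2 * K%:R) * X + C' * g.
have B0 : 0 <= B by rewrite /B; nneg; rewrite ltW.
have step q : (q < K)%N -> `|D j.+2 (x0 + h *+ q)| <= B.
  move=> qK; have hqK := hq _ (ltnW qK).
  have inball (x : V) : `|x - (x0 + h *+ q)| <= N' * t -> `|x - x0| <= N' * t + K%:R * t.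
    move=> xr; have := ler_normD (x - (x0 + h *+ q)) (h *+ q).
    have -> : x - (x0 + h *+ q) + h *+ q = x - x0 by rewrite opprD addrA subrK.
    lra.
  apply: (IH' b _ t i f f1 f2 G H g eb t0 C2f cG H0 g0).
  - by move=> k' l' x y /inball xr /inball yr; apply: hol; lra.
  - apply: WEc_le we => x xr; rewrite leNgt; apply/negP => /ltW/inball; lra.
  - by move=> k' l' x /inball xr; apply: Gg; lra.
have D1 q : (q <= K)%N -> `|D j.+1 (x0 + h *+ q) - D j.+1 x0| <= K%:R * B.
  move=> qK; rewrite (dif_telescope (D j.+1)); apply: le_trans (ler_norm_sum _ _ _) _.
  apply: (@le_trans _ _ (\sum_(p < q) B)).
    by apply: ler_sum => p _; apply: step; exact: leq_trans qK.
  rewrite sumr_const card_ord -[leLHS]mulr_natl; apply: ler_wpM2r => //.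
  by rewrite ler_nat.
have D0 : `|D j (x0 + h *+ K) - D j x0| <= 2 ^+ j * (H * (K%:R `^ alpha * t `^ alpha)).
  apply: iter_dif_osc => y; rewrite hn => yx.
  have hKK : `|h *+ K| = K%:R * t by rewrite normrMn hn -[LHS]mulr_natl.
  have jj : j%:R * t <= j.+1%:R * t by apply: ler_wpM2r; [exact: ltW|rewrite ler_nat].
  apply: le_trans (hol k l _ _ _ _) _.
  - rewrite addrAC; apply: le_trans (ler_normD _ _) _; rewrite hKK; lra.
  - lra.
  - by rewrite [y + _ - y]addrAC subrr add0r hKK powRM// ltW.
have sumD : K%:R * D j.+1 x0 = (D j (x0 + h *+ K) - D j x0) -
    \sum_(q < K) (D j.+1 (x0 + h *+ q) - D j.+1 x0).
  rewrite (dif_telescope (D j)) -sumrB (eq_bigr (fun=> D j.+1 x0)) => [|q _].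
    by rewrite sumr_const card_ord -[RHS]mulr_natl.
  exact: subKr.
have : K%:R * `|D j.+1 x0| <= K%:R * (delta / 2 * X) + K%:R * (K%:R * B).
  rewrite -[K%:R in X in X <= _]ger0_norm ?(ltW Kr)// -normrM sumD.
  apply: le_trans (ler_normB _ _) _; apply: lerD.
    apply: le_trans D0 _.
    have -> : 2 ^+ j * (H * (K%:R `^ alpha * t `^ alpha)) = 2 ^+ j * K%:R `^ alpha * X by rewrite /X; ring.
    rewrite mulrA; apply: ler_wpM2r => //.
    rewrite mulrC -ler_pdivlMr ?exprn_gt0//; apply: le_trans hK _.
    by rewrite le_eqVlt; apply/orP; left; apply/eqP; ring.
  apply: le_trans (ler_norm_sum _ _ _) _.
  apply: (@le_trans _ _ (\sum_(q < K) (K%:R * B))).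
    by apply: ler_sum => q _; apply: D1; exact: ltnW.
  by rewrite sumr_const card_ord -[leLHS]mulr_natl.
rewrite -mulrDr ler_pM2l// => h1.
apply: le_trans h1 _; rewrite -/X /B.
rewrite le_eqVlt; apply/orP; left; apply/eqP; field.
by rewrite gt_eqF.
Qed.

Lemma dif_estimate1 : dif_estimate 1.
Proof.
have := dif_estimate_high; elim: n.+1.*2.+1 => // j IH /dif_estimate_step; exact: IH.
Qed.

End difference_estimate.

Section holder_path.
Context {R : realType} {n : nat}.
Local Notation V := 'rV[R]_n.
Local Notation e i := (delta_mx ord0 i : V).

(** Coordinates of [x] are replaced one by one by those of [y]. Each intermediate point has
    coordinates of [x] or of [y] only, so it stays in the max norm ball. *)
Lemma holder_path (g : V -> R) (x0 : V) (s H a : R) : 0 <= H -> 0 <= a ->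
  (forall i t x, 0 < t -> `|x - x0| <= s -> `|x + t *: e i - x0| <= s ->
     `|g (x + t *: e i) - g x| <= H * t `^ a) ->
  forall x y, `|x - x0| <= s -> `|y - x0| <= s -> `|g x - g y| <= n%:R * H * `|x - y| `^ a.
Proof.
move=> H0 a0 hg x y xs ys.
pose z (k : nat) : V := \row_i (if (i < k)%N then y ord0 i else x ord0 i).
have s0 : 0 <= s by apply: le_trans xs.
have zs k : `|z k - x0| <= s.
  apply: normrV_leP => // i; rewrite !mxE; case: ifP => _.
    by apply: le_trans ys; have := normrV_coord (y - x0) i; rewrite !mxE.
  by apply: le_trans xs; have := normrV_coord (x - x0) i; rewrite !mxE.
have zE (k : 'I_n) : z k.+1 = z k + (y ord0 k - x ord0 k) *: e k.
  apply/rowP => i; rewrite !mxE eqxx /= ltnS leq_eqVlt -[(i : nat) == k]/(i == k).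
  case: eqVneq => [->|_] /=; first by rewrite ltnn mulr1 addrC subrK.
  by rewrite mulr0 addr0.
have step (k : 'I_n) : `|g (z k.+1) - g (z k)| <= H * `|x - y| `^ a.
  have dk : `|y ord0 k - x ord0 k| <= `|x - y|.
    by have := normrV_coord (x - y) k; rewrite !mxE distrC.
  have [yx|yx|yx] := ltgtP (y ord0 k) (x ord0 k).
  - have zE' : z k = z k.+1 + (x ord0 k - y ord0 k) *: e k.
      by rewrite zE -addrA -scalerDl addrA subrK subrr scale0r addr0.
    rewrite distrC {1}zE'; apply: (@le_trans _ _ (H * (x ord0 k - y ord0 k) `^ a)).
      by apply: hg; rewrite ?subr_gt0 -?zE'.
    apply: ler_wpM2l => //; apply: ler_powR_base => //; first by rewrite subr_ge0 ltW.
    by apply: le_trans dk; rewrite distrC ler_norm.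
  - rewrite zE; apply: (@le_trans _ _ (H * (y ord0 k - x ord0 k) `^ a)).
      by apply: hg; rewrite ?subr_gt0 -?zE.
    apply: ler_wpM2l => //; apply: ler_powR_base => //; first by rewrite subr_ge0 ltW.
    by apply: le_trans dk; rewrite ler_norm.
  - by rewrite zE yx subrr scale0r addr0 subrr normr0 mulr_ge0// powR_ge0.
have path k : (k <= n)%N -> `|g (z k) - g (z 0%N)| <= k%:R * (H * `|x - y| `^ a).
  elim: k => [|k IH] kn; first by rewrite subrr normr0 mul0r.
  rewrite -natr1 mulrDl mul1r; have := IH (ltnW kn); have := step (Ordinal kn).
  have := ler_normD (g (z k.+1) - g (z k)) (g (z k) - g (z 0%N)).
  rewrite addrA subrK /=; lra.
have := path n (leqnn n).
have -> : z n = y by apply/rowP => i; rewrite mxE ltn_ord.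
have -> : z 0%N = x by apply/rowP => i; rewrite mxE.
by rewrite distrC mulrA.
Qed.

End holder_path.

Lemma powR_ratio {R : realType} (g r a : R) : 0 < g -> g <= r -> a < 1 ->
  g * r `^ a <= r * g `^ a.
Proof.
move=> g0 gr a1; have r0 : 0 < r by lra.
have E (x : R) : 0 < x -> x = x `^ a * x `^ (1 - a).
  move=> x0; rewrite -powRD; last by apply/implyP => _; rewrite gt_eqF.
  by rewrite (_ : a + (1 - a) = 1) ?powRr1 ?ltW//; ring.
have h : g `^ (1 - a) <= r `^ (1 - a) by apply: ler_powR_base; lra.
rewrite [X in X * _ <= _](E g g0) [X in _ <= X * _](E r r0).
have := ler_wpM2l (mulr_ge0 (powR_ge0 g a) (powR_ge0 r a)) h; lra.
Qed.

(** * Interior Schauder estimate *)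

Section schauder.
Context {R : realType} {n : nat}.
Local Notation V := 'rV[R]_n.
Local Notation e i := (delta_mx ord0 i : V).
Variables (lam Lam alpha Kc r : R).
Hypotheses (lam0 : 0 < lam) (alpha0 : 0 < alpha) (alpha1 : alpha < 1)
  (Kc0 : 0 <= Kc) (r0 : 0 < r).

(* The flux Phi is, near each point x and up to an error of order rho^alpha, an
   affine elliptic function of the Hessian f2: it is this form of the equation
   that is shared by difference quotients of linear and nonlinear equations. *)
Definition almost_linear (x0 : V) (f2 Phi : 'I_n -> 'I_n -> V -> R) (A : R) :=
  forall x rho, `|x - x0| <= r -> 0 < rho -> exists b, exists2 Phi0 : 'I_n -> 'I_n -> R,
    ellip lam Lam b & forall k l z W, `|z - x0| <= r -> `|z - x| <= rho ->
      (forall i j, `|f2 i j z| <= W) ->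
      `|Phi k l z - Phi0 k l - contr b (fun i j => f2 i j z) k l| <= rho `^ alpha * (A + Kc * W).

Definition holder_ball (x0 : V) (f2 : 'I_n -> 'I_n -> V -> R) (s H : R) :=
  forall k l x y, `|x - x0| <= s -> `|y - x0| <= s ->
    `|f2 k l x - f2 k l y| <= H * `|x - y| `^ alpha.

(** Over a segment of length [d] the mean value theorem finds a point where f_ij is at most 2A/d,
    and the Hoelder bound carries this back to [x]. The free [d] trades the two terms against each
    other. *)
Lemma interpolation (x0 : V) f f1 f2 s s' H A (d : R) x : C2 f f1 f2 ->
  holder_ball x0 f2 s' H -> 0 <= H -> (forall i y, `|y - x0| <= s' -> `|f1 i y| <= A) -> 0 < d ->
  s + d <= s' -> `|x - x0| <= s ->
  forall i j, `|f2 i j x| <= 2 * A / d + H * d `^ alpha.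
Proof.
move=> C2f hol H0 f1A d0 sd xs i j; have [_ _ _ _ d2] := C2f.
have [u ud E] := @MVT_line R V (f1 i) (f2 i j) x (e j) d (fun u _ => d2 i j (x + u *: e j)).
rewrite (gtr0_norm d0) in ud.
have ball u' : `|u'| <= d -> `|x + u' *: e j - x0| <= s'.
  move=> ud'; rewrite addrAC; apply: le_trans (ler_normD _ _) _.
  by rewrite normrZ normr_delta mulr1; lra.
have h1 : `|f2 i j (x + u *: e j)| <= 2 * A / d.
  rewrite ler_pdivlMr// mulrC -[X in X * _](gtr0_norm d0) -normrM -E.
  apply: le_trans (ler_normB _ _) _.
  have bd : `|x + d *: e j - x0| <= s' by apply: ball; rewrite gtr0_norm.
  have xs' : `|x - x0| <= s' by lra.
  by have := f1A i _ bd; have := f1A i _ xs'; lra.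
have h2 : `|f2 i j x - f2 i j (x + u *: e j)| <= H * d `^ alpha.
  apply: le_trans (hol i j _ _ _ _) _; [lra|exact: ball|].
  rewrite opprD addrA subrr sub0r normrN normrZ normr_delta mulr1.
  by apply: ler_wpM2l => //; apply: ler_powR_base => //; exact: ltW.
have := ler_normD (f2 i j x - f2 i j (x + u *: e j)) (f2 i j (x + u *: e j)).
by rewrite subrK; lra.
Qed.

(** Let g = s' - s. For increments t small compared with g the difference estimate applies at scale
    t; larger ones are comparable to g, and a sup bound on the Hessian by interpolation suffices. *)
Lemma schauder_step : exists2 C : R, 0 <= C & forall x0 f f1 f2 Phi A s s' H,
  C2 f f1 f2 -> (forall k l, continuous (Phi k l)) -> 0 <= A -> WEc x0 r Phi ->
  almost_linear x0 f2 Phi A -> (forall i x, `|x - x0| <= r -> `|f1 i x| <= A) ->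
  0 < s -> s < s' -> s' <= r -> 0 <= H -> holder_ball x0 f2 s' H ->
  holder_ball x0 f2 s (H / 8 + C * A / (s' - s) ^+ 2).
Proof.
(* Each case leaves 2 delta H, and [holder_path] multiplies this by n; the result is at most H/8. *)
pose delta : R := 1 / 16 / (n%:R + 1).
have n10 : 0 < n%:R + 1 :> R by rewrite ltr_wpDl.
have delta0 : 0 < delta by rewrite !divr_gt0.
have [N [C1 [N0 C10 est]]] := @dif_estimate1 R n lam Lam alpha lam0 alpha0 alpha1 _ delta0.
pose Na : R := N `^ alpha; have Na0 : 0 <= Na by exact: powR_ge0.
pose Q : R := C1 * Na * Kc; have Q0 : 0 <= Q by rewrite /Q; nneg.
have ra0 : 0 < r `^ alpha by exact: powR_gt0.
(* The flux error contains the sup [W] of the Hessian, hence by interpolation a term H d^alpha; with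
   d = [sg1 * g] its total coefficient is at most [delta]. *)
have [|u1 [u10 u11 hu1]] := @small_powR R alpha (delta / ((Q + 1) * r `^ alpha)) alpha0.
  by rewrite divr_gt0// mulr_gt0// ltr_wpDl.
pose sg1 : R := u1 / 2; have sg10 : 0 < sg1 by rewrite divr_gt0.
have N2a : 0 < (2 * N) `^ alpha by apply: powR_gt0; rewrite mulr_gt0.
have [|u2 [u20 u21 hu2]] := @small_powR R alpha (delta / (2 * (2 * N) `^ alpha)) alpha0.
  by rewrite divr_gt0// mulr_gt0.
pose c1 : R := C1 * Na * r ^+ 2 + 2 * Q * r / sg1.
pose c2 : R := (2 * N) `^ alpha * 4 / u2 * (r * (r `^ alpha)^-1).
have c10 : 0 <= c1 by rewrite /c1; nneg.
have c20 : 0 <= c2 by rewrite /c2; nneg.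
exists (n%:R * (c1 + c2)); first by nneg.
move=> x0 f f1 f2 Phi A s s' H C2f cP A0 we al f1A s0 ss' s'r H0 hol.
set g := s' - s; have g0 : 0 < g by rewrite subr_gt0.
have gr : g <= r by rewrite /g; lra.
have f1A' i y : `|y - x0| <= s' -> `|f1 i y| <= A by move=> ys; apply: f1A; lra.
have gi : 0 <= g ^- 2 by rewrite invr_ge0 exprn_ge0// ltW.
have Ag : 0 <= A / g ^+ 2 by rewrite mulr_ge0.
have sga : sg1 `^ alpha <= u1 `^ alpha by apply: ler_powR_base; rewrite ?ltW// /sg1; lra.
have coord k l i t x : 0 < t -> `|x - x0| <= s -> `|x + t *: e i - x0| <= s ->
   `|f2 k l (x + t *: e i) - f2 k l x| <= (2 * delta * H + (c1 + c2) * (A / g ^+ 2)) * t `^ alpha.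
  move=> t0 xs ys; have ta0 : 0 <= t `^ alpha by exact: powR_ge0.
  (* In the first case the ball of radius [N * t] around [x] leaves a margin g/2 in the larger ball
     for interpolation. *)
  have [Ntg|Ntg] := leP (N * t) (g / 2).
    have Nt0 : 0 < N * t by rewrite mulr_gt0.
    pose d := sg1 * g; have d0 : 0 < d by rewrite mulr_gt0.
    have dg : d <= g / 2.
      have : sg1 * g <= 1 / 2 * g by apply: ler_wpM2r; [exact: ltW|rewrite /sg1; clear -u11 lam0 Lam alpha0 alpha1 Kc0 r0; lra].
      by rewrite /d; clear -u11 lam0 Lam alpha0 alpha1 Kc0 r0; lra.
    pose W : R := 2 * A / d + H * d `^ alpha.
    have W0 : 0 <= W by rewrite /W; nneg; rewrite ?powR_ge0.
    have f2W z : `|z - x| <= N * t -> forall i j, `|f2 i j z| <= W.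
      move=> zx; apply: (@interpolation x0 f f1 f2 (s + g / 2) s') => //.
        by rewrite /g in dg *; clear -dg lam0 Lam alpha0 alpha1 Kc0 r0; lra.
      by have := ler_normD (z - x) (x - x0); rewrite addrA subrK; clear -zx xs Ntg lam0 Lam alpha0 alpha1 Kc0 r0; lra.
    have xr : `|x - x0| <= r by clear -xs ss' s'r lam0 Lam alpha0 alpha1 Kc0 r0; lra.
    have [b [Phi0 eb hb]] := al x (N * t) xr Nt0.
    pose G k l z := contr b (fun i j => f2 i j z) k l - (Phi k l z - Phi0 k l).
    have cc k' l' : continuous (fun z => contr b (fun i j => f2 i j z) k' l').
      by apply: cont_contr; case: C2f.
    have cG k' l' : continuous (G k' l').
      by apply: contB => //; apply: contB => //; exact: contC.
    have g1 : 0 <= (N * t) `^ alpha * (A + Kc * W) by nneg; rewrite ?powR_ge0.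
    have bx z : `|z - x| <= N * t -> `|z - x0| <= s'.
      by move=> zx; have := ler_normD (z - x) (x - x0); rewrite addrA subrK /g in Ntg *; clear -Ntg xs zx ss' lam0 Lam alpha0 alpha1 Kc0 r0; lra.
    have := est b x t i f f1 f2 G H _ eb t0 C2f cG H0 g1 _ _ _ k l.
    rewrite -[iter 1 _ _ _]/(f2 k l (x + t *: e i) - f2 k l x) => est1.
    have {}est1 : `|f2 k l (x + t *: e i) - f2 k l x| <= delta * (H * t `^ alpha) + C1 * ((N * t) `^ alpha * (A + Kc * W)).
      apply: est1.
      - by move=> k' l' z z' /bx zs /bx zs'; exact: hol.
      - rewrite (_ : (fun _ _ => _) = (fun k l z => Phi k l z - Phi0 k l)); last first.
          by apply/funext => k'; apply/funext => l'; apply/funext => z; rewrite /G subKr.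
        apply: WEcB => //; [by move=> k' l'; exact: contC| |exact: WEc_cst].
        apply: WEc_le we => z zr.
        by have := ler_normD (z - x) (x - x0); rewrite addrA subrK /g in Ntg *; clear -Ntg xs zr ss' s'r lam0 Lam alpha0 alpha1 Kc0 r0; lra.
      - move=> k' l' z zx; rewrite /G distrC; apply: hb => //; last exact: f2W.
        by have := bx z zx; clear -s'r lam0 Lam alpha0 alpha1 Kc0 r0; lra.
    apply: le_trans est1 _.
    rewrite (powRM _ (ltW N0) (ltW t0)) -/Na.
    have Qd : Q * d `^ alpha <= delta.
      have dr : d `^ alpha <= u1 `^ alpha * r `^ alpha.
        rewrite /d powRM ?(ltW sg10) ?(ltW g0)//; apply: ler_pM; rewrite ?powR_ge0//.
        by apply: ler_powR_base => //; exact: ltW.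
      apply: (@le_trans _ _ ((Q + 1) * (u1 `^ alpha * r `^ alpha))).
        by apply: ler_pM; rewrite ?powR_ge0//; clear -Q0 lam0 Lam alpha0 alpha1 Kc0 r0; lra.
      rewrite mulrCA -ler_pdivlMr ?mulr_gt0//; clear -Q0 hu1 lam0 Lam alpha0 alpha1 Kc0 r0; lra.
    have E1 : delta * (H * t `^ alpha) + C1 * (Na * t `^ alpha * (A + Kc * W)) =
      (delta * H + C1 * Na * A + Q * (2 * A / d) + H * (Q * d `^ alpha)) * t `^ alpha.
      by rewrite /W /Q; ring.
    rewrite E1; apply: ler_wpM2r => //.
    have h1 : H * (Q * d `^ alpha) <= H * delta by exact: ler_wpM2l.
    have r2g : 1 <= r ^+ 2 / g ^+ 2.
      by rewrite ler_pdivlMr ?exprn_gt0// mul1r; apply: lerXn2r; rewrite ?nnegrE// ltW.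
    have h2 : C1 * Na * A <= C1 * Na * A * (r ^+ 2 / g ^+ 2) by apply: ler_peMr => //; nneg.
    have h3 : Q * (2 * A / d) <= 2 * Q * r / sg1 * (A / g ^+ 2).
      have -> : Q * (2 * A / d) = 2 * Q / sg1 * (A / g ^+ 2) * g.
        by rewrite /d; field; rewrite !gt_eqF.
      have -> : 2 * Q * r / sg1 * (A / g ^+ 2) = 2 * Q / sg1 * (A / g ^+ 2) * r by ring.
      by apply: ler_wpM2l => //; nneg.
    have h4 : 0 <= c2 * (A / g ^+ 2) by exact: mulr_ge0.
    have -> : (c1 + c2) * (A / g ^+ 2) = C1 * Na * A * (r ^+ 2 / g ^+ 2) +
      2 * Q * r / sg1 * (A / g ^+ 2) + c2 * (A / g ^+ 2) by rewrite /c1; ring.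
    clear -h1 h2 h3 h4 lam0 Lam alpha0 alpha1 Kc0 r0; lra.
  (* Now g is at most 2 N t, so [u2] can be chosen to make twice H d^alpha at most delta H
     t^alpha. *)
  pose d := u2 * g; have d0 : 0 < d by rewrite mulr_gt0.
  have dg : d <= g by rewrite /d ler_piMl// ltW.
  have sds : s + d <= s' by rewrite /g in dg; lra.
  have W1 := interpolation C2f hol H0 f1A' d0 sds xs k l.
  have W2 := interpolation C2f hol H0 f1A' d0 sds ys k l.
  have := ler_normB (f2 k l (x + t *: e i)) (f2 k l x).
  have tg : g `^ alpha <= (2 * N) `^ alpha * t `^ alpha.
    have N20 : 0 <= 2 * N by rewrite mulr_ge0// ltW.
    rewrite -(powRM _ N20 (ltW t0)); apply: ler_powR_base; [exact: ltW|exact: ltW|].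
    by rewrite ltr_pdivrMr// in Ntg; clear -Ntg lam0 Lam alpha0 alpha1 Kc0 r0; lra.
  have h1 : 2 * (H * d `^ alpha) <= delta * H * t `^ alpha.
    rewrite /d powRM ?(ltW u20) ?(ltW g0)//.
    have a1 : 2 * (u2 `^ alpha * ((2 * N) `^ alpha * t `^ alpha)) <= delta * t `^ alpha.
      have : u2 `^ alpha * (2 * (2 * N) `^ alpha) <= delta.
        by rewrite -ler_pdivlMr ?mulr_gt0.
      by move=> /(ler_wpM2r ta0); clear -u11 lam0 Lam alpha0 alpha1 Kc0 r0; lra.
    have a2 : u2 `^ alpha * g `^ alpha <= u2 `^ alpha * ((2 * N) `^ alpha * t `^ alpha).
      by apply: ler_wpM2l => //; exact: powR_ge0.
    have a3 := ler_wpM2l H0 a1; have a4 := ler_wpM2l H0 a2; clear -a3 a4 lam0 Lam alpha0 alpha1 Kc0 r0; lra.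
  have h2 : 2 * (2 * A / d) <= c2 * (A / g ^+ 2) * t `^ alpha.
    have -> : 2 * (2 * A / d) = 4 / u2 * (A / g ^+ 2) * g.
      by rewrite /d; field; rewrite !gt_eqF.
    have -> : c2 * (A / g ^+ 2) * t `^ alpha =
       4 / u2 * (A / g ^+ 2) * (r * ((2 * N) `^ alpha * t `^ alpha) / r `^ alpha).
      by rewrite /c2; ring.
    apply: ler_wpM2l; first by nneg.
    rewrite ler_pdivlMr//; apply: le_trans (powR_ratio g0 gr alpha1) _.
    by apply: ler_wpM2l => //; exact: ltW.
  have h4 : 0 <= c1 * (A / g ^+ 2) * t `^ alpha by rewrite !mulr_ge0.
  have h5 : 0 <= delta * H * t `^ alpha by rewrite !mulr_ge0// ltW.
  clear -W1 W2 h1 h2 h4 h5 lam0 Lam alpha0 alpha1 Kc0 r0; lra.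
move=> k l x y xs ys.
have B0 : 0 <= 2 * delta * H + (c1 + c2) * (A / g ^+ 2).
  by apply: addr_ge0; apply: mulr_ge0 => //; nneg.
apply: le_trans (holder_path B0 (ltW alpha0) (coord k l) xs ys) _.
apply: ler_wpM2r; first exact: powR_ge0.
have : n%:R * (2 * delta * H) <= H / 8.
  have nd : n%:R * delta <= 1 / 16.
    rewrite /delta mulrCA -[leRHS]mulr1; apply: ler_wpM2l; first by clear -u11 lam0 Lam alpha0 alpha1 Kc0 r0; lra.
    by rewrite ler_pdivrMr// mul1r lerDl.
  have := ler_wpM2r H0 nd; clear -u11 lam0 Lam alpha0 alpha1 Kc0 r0; lra.
clear -u11 lam0 Lam alpha0 alpha1 Kc0 r0; lra.
Qed.

End schauder.

Section schauder_interior.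
Context {R : realType} {n : nat}.
Local Notation V := 'rV[R]_n.
Local Notation e i := (delta_mx ord0 i : V).
Variables (lam Lam alpha Kc r : R).
Hypotheses (lam0 : 0 < lam) (alpha0 : 0 < alpha) (alpha1 : alpha < 1)
  (Kc0 : 0 <= Kc) (r0 : 0 < r).

(* The a priori constant H0 enters neither C nor the conclusion. *)
Lemma schauder : exists2 C : R, 0 <= C & forall x0 f f1 f2 Phi A H0,
  C2 f f1 f2 -> (forall k l, continuous (Phi k l)) -> 0 <= A -> WEc x0 r Phi ->
  almost_linear lam Lam alpha Kc r x0 f2 Phi A ->
  (forall i (x : V), `|x - x0| <= r -> `|f1 i x| <= A) ->
  0 <= H0 -> holder_ball alpha x0 f2 r H0 -> holder_ball alpha x0 f2 (r / 2) (C * A).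
Proof.
have [C C0 step] := @schauder_step R n lam Lam alpha Kc r lam0 alpha0 alpha1 Kc0 r0.
pose C3 : R := C * 16 / r ^+ 2.
have C30 : 0 <= C3 by rewrite /C3; nneg; exact: ltW.
exists (2 * C3); first by nneg.
move=> x0 f f1 f2 Phi A H0 C2f cP A0 we al f1A H00 hol0.
(* The gaps shrink like 2^-k, so the terms with squared gaps grow like 4^k; the contraction factor
   8^-k turns them into the geometric series of ratio 1/2. *)
pose s (k : nat) : R := r - r / 2 * 2^-1 ^+ k.
have h0 k : 0 < 2^-1 ^+ k :> R by rewrite exprn_gt0.
have h1 k : 2^-1 ^+ k <= 1 :> R by rewrite exprn_ile1// invf_le1// ler1n.
have r20 : 0 < r / 2 by rewrite divr_gt0.
have s0 k : 0 < s k by have := ler_wpM2l (ltW r20) (h1 k); rewrite /s; lra.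
have sr k : s k <= r by have := mulr_gt0 r20 (h0 k); rewrite /s; lra.
have gap k : s k.+1 - s k = r / 4 * 2^-1 ^+ k by rewrite /s exprS; field.
have ss k : s k < s k.+1.
  by rewrite -subr_gt0 gap mulr_gt0// divr_gt0.
have key k H : 0 <= H -> holder_ball alpha x0 f2 (s k) H ->
   holder_ball alpha x0 f2 (s 0%N) (8^-1 ^+ k * H + C3 * A * \sum_(j < k) 2^-1 ^+ j).
  elim: k H => [|k IH] H H0' hol.
    by rewrite big_ord0 mulr0 addr0 expr0 mul1r.
  have hs := step x0 f f1 f2 Phi A (s k) (s k.+1) H C2f cP A0 we al f1A (s0 k) (ss k) (sr _) H0' hol.
  have g0 : 0 < s k.+1 - s k by rewrite subr_gt0.
  have H1 : 0 <= H / 8 + C * A / (s k.+1 - s k) ^+ 2.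
    by nneg; exact: ltW.
  have := IH _ H1 hs; rewrite gap big_ord_recr /=; congr holder_ball.
  rewrite (_ : C * A / (r / 4 * 2^-1 ^+ k) ^+ 2 = C3 * A * 4 ^+ k); last first.
    have -> : 2^-1 ^+ k = (2 ^+ k)^-1 :> R by rewrite exprVn.
    have -> : 4 ^+ k = (2 ^+ k) ^+ 2 :> R by rewrite -exprM mulnC exprM; congr (_ ^+ _); ring.
    by rewrite /C3; field; rewrite gt_eqF//= gt_eqF// exprn_gt0.
  rewrite mulrDr exprS mulrDr; rewrite (_ : 8^-1 ^+ k * (H / 8) = 8^-1 * 8^-1 ^+ k * H); last by ring.
  rewrite -addrA; congr (_ + _); rewrite addrC; congr (_ + _).
  by rewrite mulrCA; congr (_ * _); rewrite -exprMn; congr (_ ^+ _); field.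
have sum2 m : \sum_(j < m) 2^-1 ^+ j <= 2 :> R.
  have -> : \sum_(j < m) 2^-1 ^+ j = 2 - 2 * 2^-1 ^+ m :> R.
    elim: m => [|m IH]; first by rewrite big_ord0 expr0; ring.
    by rewrite big_ord_recr /= IH exprS; field.
  by have := h0 m; lra.
have s00 : s 0%N = r / 2 by rewrite /s expr0; field.
move=> k l x y xs ys.
have P0 : 0 <= `|x - y| `^ alpha by exact: powR_ge0.
apply/ler_addgt0Pr => d d0.
(* After [m] steps the a priori constant survives only with the factor 8^-m; this [m] brings its
   contribution below [d]. *)
have [m hm] : exists m : nat, H0 * `|x - y| `^ alpha / d < m.+1%:R.
  by exists (Num.truncn (H0 * `|x - y| `^ alpha / d)); exact: truncnS_gt.
have holm : holder_ball alpha x0 f2 (s m) H0.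
  by move=> k' l' x' y' xs' ys'; apply: hol0; apply: le_trans (sr m).
have := key m H0 H00 holm k l x y; rewrite s00 => /(_ xs ys) h.
apply: le_trans h _.
have e8 : 8^-1 ^+ m * m.+1%:R <= 1 :> R.
  rewrite exprVn mulrC ler_pdivrMr ?exprn_gt0// mul1r -natrX ler_nat.
  exact: ltn_expl.
have a1 : C3 * A * (\sum_(j < m) 2^-1 ^+ j) <= C3 * A * 2 by apply: ler_wpM2l; nneg.
have a2 : 8^-1 ^+ m * (H0 * `|x - y| `^ alpha) <= d.
  rewrite ltr_pdivrMr// in hm.
  have e80 : 0 <= 8^-1 ^+ m :> R by rewrite exprn_ge0.
  have := ler_wpM2l e80 (ltW hm); have := ler_wpM2r (ltW d0) e8; lra.
have := ler_wpM2r P0 a1; lra.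
Qed.

End schauder_interior.

(** * Derivatives from uniformly Hoelder difference quotients *)

Section difference_quotients.
Context {R : realType} {n : nat}.
Local Notation V := 'rV[R]_n.
Local Notation e i := (delta_mx ord0 i : V).

Definition quot (g : V -> R) (i : 'I_n) (h : R) (x : V) : R := (g (x + h *: e i) - g x) / h.

Variables (g : V -> R) (i : 'I_n) (x0 : V) (r C h0 alpha : R).
Hypotheses (cg : continuous g) (r0 : 0 < r) (C0 : 0 <= C) (h00 : 0 < h0) (alpha0 : 0 < alpha)
  (holq : forall h x y, 0 < h -> h <= h0 -> `|x - x0| <= r -> `|y - x0| <= r ->
    `|quot g i h x - quot g i h y| <= C * `|x - y| `^ alpha).

Let h1 : R := minr h0 (r / 4).
Let h10 : 0 < h1. Proof. by rewrite lt_min h00 divr_gt0. Qed.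

Let in_ball x (h : R) : `|x - x0| <= r / 2 -> `|h| <= h1 -> `|x + h *: e i - x0| <= r.
Proof.
move=> xr hh; rewrite addrAC; apply: le_trans (ler_normD _ _) _.
rewrite normrZ normr_delta mulr1; have : h1 <= r / 4 by rewrite ge_min lexx orbT.
have := r0; lra.
Qed.

(** The quotient of step h is the mean of M quotients of step h/M based at points between x and x +
    h e_i, and [holq] compares each of these with the one based at x. *)
Let quot_div x (h : R) (P : nat) : `|x - x0| <= r / 2 -> 0 < h -> h <= h1 ->
  `|quot g i h x - quot g i (h / P.+1%:R) x| <= C * h `^ alpha.
Proof.
move=> xr hp hh; set M := P.+1; have M0 : 0 < M%:R :> R by rewrite ltr0Sn.
set s := h / M%:R; have s0 : 0 < s by rewrite divr_gt0.
have sM : h = s * M%:R by rewrite divfK// gt_eqF.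
have sh : s <= h.
  by rewrite [leRHS]sM; apply: ler_peMr; [exact: ltW|rewrite ler1n].
have hh0 : h1 <= h0 by rewrite ge_min lexx.
have E : quot g i h x - quot g i s x =
    M%:R^-1 * \sum_(p < M) (quot g i s (x + (s * p%:R) *: e i) - quot g i s x).
  rewrite sumrB sumr_const card_ord -(mulr_natl (quot g i s x) M) mulrBr mulKf ?gt_eqF//.
  congr (_ - _); rewrite -mulr_suml.
  have -> : \sum_(p < M) (g (x + (s * p%:R) *: e i + s *: e i) - g (x + (s * p%:R) *: e i)) =
      g (x + h *: e i) - g x.
    rewrite sM -[g x]/(g x); have -> : x + (s * M%:R) *: e i = x + (s *: e i) *+ M.
      by rewrite -scaler_nat scalerA mulrC.
    rewrite dif_telescope; apply: eq_bigr => p _; rewrite /dif.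
    by rewrite (_ : (s * p%:R) *: e i = s *: e i *+ p)// -scaler_nat scalerA mulrC.
  by rewrite /quot sM; field; rewrite !gt_eqF.
rewrite E normrM normfV (gtr0_norm M0) [leLHS]mulrC ler_pdivrMr//.
apply: le_trans (ler_norm_sum _ _ _) _.
apply: (@le_trans _ _ (\sum_(p < M) (C * h `^ alpha))); last first.
  by rewrite sumr_const card_ord -[leLHS]mulr_natr.
apply: ler_sum => p _.
have ph : 0 <= s * p%:R <= h.
  by rewrite mulr_ge0 ?(ltW s0)//= sM ler_pM2l// ler_nat ltnW.
case/andP: ph => ph1 ph2.
have hn : `|s * p%:R| <= h1 by rewrite ger0_norm//; exact: le_trans hh.
apply: le_trans (holq s0 _ _ _) _.
- exact: le_trans sh (le_trans hh hh0).
- exact: in_ball.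
- by have := r0; lra.
rewrite [x + _ - x]addrAC subrr add0r normrZ normr_delta mulr1 ger0_norm//.
by apply: ler_wpM2l => //; apply: ler_powR_base => //; exact: ltW.
Qed.

Let quot_cont x (k : R) : 0 < k -> {for k, continuous (fun h => quot g i h x)}.
Proof.
move=> k0; apply: cvgM; last by apply: cvgV; [rewrite gt_eqF|exact: cvg_id].
apply: cvgB; last exact: cvg_cst.
apply: (@continuous_comp _ _ _ (fun h : R => x + h *: e i) g); last exact: cg.
apply/cvg_at_distP => d d0; exists d => // y ky.
by rewrite opprD addrACA subrr add0r -scalerBl normrZ normr_delta mulr1.
Qed.

(** The ratio h/k need not be rational: k is approximated by a multiple Q s of a fine submultiple s
    of h. The steps h and Q s are compared through s by [quot_div], and continuity in the step
    replaces Q s by k. *)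
Let quot_cauchy x (h k : R) : `|x - x0| <= r / 2 -> 0 < k -> k <= h -> h <= h1 ->
  `|quot g i h x - quot g i k x| <= 2 * C * h `^ alpha.
Proof.
move=> xr k0 kh hh; have hp : 0 < h by lra.
apply/ler_addgt0Pr => d d0.
have /cvg_at_distP /(_ _ d0)[d' d'0 hd'] := @quot_cont x k k0.
have m0 : 0 < minr d' k by rewrite lt_min d'0.
pose P := Num.truncn (h / minr d' k).
have M0 : 0 < P.+1%:R :> R by rewrite ltr0Sn.
pose s : R := h / P.+1%:R; have s0 : 0 < s by rewrite divr_gt0.
have : s < minr d' k.
  by rewrite ltr_pdivrMr// mulrC -ltr_pdivrMr// truncnS_gt.
rewrite lt_min => /andP[sd sk].
have ks0 : 0 <= k / s by rewrite divr_ge0// ltW.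
have /andP[q1 q2] := truncn_itv ks0.
set Q := Num.truncn (k / s) in q1 q2.
have Q0 : (0 < Q)%N.
  rewrite lt0n; apply/negP => /eqP Q0; move: q2; rewrite Q0 ltr_pdivrMr// mul1r; lra.
have Qk : Q%:R * s <= k by rewrite -ler_pdivlMr.
have kQ : k < Q%:R * s + s by rewrite ltr_pdivrMr// -natr1 mulrDl mul1r in q2.
have Qs0 : 0 < Q%:R * s by rewrite mulr_gt0// ltr0n.
have A1 := quot_div P xr hp hh.
have Qh : Q%:R * s <= h1 by lra.
have := quot_div Q.-1 xr Qs0 Qh.
rewrite prednK// [Q%:R * s / _]mulrAC mulfV ?mul1r ?gt_eqF ?ltr0n// => A2.
have A3 : (Q%:R * s) `^ alpha <= h `^ alpha by apply: ler_powR_base; [exact: ltW|exact: ltW|lra].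
have A4 : `|quot g i k x - quot g i (Q%:R * s) x| < d.
  by apply: hd'; rewrite ger0_norm ?subr_ge0//; lra.
have A5 := ler_wpM2l C0 A3.
rewrite -/s in A1.
have := ler_normD (quot g i h x - quot g i s x) (quot g i s x - quot g i (Q%:R * s) x).
have := ler_normD (quot g i h x - quot g i (Q%:R * s) x) (quot g i (Q%:R * s) x - quot g i k x).
rewrite !addrA !subrK [`|quot g i (Q%:R * s) x - quot g i k x|]distrC.
rewrite [`|quot g i s x - quot g i (Q%:R * s) x|]distrC.
lra.
Qed.

Let quot_lim x : `|x - x0| <= r / 2 -> exists L, forall h, 0 < h -> h <= h1 ->
  `|quot g i h x - L| <= 2 * C * h `^ alpha.
Proof.
move=> xr.
have small (d : R) : 0 < d -> exists h, [/\ 0 < h, h <= h1 & 2 * C * h `^ alpha < d].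
  move=> d0; have [|s [s0 s1 hs]] := @small_powR R alpha (d / 2 / (2 * C + 1)) alpha0.
    by rewrite !divr_gt0// ltr_wpDl// mulr_ge0.
  exists (minr s h1); split; [by rewrite lt_min s0|by rewrite ge_min lexx orbT|].
  have c1 : 0 < 2 * C + 1 by rewrite ltr_wpDl// mulr_ge0.
  have h : minr s h1 `^ alpha <= s `^ alpha.
    apply: ler_powR_base; [exact: ltW|by rewrite le_min (ltW s0) ltW|by rewrite ge_min lexx].
  have : (2 * C + 1) * minr s h1 `^ alpha <= d / 2.
    by rewrite mulrC -ler_pdivlMr//; exact: le_trans hs.
  by have := powR_ge0 (minr s h1) alpha; lra.
have : cauchy ((fun h => quot g i h x) @ 0^'+).
  refine (@cauchy_exP R R _ _ _) => d d0; have [h [hp hh hd]] := small d d0.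
  exists (quot g i h x); rewrite /nbhs /=.
  near=> k; rewrite -ball_normE /=; apply: le_lt_trans hd; apply: quot_cauchy => //.
  by near: k; exact: nbhs_right_le.
move=> /cauchy_cvg /cvg_ex[L hL]; exists L => h hp hh.
apply/ler_addgt0Pr => d d0.
have := hL; move=> /cvgrPdist_lt /(_ _ d0) hnear.
have : \forall k \near (0 : R)^'+, `|quot g i h x - L| <= 2 * C * h `^ alpha + d.
  near=> k.
  have k1 : `|L - quot g i k x| < d by near: k.
  have kh : k <= h by near: k; exact: nbhs_right_le.
  have k0 : 0 < k by near: k; exact: nbhs_right_gt.
  have := quot_cauchy xr k0 kh hh.
  have := ler_normD (quot g i h x - quot g i k x) (quot g i k x - L).
  by rewrite addrA subrK [`|quot g i k x - L|]distrC; lra.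
by move=> /(@filter_ex _ _ _)[].
Unshelve. all: by end_near. Qed.

(** Quotients of positive step converge with the rate 2 C h^alpha, and the Hoelder bound passes to
    the limit with the same constant [C]. *)
Lemma derivable_of_quot : exists g1 : V -> R,
  (forall x, `|x - x0| <= r / 2 -> is_derive x (e i) g (g1 x)) /\
  (forall x y, `|x - x0| <= r / 2 -> `|y - x0| <= r / 2 ->
     `|g1 x - g1 y| <= C * `|x - y| `^ alpha).
Proof.
have ex x : exists L, `|x - x0| <= r / 2 -> forall h, 0 < h -> h <= h1 ->
    `|quot g i h x - L| <= 2 * C * h `^ alpha.
  by have [/quot_lim[L hL]|xr] := leP `|x - x0| (r / 2); [exists L|exists 0].
have [g1 hg1] := choice ex; exists g1.
have small (d : R) : 0 < d -> exists h, [/\ 0 < h, h <= h1 & 4 * C * h `^ alpha < d].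
  move=> d0; have [|s [s0 s1 hs]] := @small_powR R alpha (d / 2 / (4 * C + 1)) alpha0.
    by rewrite !divr_gt0// ltr_wpDl// mulr_ge0.
  exists (minr s h1); split; [by rewrite lt_min s0|by rewrite ge_min lexx orbT|].
  have c1 : 0 < 4 * C + 1 by rewrite ltr_wpDl// mulr_ge0.
  have h : minr s h1 `^ alpha <= s `^ alpha.
    apply: ler_powR_base; [exact: ltW|by rewrite le_min (ltW s0) ltW|by rewrite ge_min lexx].
  have : (4 * C + 1) * minr s h1 `^ alpha <= d / 2.
    by rewrite mulrC -ler_pdivlMr//; exact: le_trans hs.
  by have := powR_ge0 (minr s h1) alpha; lra.
have hh0 : h1 <= h0 by rewrite ge_min lexx.
have r2 : r / 2 <= r by have := r0; lra.
split.
  move=> x xr; apply/is_deriveP => d d0; have [h [hp hh hd]] := small d d0.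
  exists h => // k kn kh.
  have kp : 0 < `|k| by rewrite normr_gt0.
  have kh1 : `|k| <= h1 by lra.
  have A1 := hg1 x xr _ kp kh1.
  have A2 : `|k| `^ alpha <= h `^ alpha by apply: ler_powR_base => //; exact: ltW.
  have kh0 : `|k| <= h0 by exact: le_trans hh0.
  have A3 := ler_wpM2l C0 A2.
  have Ck : 0 <= C * `|k| `^ alpha by rewrite mulr_ge0// powR_ge0.
  have [k0|k0|k0] := ltgtP k 0.
  (* For a negative increment the quotient is one of positive step based at the shifted point, which
     [holq] compares with the one at [x]. *)
  - have E : (g (x + k *: e i) - g x) / k = quot g i `|k| (x + k *: e i).
      rewrite /quot (ltr0_norm k0) -addrA -scalerDl subrr scale0r addr0.
      by rewrite invrN mulrN -mulNr opprB.
    rewrite E.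
    have B : `|quot g i `|k| (x + k *: e i) - quot g i `|k| x| <= C * `|k| `^ alpha.
      apply: le_trans (holq kp _ _ _) _; [exact: kh0|exact: in_ball|exact: le_trans r2|].
      by rewrite [x + _ - x]addrAC subrr add0r normrZ normr_delta mulr1.
    have := ler_normD (quot g i `|k| (x + k *: e i) - quot g i `|k| x) (quot g i `|k| x - g1 x).
    by rewrite addrA subrK; lra.
  - rewrite -[X in `|X - _|]/(quot g i k x).
    by move: A1 A3 Ck; rewrite (gtr0_norm k0); lra.
  - by rewrite k0 eqxx in kn.
move=> x y xr yr; apply/ler_addgt0Pr => d d0; have [h [hp hh hd]] := small d d0.
have A1 := hg1 x xr h hp hh; have A2 := hg1 y yr h hp hh.
have A3 := holq hp (le_trans hh hh0) (le_trans xr r2) (le_trans yr r2).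
have := ler_normD (g1 x - quot g i h x) (quot g i h x - g1 y).
have := ler_normD (quot g i h x - quot g i h y) (quot g i h y - g1 y).
rewrite !addrA !subrK [`|g1 x - quot g i h x|]distrC.
lra.
Qed.

End difference_quotients.

(** * Local Hoelder classes and difference quotients *)

Section classes.
Context {R : realType} {V : normedModType R}.
Implicit Types f g : V -> R.

Lemma is_derive_near f g (x v : V) (d r : R) : 0 < r ->
  (forall y, `|y - x| < r -> f y = g y) -> is_derive x v f d -> is_derive x v g d.
Proof.
move=> r0 fg /is_deriveP h; apply/is_deriveP => c /h[s s0 hs].
have v0 : 0 < `|v| + 1 by rewrite ltr_wpDl.
exists (minr s (r / (`|v| + 1))); first by rewrite lt_min s0 divr_gt0.
move=> k k0; rewrite lt_min => /andP[ks kr].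
rewrite -!fg ?subrr ?normr0//; first exact: hs.
rewrite addrAC subrr add0r normrZ; apply: le_lt_trans (_ : `|k| * (`|v| + 1) < r).
  by apply: ler_wpM2l => //; rewrite lerDl.
by rewrite -ltr_pdivlMr.
Qed.

Lemma cont_near f g (x : V) (r : R) : 0 < r ->
  (forall y, `|y - x| < r -> f y = g y) -> {for x, continuous f} -> {for x, continuous g}.
Proof.
move=> r0 fg /cvg_at_distP h; apply/cvg_at_distP => c /h[s s0 hs].
exists (minr s r); first by rewrite lt_min s0.
move=> y; rewrite lt_min => /andP[ys yr]; rewrite -!fg ?subrr ?normr0//; first exact: hs.
by rewrite distrC.
Qed.

Lemma is_derive_unique f (x v : V) (a b : R) : is_derive x v f a -> is_derive x v f b -> a = b.
Proof.
by move=> ha hb; rewrite -(@derive_val _ _ _ _ _ _ _ ha) (@derive_val _ _ _ _ _ _ _ hb).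
Qed.

Variables (Q : (V -> R) -> Prop) (dirs D : set V).

(* Used with [Q] local Hoelder continuity and [D] open, and with [Q] continuity
   within the relatively open set [D] of symmetric matrices. *)
Fixpoint Cls (k : nat) f : Prop :=
  Q f /\ if k is k'.+1 then
    forall v, dirs v -> exists2 f1, (forall x, D x -> is_derive x v f (f1 x)) & Cls k' f1
  else True.

Lemma Cls_base k f : Cls k f -> Q f. Proof. by case: k => [|k] []. Qed.

Lemma ClsS k f : Cls k.+1 f -> Cls k f.
Proof.
elim: k f => [|k IH] f [cf h]; split=> // v dv.
by have [f1 d1 D1] := h v dv; exists f1 => //; exact: IH.
Qed.

Lemma Cls_cst k (c : R) : (forall c, Q (fun=> c)) -> Cls k (fun=> c).
Proof.
move=> Qc; elim: k c => [|k IH] c; split=> // v _.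
by exists (fun=> 0) => // x _; exact: is_derive_cst.
Qed.

Lemma ClsD k f g : (forall f g, Q f -> Q g -> Q (fun x => f x + g x)) ->
  Cls k f -> Cls k g -> Cls k (fun x => f x + g x).
Proof.
move=> QD; elim: k f g => [|k IH] f g [cf hf] [cg hg]; split=> //; try exact: QD.
move=> v dv; have [f1 df Df] := hf v dv; have [g1 dg Dg] := hg v dv.
exists (fun x => f1 x + g1 x); last exact: IH.
by move=> x Dx; apply: is_deriveD; [exact: df|exact: dg].
Qed.

Lemma ClsM k f g : (forall f g, Q f -> Q g -> Q (fun x => f x + g x)) ->
  (forall f g, Q f -> Q g -> Q (fun x => f x * g x)) ->
  Cls k f -> Cls k g -> Cls k (fun x => f x * g x).
Proof.
move=> QD QM; elim: k f g => [|k IH] f g Hf Hg.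
  by split=> //; apply: QM; [case: Hf|case: Hg].
split; first by apply: QM; [case: Hf|case: Hg].
move=> v dv; have [f1 df Df] := Hf.2 v dv; have [g1 dg Dg] := Hg.2 v dv.
exists (fun x => f x * g1 x + f1 x * g x).
  by move=> x Dx; apply: is_deriveM1; [exact: df|exact: dg].
by apply: ClsD => //; apply: IH => //; exact: ClsS.
Qed.

Lemma Cls_sum k (J : Type) (s : seq J) (F : J -> V -> R) : (forall c, Q (fun=> c)) ->
  (forall f g, Q f -> Q g -> Q (fun x => f x + g x)) ->
  (forall j, Cls k (F j)) -> Cls k (fun x => \sum_(j <- s) F j x).
Proof.
move=> Qc QD CF; elim: s => [|j s IH].
  by under eq_fun do rewrite big_nil; exact: Cls_cst.
by under eq_fun do rewrite big_cons; exact: ClsD.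
Qed.

Definition con f := forall x, D x -> {for x, continuous f}.

End classes.

Section gluing.
Context {R : realType} {V : normedModType R}.
Variables (O K : set V) (f psi : V -> R).
Hypotheses (cK : closed K) (KO : K `<=` O) (psi0 : forall x, ~ K x -> psi x = 0).

Lemma off_closed x : ~ K x -> exists2 r : R, 0 < r & forall y, `|y - x| < r -> ~ K y.
Proof.
move=> Kx; have : nbhs x (~` K) by apply: open_nbhs_nbhs; split => //; exact: closed_openC.
move=> /nbhs_ballP[r /= r0 hr]; exists r => // y yr; apply: hr.
by rewrite -ball_normE /= distrC.
Qed.

(** Nothing is known of [f] off [O]; there the product vanishes in a neighbourhood, because [K] is
    closed. *)
Lemma glue_cont : con O f -> continuous psi -> continuous (fun x => f x * psi x).
Proof.
move=> cf cp x; have [Kx|Kx] := pselect (K x).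
  by apply: cvgM; [exact/cf/KO|exact: cp].
have [r r0 hr] := off_closed Kx; apply: (@cont_near _ _ (fun=> 0) _ x r r0).
  by move=> y yr; rewrite psi0 ?mulr0//; exact: hr.
exact: cvg_cst.
Qed.

Lemma glue_derive f1 psi1 v : (forall x, O x -> is_derive x v f (f1 x)) ->
  (forall x, is_derive x v psi (psi1 x)) -> (forall x, ~ K x -> psi1 x = 0) ->
  forall x, is_derive x v (fun x => f x * psi x) (f x * psi1 x + f1 x * psi x).
Proof.
move=> fd pd p10 x; have [Kx|Kx] := pselect (K x); first by apply: is_deriveM1 => //; exact/fd/KO.
rewrite (psi0 Kx) (p10 _ Kx) !mulr0 addr0.
have [r r0 hr] := off_closed Kx; apply: (@is_derive_near _ _ (fun=> 0) _ x _ _ r r0).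
by move=> y yr; rewrite psi0 ?mulr0//; exact: hr.
Qed.

End gluing.

Section local_holder.
Context {R : realType} {n : nat}.
Local Notation V := 'rV[R]_n.
Local Notation e i := (delta_mx ord0 i : V).
Variables (alpha : R) (O : set V).
Hypotheses (alpha0 : 0 < alpha) (oO : open O).
Implicit Types f g : V -> R.

(** Hoelder continuity in a neighbourhood of each point, for the max norm: this form passes to sums
    and products with no appeal to compactness. *)
Definition lh f := forall x0, O x0 -> exists r C : R, [/\ 0 < r, 0 <= C &
  forall x y, `|x - x0| <= r -> `|y - x0| <= r -> `|f x - f y| <= C * `|x - y| `^ alpha].

Lemma open_ballV x0 : O x0 -> exists2 r : R, 0 < r & forall x, `|x - x0| <= r -> O x.
Proof.
move=> Ox; have /nbhs_ballP[r /= r0 hr] : nbhs x0 O by exact: open_nbhs_nbhs.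
exists (r / 2); first by rewrite divr_gt0.
by move=> x xr; apply: hr; rewrite -ball_normE /= distrC; lra.
Qed.

Lemma lh_con f : lh f -> con O f.
Proof.
move=> hf x Ox; have [r [C [r0 C0 h]]] := hf x Ox.
apply/cvg_at_distP => d d0.
have c1 : 0 < C + 1 by rewrite ltr_wpDl.
have [|s [s0 s1 hs]] := @small_powR R alpha (d / 2 / (C + 1)) alpha0.
  by rewrite !divr_gt0.
exists (minr r s); first by rewrite lt_min r0.
move=> y; rewrite lt_min => /andP[yr ys].
apply: le_lt_trans (h x y _ _) _; [by rewrite subrr normr0 ltW|by rewrite distrC ltW|].
have h1 : `|x - y| `^ alpha <= s `^ alpha by apply: ler_powR_base => //; exact: ltW.
have := ler_wpM2l (ltW c1) (le_trans h1 hs); rewrite [(C + 1) * (_ / _)]mulrC divfK ?gt_eqF//.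
by have := powR_ge0 `|x - y| alpha; lra.
Qed.

Lemma lh_bounded f x0 : lh f -> O x0 -> exists r C : R, [/\ 0 < r, 0 <= C &
  forall x, `|x - x0| <= r -> `|f x| <= C].
Proof.
move=> hf /hf[r [C [r0 C0 h]]]; exists r, (`|f x0| + C * r `^ alpha); split=> //.
  by rewrite addr_ge0// mulr_ge0// powR_ge0.
move=> x xr; have := h x x0 xr _; rewrite subrr normr0 (ltW r0) => /(_ isT) h1.
have h2 : C * `|x - x0| `^ alpha <= C * r `^ alpha.
  by apply: ler_wpM2l => //; apply: ler_powR_base => //; exact: ltW.
by have := ler_normD (f x - f x0) (f x0); rewrite subrK; lra.
Qed.

Lemma lh_cst (c : R) : lh (fun=> c).
Proof.
move=> x0 _; exists 1, 0; split=> // x y _ _.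
by rewrite subrr normr0 mul0r.
Qed.

Lemma lhD f g : lh f -> lh g -> lh (fun x => f x + g x).
Proof.
move=> hf hg x0 Ox; have [r [C [r0 C0 h]]] := hf x0 Ox; have [s [B [s0 B0 k]]] := hg x0 Ox.
exists (minr r s), (C + B); split; [by rewrite lt_min r0|exact: addr_ge0|].
move=> x y; rewrite !le_min => /andP[xr xs] /andP[yr ys].
rewrite mulrDl; apply: le_trans (lerD (h x y xr yr) (k x y xs ys)).
by rewrite opprD addrACA; exact: ler_normD.
Qed.

Lemma lhM f g : lh f -> lh g -> lh (fun x => f x * g x).
Proof.
move=> hf hg x0 Ox; have [r [C [r0 C0 h]]] := hf x0 Ox; have [s [B [s0 B0 k]]] := hg x0 Ox.
have [r' [F [r'0 F0 bf]]] := lh_bounded hf Ox; have [s' [G [s'0 G0 bg]]] := lh_bounded hg Ox.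
exists (minr (minr r s) (minr r' s')), (F * B + C * G); split.
- by rewrite !lt_min r0 s0 r'0.
- by nneg.
move=> x y; rewrite !le_min => /andP[/andP[xr xs] /andP[xr' xs']] /andP[/andP[yr ys] /andP[yr' ys']].
have -> : f x * g x - f y * g y = f x * (g x - g y) + (f x - f y) * g y by ring.
apply: le_trans (ler_normD _ _) _; rewrite !normrM [leRHS]mulrDl.
apply: lerD; first by rewrite -mulrA; apply: ler_pM => //; [exact: bf|exact: k].
by rewrite mulrAC; apply: ler_pM => //; [exact: h|exact: bg].
Qed.

Definition cka := Cls lh (@coord_dirs R n) O.

Lemma cka_cst k (c : R) : cka k (fun=> c).
Proof. exact: Cls_cst lh_cst. Qed.

Lemma ckaD k f g : cka k f -> cka k g -> cka k (fun x => f x + g x).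
Proof. exact: ClsD lhD. Qed.

Lemma ckaM k f g : cka k f -> cka k g -> cka k (fun x => f x * g x).
Proof. exact: ClsM lhD lhM. Qed.

Lemma cka_sum k (J : Type) (s : seq J) (F : J -> V -> R) :
  (forall j, cka k (F j)) -> cka k (fun x => \sum_(j <- s) F j x).
Proof. exact: Cls_sum lh_cst lhD. Qed.

Lemma cka_derive k f i : cka k.+1 f ->
  exists2 f1, (forall x, O x -> is_derive x (e i) f (f1 x)) & cka k f1.
Proof. by case=> _; apply; exists i. Qed.

Lemma ckaN k f : cka k f -> cka k (fun x => - f x).
Proof.
move=> /(ckaM (cka_cst k (-1))); congr (cka k _).
by apply/funext => x; rewrite mulN1r.
Qed.

Lemma ckaB k f g : cka k f -> cka k g -> cka k (fun x => f x - g x).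
Proof. by move=> hf hg; apply: ckaD => //; exact: ckaN. Qed.

Definition C2on (f : V -> R) (f1 : 'I_n -> V -> R) (f2 : 'I_n -> 'I_n -> V -> R) :=
  [/\ con O f, forall i, con O (f1 i), forall i j, con O (f2 i j),
      forall i x, O x -> is_derive x (e i) f (f1 i x) &
      forall i j x, O x -> is_derive x (e j) (f1 i) (f2 i j x)].

Lemma mixed_derivative_on f fi fj fij i j : (forall x, O x -> is_derive x (e i) f (fi x)) ->
  (forall x, O x -> is_derive x (e j) f (fj x)) ->
  (forall x, O x -> is_derive x (e j) fi (fij x)) -> con O fij ->
  forall x, O x -> is_derive x (e i) fj (fij x).
Proof.
move=> di dj dij cij x Ox; have [r r0 hr] := open_ballV Ox.
by apply: (mixed_derivative (r := r) r0 (f := f) (fi := fi) (vj := e j)); [move=> y /ltW /hr; auto..|exact: cij].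
Qed.

Lemma C2on_sym f (f1 : 'I_n -> V -> R) (f2 : 'I_n -> 'I_n -> V -> R) : C2on f f1 f2 -> forall i j x, O x -> f2 i j x = f2 j i x.
Proof.
move=> [cf c1 c2 d1 d2] i j x Ox.
have h := mixed_derivative_on (d1 i) (d1 j) (d2 i j) (c2 i j) Ox.
exact: is_derive_unique h (d2 j i x Ox).
Qed.

Lemma is_derive_on f g (x v : V) d : (forall y, O y -> f y = g y) -> O x ->
  is_derive x v f d -> is_derive x v g d.
Proof.
move=> fg Ox; have [r r0 hr] := open_ballV Ox.
by apply: is_derive_near r0 _ => y /ltW /hr /fg.
Qed.

Lemma closed_ballV (x0 : V) (r : R) : closed [set x : V | `|x - x0| <= r].
Proof.
apply: compact_closed; [exact: norm_hausdorff|exact: closed_ball_compactrV].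
Qed.

(** The Schauder estimate concerns functions on the whole space; multiplication by a cutoff supplies
    one with the same derivatives near [x0]. *)
Lemma C2_localize f (f1 : 'I_n -> V -> R) (f2 : 'I_n -> 'I_n -> V -> R) x0 (r : R) : 0 < r -> (forall x, `|x - x0| <= 2 * r -> O x) ->
  C2on f f1 f2 -> exists (g : V -> R) (g1 : 'I_n -> V -> R) (g2 : 'I_n -> 'I_n -> V -> R), C2 g g1 g2 /\ forall x, `|x - x0| < r ->
  (forall i, g1 i x = f1 i x) /\ (forall i j, g2 i j x = f2 i j x).
Proof.
move=> r0 hO [cf c1 c2 d1 d2].
have [k0 k1 k2 b1 b2] := @C2_cut R n x0 r.
pose K := [set x : V | `|x - x0| <= 2 * r].
have cK : closed K by exact: closed_ballV.
have KO : K `<=` O by exact: hO.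
have KP x : ~ K x -> 2 * r <= `|x - x0| by rewrite /K /= => /negP; rewrite -ltNge => /ltW.
have z0 x : ~ K x -> cutoff x0 r x = 0 by move=> /KP; exact: cut_eq0.
have z1 i x : ~ K x -> cut1 x0 r i x = 0 by move=> /KP; exact: cut1_eq0.
have z2 i j x : ~ K x -> cut2 x0 r i j x = 0 by move=> /KP; exact: cut2_eq0.
pose g x := f x * cutoff x0 r x.
pose g1 i x := f x * cut1 x0 r i x + f1 i x * cutoff x0 r x.
pose g2 i j x := (f x * cut2 x0 r i j x + f1 j x * cut1 x0 r i x) +
  (f1 i x * cut1 x0 r j x + f2 i j x * cutoff x0 r x).
have C2g : C2 g g1 g2.
  split.
  - exact: glue_cont KO z0 cf k0.
  - by move=> i; apply: contD; [exact: glue_cont KO (z1 i) cf (k1 i)|exact: glue_cont KO z0 (c1 i) k0].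
  - move=> i j; apply: contD; apply: contD.
    + exact: glue_cont KO (z2 i j) cf (k2 i j).
    + exact: glue_cont KO (z1 i) (c1 j) (k1 i).
    + exact: glue_cont KO (z1 j) (c1 i) (k1 j).
    + exact: glue_cont KO z0 (c2 i j) k0.
  - by move=> i x; exact: glue_derive KO z0 _ _ _ (d1 i) (b1 i) (z1 i) x.
  - move=> i j x; apply: is_deriveD.
      exact: glue_derive KO (z1 i) _ _ _ (d1 j) (b2 i j) (z2 i j) x.
    exact: glue_derive KO z0 _ _ _ (d2 i j) (b1 j) (z1 j) x.
exists g, g1, g2; split=> // x xr.
have gf y : `|y - x0| < r -> g y = f y by move=> /ltW h; rewrite /g cut_eq1// mulr1.
have near y : `|y - x0| < r -> 0 < r - `|y - x0| /\
    forall z, `|z - y| < r - `|y - x0| -> `|z - x0| < r.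
  move=> yr; split=> [|z zr]; first by rewrite subr_gt0.
  by have := ler_normD (z - y) (y - x0); rewrite addrA subrK; lra.
have Oy y : `|y - x0| < r -> O y by move=> yr; apply: hO; lra.
have [_ _ _ h1 h2] := C2g.
have g1f i y : `|y - x0| < r -> g1 i y = f1 i y.
  move=> yr; have [s0 hs] := near y yr.
  apply: is_derive_unique (h1 i y) _; apply: is_derive_near s0 _ (d1 i y (Oy y yr)) => z /hs.
  by move=> /gf ->.
split=> i; first exact: g1f.
move=> j; have [s0 hs] := near x xr.
apply: is_derive_unique (h2 i j x) _; apply: is_derive_near s0 _ (d2 i j x (Oy x xr)) => z /hs.
by move=> /g1f ->.
Qed.

End local_holder.

(** * Existence of third derivatives *)

Section third_derivatives.
Context {R : realType} {n : nat}.
Local Notation V := 'rV[R]_n.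
Local Notation e i := (delta_mx ord0 i : V).
Variables (alpha : R) (O : set V).
Hypotheses (alpha0 : 0 < alpha) (alpha1 : alpha < 1) (oO : open O).

Lemma almost_linear_ext lam Lam Kc (r r' : R) x0 (f2 f2' Phi Phi' : 'I_n -> 'I_n -> V -> R) A A' :
  0 <= Kc -> r' <= r -> A <= A' ->
  (forall i j x, `|x - x0| <= r' -> f2' i j x = f2 i j x) ->
  (forall i j x, `|x - x0| <= r' -> Phi' i j x = Phi i j x) ->
  almost_linear lam Lam alpha Kc r x0 f2 Phi A -> almost_linear lam Lam alpha Kc r' x0 f2' Phi' A'.
Proof.
move=> Kc0 rr AA ef ePhi al x rho xr rho0.
have [b [Phi0 eb hb]] := al x rho (le_trans xr rr) rho0.
exists b, Phi0 => // k l z W zr zx hW; rewrite ePhi//.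
have -> : (fun i j => f2' i j z) = (fun i j => f2 i j z).
  by apply/funext => i; apply/funext => j; exact: ef.
apply: le_trans (hb k l z W (le_trans zr rr) zx _) _; first by move=> i j; rewrite -ef.
by apply: ler_wpM2l; [exact: powR_ge0|lra].
Qed.

Lemma third_derivative_local v v1 v2 (Phi : 'I_n -> 'I_n -> V -> R) (m : 'I_n) x0
    (lam Lam Kc r0 h0 A0 : R) :
  C2on O v v1 v2 -> (forall i j, lh alpha O (v2 i j)) ->
  (forall k l, con O (Phi k l)) -> WE O Phi -> O x0 ->
  0 < lam -> 0 <= Kc -> 0 < r0 -> 0 < h0 -> 0 <= A0 ->
  (forall h, 0 < h -> h <= h0 -> almost_linear lam Lam alpha Kc r0 x0
     (fun i j => quot (v2 i j) m h) (fun k l => quot (Phi k l) m h) A0) ->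
  exists r C : R, [/\ 0 < r, 0 <= C & forall k l, exists g1 : V -> R,
    (forall x, `|x - x0| <= r -> is_derive x (e m) (v2 k l) (g1 x)) /\
    (forall x y, `|x - x0| <= r -> `|y - x0| <= r ->
       `|g1 x - g1 y| <= C * `|x - y| `^ alpha)].
Proof.
move=> C2v hv2 cPhi we Ox0 lam0 Kc0 r00 h00 A00 al.
have [R0 R00 hO] := open_ballV oO Ox0.
have [R1 R10 [H H0 hol]] : exists2 R1 : R, 0 < R1 & exists2 H : R, 0 <= H &
    forall k l x y, `|x - x0| <= R1 -> `|y - x0| <= R1 -> `|v2 k l x - v2 k l y| <= H * `|x - y| `^ alpha.
  have h (kl : 'I_n * 'I_n) := hv2 kl.1 kl.2 x0 Ox0.
  have [||R1 R10 h1] := @finite_lower R _ (fun (kl : 'I_n * 'I_n) R1 => exists2 C : R, 0 <= C &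
    forall x y, `|x - x0| <= R1 -> `|y - x0| <= R1 ->
      `|v2 kl.1 kl.2 x - v2 kl.1 kl.2 y| <= C * `|x - y| `^ alpha).
  - move=> kl r r' r'0 rr [C C0 hC]; exists C => // x y xr yr.
    by apply: hC; [exact: le_trans xr rr|exact: le_trans yr rr].
  - by move=> kl; have [r [C [rp C0 hC]]] := h kl; exists r => //; exists C.
  have [||H H0 h2] := @finite_upper R _ (fun (kl : 'I_n * 'I_n) C =>
      forall x y, `|x - x0| <= R1 -> `|y - x0| <= R1 ->
      `|v2 kl.1 kl.2 x - v2 kl.1 kl.2 y| <= C * `|x - y| `^ alpha).
  - move=> kl C C' CC hC x y xr yr; apply: le_trans (hC x y xr yr) _.
    by apply: ler_wpM2r => //; exact: powR_ge0.
  - by move=> kl; have [C _ hC] := h1 kl; exists C.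
  by exists R1 => //; exists H => // k l; exact: (h2 (k, l)).
(* Localisation uses a cutoff of radius 4r, which lives on the ball of radius 8r. The Hoelder bound
   is needed at points of the ball of radius r translated by at most r. *)
pose r : R := minr (minr (R0 / 8) (R1 / 3)) r0.
have rp : 0 < r by rewrite !lt_min !divr_gt0.
have rR0 : 8 * r <= R0.
  have : r <= R0 / 8 by rewrite /r !ge_min lexx.
  lra.
have rR1 : 3 * r <= R1.
  have : r <= R1 / 3 by rewrite /r !ge_min lexx !orbT.
  lra.
have rr0 : r <= r0 by rewrite /r ge_min lexx !orbT.
have r40 : 0 < 4 * r by rewrite mulr_gt0.
have hO8 x : `|x - x0| <= 2 * (4 * r) -> O x by move=> h; apply: hO; lra.
have [w [w1 [w2 [C2w ew]]]] := C2_localize r40 hO8 C2v.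
have [cw cw1 cw2 dw1 dw2] := C2w.
pose Phi' k l x := Phi k l x * cutoff x0 (4 * r) x.
have cPhi' k l : continuous (Phi' k l).
  apply: (@glue_cont _ _ O [set x : V | `|x - x0| <= 2 * (4 * r)]) => //.
  - exact: closed_ballV.
  - by move=> x /negP; rewrite -ltNge => /ltW; exact: cut_eq0.
  - by case: (@C2_cut R n x0 (4 * r)).
have ePhi k l x : `|x - x0| <= 4 * r -> Phi' k l x = Phi k l x.
  by move=> xr; rewrite /Phi' cut_eq1// mulr1.
have r34 : 3 * r < 4 * r by lra.
have r30 : 0 < 3 * r by lra.
have we' : WEc x0 (3 * r) Phi'.
  by apply: (@WE_local R n O Phi Phi' x0 (3 * r) (4 * r)) => // x h; apply: hO8; lra.
have [C C0 sch] := @schauder R n lam Lam alpha Kc r lam0 alpha0 alpha1 Kc0 rp.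
have [B [B0 hB]] : exists B : R, 0 <= B /\ forall i j x, `|x - x0| <= 2 * r -> `|w2 i j x| <= B.
  have [B B0 hB] := @finite_upper R ('I_n * 'I_n)%type (fun ij B => forall x, `|x - x0| <= 2 * r ->
    `|w2 ij.1 ij.2 x| <= B) (fun ij B B' BB h x xr => le_trans (h x xr) BB)
    (fun ij => let: ex_intro2 M _ h := bounded_on_ball x0 (2 * r) (cw2 ij.1 ij.2) in ex_intro _ M h).
  by exists B; split=> // i j; exact: (hB (i, j)).
pose A := maxr A0 B.
have A0' : 0 <= A by rewrite le_max A00.
have in2 (x : V) (s : R) : `|x - x0| <= r -> `|s| <= r -> `|x + s *: e m - x0| <= 2 * r.
  move=> xr sr; rewrite addrAC; apply: le_trans (ler_normD _ _) _.
  by rewrite normrZ normr_delta mulr1; lra.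
have hol2 h x y k l : 0 < h -> h <= minr h0 r -> `|x - x0| <= r / 2 -> `|y - x0| <= r / 2 ->
    `|quot (w2 k l) m h x - quot (w2 k l) m h y| <= C * A * `|x - y| `^ alpha.
  move=> hp; rewrite le_min => /andP[hh0 hr] xr yr.
  have nh : `|h *: e m| = h by rewrite normrZ normr_delta mulr1 gtr0_norm.
  have qE (g : V -> R) z : quot g m h z = h^-1 * dif (h *: e m) g z by rewrite /quot mulrC.
  have C2W := C2Z h^-1 (C2_dif (h *: e m) C2w).
  have cP k' l' : continuous (fun x => h^-1 * dif (h *: e m) (Phi' k' l') x).
    by apply: contM; [exact: contC|apply: contB => //; exact: continuous_shiftr].
  have weh : WEc x0 r (fun k l x => h^-1 * dif (h *: e m) (Phi' k l) x).
    apply: WEcZ => [k' l'|]; first by apply: contB => //; exact: continuous_shiftr.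
    apply: WEc_le (WEc_dif cPhi' we'); rewrite nh => z; lra.
  have alh := al h hp hh0.
  have qw2 i j z : `|z - x0| <= r -> h^-1 * dif (h *: e m) (w2 i j) z = quot (v2 i j) m h z.
    move=> zr; rewrite qE /dif; have hzr : `|z + h *: e m - x0| <= 2 * r.
      by apply: in2 => //; rewrite gtr0_norm.
    by rewrite (ew z _).2 ?(ew (z + _) _).2//; clear -zr hzr rp; lra.
  have qPhi i j z : `|z - x0| <= r -> h^-1 * dif (h *: e m) (Phi' i j) z = quot (Phi i j) m h z.
    move=> zr; rewrite qE /dif; have hzr : `|z + h *: e m - x0| <= 2 * r.
      by apply: in2 => //; rewrite gtr0_norm.
    by rewrite !ePhi//; clear -zr hzr rp; lra.
  have AA : A0 <= A by rewrite le_max lexx.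
  have al' := almost_linear_ext Kc0 rr0 AA qw2 qPhi alh.
  (* First derivatives of the difference quotient are quotients of first derivatives, hence bounded
     by second derivatives uniformly in [h]. *)
  have bd i (z : V) : `|z - x0| <= r -> `|h^-1 * dif (h *: e m) (w1 i) z| <= A.
    move=> zr; rewrite /dif.
    have [s sh ->] := @MVT_line R V (w1 i) (w2 i m) z (e m) h (fun s _ => dw2 i m _).
    rewrite mulKf ?gt_eqF//; apply: le_trans (hB i m _ _) _; last by rewrite le_max lexx orbT.
    by apply: in2 => //; rewrite (gtr0_norm hp) in sh; exact: le_trans hr.
  (* This a priori constant blows up as [h] tends to 0, but only its finiteness is needed in
     [schauder]. *)
  have H0h : 0 <= 2 * H / h by rewrite divr_ge0 ?mulr_ge0// ltW.
  have holh : holder_ball alpha x0 (fun i j x => h^-1 * dif (h *: e m) (w2 i j) x) r (2 * H / h).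
    move=> i j z z' zr z'r; rewrite qw2// qw2// /quot -mulrBl normrM normfV (gtr0_norm hp).
    rewrite [leRHS]mulrAC; apply: ler_wpM2r; first by rewrite invr_ge0 ltW.
    have i2 (y' : V) : `|y' - x0| <= r -> `|y' + h *: e m - x0| <= R1.
      by move=> y'r; have := @in2 y' h y'r; rewrite gtr0_norm// => /(_ hr); clear -rR1 rp; lra.
    have i1 (y' : V) : `|y' - x0| <= r -> `|y' - x0| <= R1 by clear -rR1 rp; lra.
    have a1 := hol i j _ _ (i2 z zr) (i2 z' z'r); have a2 := hol i j _ _ (i1 z zr) (i1 z' z'r).
    have E : z + h *: e m - (z' + h *: e m) = z - z' by rewrite opprD addrACA subrr addr0.
    rewrite E in a1.
    have -> : v2 i j (z + h *: e m) - v2 i j z - (v2 i j (z' + h *: e m) - v2 i j z') =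
      (v2 i j (z + h *: e m) - v2 i j (z' + h *: e m)) - (v2 i j z - v2 i j z') by ring.
    by apply: le_trans (ler_normB _ _) _; clear -a1 a2; lra.
  have res := sch x0 _ _ _ _ A _ C2W cP A0' weh al' bd H0h holh.
  by have := res k l x y xr yr; rewrite !qE.
have CA : 0 <= C * A by nneg.
have r20 : 0 < r / 2 by rewrite divr_gt0.
have hm0 : 0 < minr h0 r by rewrite lt_min h00.
exists (r / 2 / 2), (C * A); split=> //; first by rewrite divr_gt0.
move=> k l.
have [g1 [dg hg]] := derivable_of_quot (cw2 k l) r20 CA hm0 alpha0
  (fun h x y hp hh xr yr => @hol2 h x y k l hp hh xr yr).
exists g1; split=> // x xr.
have s0 : 0 < 4 * r - `|x - x0| by lra.
apply: is_derive_near s0 _ (dg x xr) => y yr.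
rewrite (ew y _).2//.
by have := ler_normD (y - x) (x - x0); rewrite addrA subrK; lra.
Qed.

Lemma third_derivative v v1 v2 (Phi : 'I_n -> 'I_n -> V -> R) (m : 'I_n) :
  C2on O v v1 v2 -> (forall i j, lh alpha O (v2 i j)) ->
  (forall k l, con O (Phi k l)) -> WE O Phi ->
  (forall x0, O x0 -> exists lam Lam Kc r0 h0 A0 : R,
    [/\ 0 < lam, 0 <= Kc, 0 < r0, 0 < h0 & 0 <= A0 /\
    forall h, 0 < h -> h <= h0 -> almost_linear lam Lam alpha Kc r0 x0
     (fun i j => quot (v2 i j) m h) (fun k l => quot (Phi k l) m h) A0]) ->
  forall k l, exists2 g : V -> R,
    (forall x, O x -> is_derive x (e m) (v2 k l) (g x)) & lh alpha O g.
Proof.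
move=> C2v hv2 cPhi we al k l.
have loc x0 : O x0 -> exists r C : R, [/\ 0 < r, 0 <= C & exists g1 : V -> R,
    (forall x, `|x - x0| <= r -> is_derive x (e m) (v2 k l) (g1 x)) /\
    (forall x y, `|x - x0| <= r -> `|y - x0| <= r ->
       `|g1 x - g1 y| <= C * `|x - y| `^ alpha)].
  move=> Ox; have [lam [Lam [Kc [r0 [h0 [A0 [a1 a2 a3 a4 [a5 a6]]]]]]]] := al x0 Ox.
  have [r [C [rp C0 h]]] := third_derivative_local C2v hv2 cPhi we Ox a1 a2 a3 a4 a5 a6.
  by exists r, C; split.
exists (fun x => 'D_(e m) (v2 k l) x).
  move=> x /loc[r [C [rp C0 [g1 [d1 _]]]]]; apply/derivableP.
  by apply: (@ex_derive _ _ _ _ _ _ _ (d1 x _)); rewrite subrr normr0 ltW.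
move=> x0 /loc[r [C [rp C0 [g1 [d1 h1]]]]]; exists r, C; split=> // x y xr yr.
rewrite (@derive_val _ _ _ _ _ _ _ (d1 x xr)) (@derive_val _ _ _ _ _ _ _ (d1 y yr)).
exact: h1.
Qed.

End third_derivatives.

Lemma is_derive_sum1 {R : realType} (W : normedModType R) (J : Type) (s : seq J)
    (F : J -> W -> R) (dF : J -> R) (x v : W) :
  (forall j, is_derive x v (F j) (dF j)) ->
  is_derive x v (fun y => \sum_(j <- s) F j y) (\sum_(j <- s) dF j).
Proof.
move=> h; elim: s => [|j s IH].
  by rewrite big_nil; under eq_fun do rewrite big_nil; exact: is_derive_cst.
rewrite big_cons; under eq_fun do rewrite big_cons.
exact: is_deriveD (h j) IH.
Qed.

(** * Difference quotients of linear equations *)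

Section linear_equation.
Context {R : realType} {n : nat}.
Local Notation V := 'rV[R]_n.
Local Notation e i := (delta_mx ord0 i : V).
Variables (alpha : R) (O : set V).
Hypotheses (alpha0 : 0 < alpha) (alpha1 : alpha < 1) (oO : open O).

Lemma lh_family (J : finType) (F : J -> V -> R) x0 : (forall j, lh alpha O (F j)) -> O x0 ->
  exists r C : R, [/\ 0 < r, 0 <= C, forall x, `|x - x0| <= r -> O x,
    forall j x, `|x - x0| <= r -> `|F j x| <= C &
    forall j x y, `|x - x0| <= r -> `|y - x0| <= r -> `|F j x - F j y| <= C * `|x - y| `^ alpha].
Proof.
move=> hF Ox; have [R0 R00 hO] := open_ballV oO Ox.
pose P r C j := (forall x, `|x - x0| <= r -> `|F j x| <= C) /\
  (forall x y, `|x - x0| <= r -> `|y - x0| <= r -> `|F j x - F j y| <= C * `|x - y| `^ alpha).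
have Pmono r r' C C' j : r' <= r -> C <= C' -> P r C j -> P r' C' j.
  move=> rr CC [h1 h2]; split=> [x xr|x y xr yr].
    by apply: le_trans CC; apply: h1; exact: le_trans rr.
  apply: le_trans (h2 x y (le_trans xr rr) (le_trans yr rr)) _.
  by apply: ler_wpM2r => //; exact: powR_ge0.
have [||r r0 h1] := @finite_lower R J (fun j r => exists C, P r C j).
- by move=> j r r' r'0 rr [C hC]; exists C; exact: Pmono hC.
- move=> j; have [r [C [r0 C0 h]]] := hF j x0 Ox.
  have [s [B [s0 B0 hB]]] := lh_bounded alpha0 (hF j) Ox.
  exists (minr r s); first by rewrite lt_min r0.
  exists (maxr B C); split=> [x|x y]; rewrite !le_min.
    by move=> /andP[_ xs]; rewrite le_max hB.
  move=> /andP[xr _] /andP[yr _]; apply: le_trans (h x y xr yr) _.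
  by apply: ler_wpM2r; [exact: powR_ge0|rewrite le_max lexx orbT].
have [||C C0 h2] := @finite_upper R J (fun j C => P r C j).
- by move=> j C C' CC; exact: Pmono.
- exact: h1.
exists (minr R0 r), C; split=> //; first by rewrite lt_min R00.
- by move=> x; rewrite le_min => /andP[xr _]; exact: hO.
- by move=> j x; rewrite le_min => /andP[_ xr]; exact: (h2 j).1.
- by move=> j x y; rewrite !le_min => /andP[_ xr] /andP[_ yr]; exact: (h2 j).2.
Qed.

Section quotient_bounds.
Variables (g g1 : V -> R) (m : 'I_n) (x0 : V) (r C : R).
Hypotheses (dg : forall x, `|x - x0| <= r -> is_derive x (e m) g (g1 x))
  (bg : forall x, `|x - x0| <= r -> `|g1 x| <= C)
  (hg : forall x y, `|x - x0| <= r -> `|y - x0| <= r -> `|g1 x - g1 y| <= C * `|x - y| `^ alpha).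

Let inr_ (x : V) (h s : R) : `|x - x0| <= r / 2 -> 0 < h -> h <= r / 2 -> `|s| <= `|h| ->
  `|x + s *: e m - x0| <= r.
Proof.
move=> xr h0 hr; rewrite (gtr0_norm h0) => sh; rewrite addrAC.
by apply: le_trans (ler_normD _ _) _; rewrite normrZ normr_delta mulr1; lra.
Qed.

Lemma quot_bound h x : 0 < h -> h <= r / 2 -> `|x - x0| <= r / 2 -> `|quot g m h x| <= C.
Proof.
move=> h0 hr xr; rewrite /quot.
have [s sh ->] := @MVT_line R V g g1 x (e m) h (fun s sh => dg (inr_ xr h0 hr sh)).
by rewrite mulrC mulKf ?gt_eqF//; apply: bg; exact: inr_ sh.
Qed.

(** The mean value theorem is applied to the single function g(z + x - y) - g(z), so that both
    quotients see the same intermediate parameter and only the Hoelder bound on [g1] at distance |x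
    - y| is used. *)
Lemma quot_holder h x y : 0 < h -> h <= r / 2 -> `|x - x0| <= r / 2 -> `|y - x0| <= r / 2 ->
  `|quot g m h x - quot g m h y| <= C * `|x - y| `^ alpha.
Proof.
move=> h0 hr xr yr.
pose G (z : V) := g (z + (x - y)) - g z.
have dG s : `|s| <= `|h| ->
    is_derive (y + s *: e m) (e m) G (g1 (y + s *: e m + (x - y)) - g1 (y + s *: e m)).
  move=> sh; apply: is_deriveB; last exact/dg/(inr_ yr h0 hr sh).
  apply: is_derive_shiftr; apply: dg.
  by rewrite (_ : y + s *: e m + (x - y) = x + s *: e m); [exact: (inr_ xr h0 hr sh)|rewrite addrC addrA subrK].
have [s sh E] := @MVT_line R V G (fun z => g1 (z + (x - y)) - g1 z) y (e m) h dG.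
have -> : quot g m h x - quot g m h y = (G (y + h *: e m) - G y) / h.
  rewrite /quot /G -mulrBl; congr (_ / h).
  have -> : y + h *: e m + (x - y) = x + h *: e m by rewrite addrC addrA subrK.
  by rewrite [y + (x - y)]addrC subrK; ring.
rewrite E mulrC mulKf ?gt_eqF//.
have E' : y + s *: e m + (x - y) = x + s *: e m by rewrite addrC addrA subrK.
rewrite E'; apply: le_trans (hg (inr_ xr h0 hr sh) (inr_ yr h0 hr sh)) _.
by rewrite opprD addrACA subrr addr0.
Qed.

End quotient_bounds.

Lemma sum2_norm_le (F : 'I_n -> 'I_n -> R) c : (forall i j, `|F i j| <= c) ->
  `|\sum_i \sum_j F i j| <= n%:R ^+ 2 * c.
Proof.
move=> h; apply: le_trans (ler_norm_sum _ _ _) _.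
apply: (@le_trans _ _ (\sum_(i < n) (n%:R * c))).
  apply: ler_sum => i _; apply: le_trans (ler_norm_sum _ _ _) _.
  apply: (@le_trans _ _ (\sum_(j < n) c)); first by apply: ler_sum => j _.
  by rewrite sumr_const card_ord -[leLHS]mulr_natl.
by rewrite sumr_const card_ord -[leLHS]mulr_natl expr2 mulrA.
Qed.

(** Discrete Leibniz rule: the quotient of b v2 is b(z) times the quotient of v2 plus the quotient
    of b times v2 at the translated point. Freezing b at x costs rho^alpha times the quotient of v2.
    The rest is constant up to rho^alpha, since b and f have Hoelder derivatives and v2 is
    Hoelder. *)
Lemma linear_almost_linear (b b1 : 'I_n -> 'I_n -> 'I_n -> 'I_n -> V -> R)
    (f f1 v2 Phi : 'I_n -> 'I_n -> V -> R) (m : 'I_n) lam x0 : 0 < lam ->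
  (forall i j k l, lh alpha O (b i j k l)) -> (forall i j k l, lh alpha O (b1 i j k l)) ->
  (forall k l, lh alpha O (f1 k l)) -> (forall i j, lh alpha O (v2 i j)) ->
  (forall i j k l x, O x -> is_derive x (e m) (b i j k l) (b1 i j k l x)) ->
  (forall k l x, O x -> is_derive x (e m) (f k l) (f1 k l x)) ->
  (forall k l x, O x -> Phi k l x = \sum_i \sum_j b i j k l x * v2 i j x - f k l x) ->
  (forall x w, O x -> (forall i j, w i j = w j i) ->
    lam * sqs w <= \sum_k \sum_l contr (fun i j k l => b i j k l x) w k l * w k l) ->
  O x0 -> exists lam Lam Kc r0 h0 A0 : R,
    [/\ 0 < lam, 0 <= Kc, 0 < r0, 0 < h0 & 0 <= A0 /\
    forall h, 0 < h -> h <= h0 -> almost_linear lam Lam alpha Kc r0 x0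
     (fun i j => quot (v2 i j) m h) (fun k l => quot (Phi k l) m h) A0].
Proof.
move=> lam0 hb hb1 hf1 hv2 db df ePhi el Ox0.
pose T := ('I_n * 'I_n * 'I_n * 'I_n)%type.
have [r1 [C1 [r10 C10 hO B1 H1]]] := lh_family (fun t : T => hb t.1.1.1 t.1.1.2 t.1.2 t.2) Ox0.
have [r2 [C2 [r20 C20 _ B2 H2]]] := lh_family (fun t : T => hb1 t.1.1.1 t.1.1.2 t.1.2 t.2) Ox0.
have [r3 [C3 [r30 C30 _ B3 H3]]] := lh_family (fun t : 'I_n * 'I_n => hf1 t.1 t.2) Ox0.
have [r4 [C4 [r40 C40 _ B4 H4]]] := lh_family (fun t : 'I_n * 'I_n => hv2 t.1 t.2) Ox0.
pose r := minr (minr r1 r2) (minr r3 r4).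
have r0 : 0 < r by rewrite !lt_min r10 r20 r30.
have [rr1 rr2 rr3 rr4] : [/\ r <= r1, r <= r2, r <= r3 & r <= r4].
  by split; rewrite !ge_min lexx ?orbT.
have r21 (x : V) : `|x - x0| <= r / 2 -> `|x - x0| <= r by lra.
exists lam, C1, (n%:R ^+ 2 * C1), (r / 2), (r / 2), (n%:R ^+ 2 * (2 * C2 * C4) + C3).
split; [by []|by nneg|by lra|by lra|split; first by nneg].
move=> h h0 hr x rho xr rho0.
pose sh (z : V) := z + h *: e m.
have shr z : `|z - x0| <= r / 2 -> `|sh z - x0| <= r.
  move=> zr; rewrite addrAC; apply: le_trans (ler_normD _ _) _.
  by rewrite normrZ normr_delta mulr1 gtr0_norm//; lra.
exists (fun i j k l => b i j k l x).
(* The constant part is the second Leibniz term at [x] less the quotient of [f] there. *)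
exists (fun k l => \sum_i \sum_j quot (b i j k l) m h x * v2 i j (sh x) - quot (f k l) m h x).
  split; first by move=> w ws; apply: el => //; apply: hO; lra.
  by move=> i j k l; apply: (B1 (i, j, k, l)); lra.
move=> k l z W zr zx hW.
have r' (c : R) (y : V) : r <= c -> `|y - x0| <= r -> `|y - x0| <= c by lra.
have dbr i j y : `|y - x0| <= r -> is_derive y (e m) (b i j k l) (b1 i j k l y).
  by move=> yr; apply: db; apply: hO; lra.
have dfr y : `|y - x0| <= r -> is_derive y (e m) (f k l) (f1 k l y).
  by move=> yr; apply: df; apply: hO; lra.
have qb i j y : `|y - x0| <= r / 2 -> `|quot (b i j k l) m h y| <= C2.
  by apply: (quot_bound (dbr i j)) => // y' /(r' _ _ rr2); exact: (B2 (i, j, k, l)).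
have pz : `|z - x| `^ alpha <= rho `^ alpha by apply: ler_powR_base => //; exact: ltW.
have qbh i j : `|quot (b i j k l) m h z - quot (b i j k l) m h x| <= C2 * rho `^ alpha.
  apply: le_trans (ler_wpM2l C20 pz).
  apply: (quot_holder (dbr i j) _ h0 hr zr xr) => y y' /(r' _ _ rr2) yr /(r' _ _ rr2) y'r.
  exact: (H2 (i, j, k, l)).
have qfh : `|quot (f k l) m h z - quot (f k l) m h x| <= C3 * rho `^ alpha.
  apply: le_trans (ler_wpM2l C30 pz).
  apply: (quot_holder dfr _ h0 hr zr xr) => y y' /(r' _ _ rr3) yr /(r' _ _ rr3) y'r.
  exact: (H3 (k, l)).
pose q i j := quot (v2 i j) m h z.
have -> : quot (Phi k l) m h z - (\sum_i \sum_j quot (b i j k l) m h x * v2 i j (sh x) - quot (f k l) m h x) -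
    contr (fun i j k l => b i j k l x) q k l =
  \sum_i \sum_j ((b i j k l z - b i j k l x) * q i j +
     ((quot (b i j k l) m h z - quot (b i j k l) m h x) * v2 i j (sh z) +
      quot (b i j k l) m h x * (v2 i j (sh z) - v2 i j (sh x)))) -
  (quot (f k l) m h z - quot (f k l) m h x).
  have Oz : O z by apply: hO; lra.
  have Osz : O (sh z) by apply: hO; have := shr z zr; lra.
  have E0 : quot (Phi k l) m h z = \sum_i \sum_j (b i j k l (sh z) * v2 i j (sh z) - b i j k l z * v2 i j z) / h
      - quot (f k l) m h z.
    rewrite {1}/quot -/(sh z) !ePhi//.
    under [in RHS]eq_bigr do (rewrite -mulr_suml sumrB).
    by rewrite -mulr_suml sumrB /quot -/(sh z); ring.
  rewrite E0 /contr.
  rewrite [RHS](_ : _ = \sum_i \sum_j ((b i j k l (sh z) * v2 i j (sh z) - b i j k l z * v2 i j z) / h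
     - quot (b i j k l) m h x * v2 i j (sh x) - b i j k l x * q i j) - (quot (f k l) m h z - quot (f k l) m h x)).
    under [in RHS]eq_bigr do rewrite !sumrB.
    by rewrite !sumrB; ring.
  congr (_ - _); apply: eq_bigr => i _; apply: eq_bigr => j _.
  by rewrite /q /quot -/(sh z) -/(sh x); field; rewrite gt_eqF.
have rho1 := powR_ge0 rho alpha.
have main i j : `|(b i j k l z - b i j k l x) * q i j +
     ((quot (b i j k l) m h z - quot (b i j k l) m h x) * v2 i j (sh z) +
      quot (b i j k l) m h x * (v2 i j (sh z) - v2 i j (sh x)))| <=
   rho `^ alpha * (C1 * W + 2 * C2 * C4).
  have t1 : `|(b i j k l z - b i j k l x) * q i j| <= C1 * rho `^ alpha * W.
    rewrite normrM; apply: ler_pM => //; last exact: hW.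
    apply: le_trans (ler_wpM2l C10 pz).
    by apply: (H1 (i, j, k, l)); lra.
  have t2 : `|(quot (b i j k l) m h z - quot (b i j k l) m h x) * v2 i j (sh z)| <= C2 * rho `^ alpha * C4.
    rewrite normrM; apply: ler_pM => //; apply: (B4 (i, j)).
    by have := shr z zr; lra.
  have t3 : `|quot (b i j k l) m h x * (v2 i j (sh z) - v2 i j (sh x))| <= C2 * (C4 * rho `^ alpha).
    rewrite normrM; apply: ler_pM => //; first exact: qb.
    apply: le_trans (ler_wpM2l C40 pz).
    have -> : z - x = sh z - sh x by rewrite /sh opprD addrACA subrr addr0.
    by apply: (H4 (i, j)); [have := shr z zr; lra|have := shr x xr; lra].
  apply: le_trans (ler_normD _ _) _; have := ler_normD ((quot (b i j k l) m h z - quot (b i j k l) m h x) * v2 i j (sh z))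
     (quot (b i j k l) m h x * (v2 i j (sh z) - v2 i j (sh x))).
  by lra.
apply: le_trans (ler_normB _ _) _.
have := sum2_norm_le main; lra.
Qed.

End linear_equation.

(** * The differentiated equation *)

Section differentiated_equation.
Context {R : realType} {n : nat}.
Local Notation V := 'rV[R]_n.
Local Notation e i := (delta_mx ord0 i : V).

Lemma Dk_derive (f : V -> R) i : (forall k, Dk k f) ->
  (forall x, is_derive x (e i) f ('D_(e i) f x)) /\ forall k, Dk k (fun x => 'D_(e i) f x).
Proof.
move=> Df; split=> [x|k].
  by have [_ /(_ i)[f1 d1 _]] := Df 1%N; apply/derivableP; exact: (@ex_derive _ _ _ _ _ _ _ (d1 x)).
have [_ /(_ i)[f1 d1 D1]] := Df k.+1; congr (Dk k _) : D1.
by apply/funext => x; rewrite (@derive_val _ _ _ _ _ _ _ (d1 x)).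
Qed.

Lemma Dk_comm (f : V -> R) i j : (forall k, Dk k f) -> forall x,
  is_derive x (e i) (fun y => 'D_(e j) f y) ('D_(e j) (fun y => 'D_(e i) f y) x).
Proof.
move=> Df x; have [di Di] := Dk_derive i Df; have [dj Dj] := Dk_derive j Df.
have [dij Dij] := Dk_derive j Di.
have cij := Dk_cont (Dij 0%N).
exact: (@mixed_derivative R n f (fun y => 'D_(e i) f y) (fun y => 'D_(e j) f y)
  (fun y => 'D_(e j) (fun y => 'D_(e i) f y) y) (e i) (e j) x 1 ltr01
  (fun y _ => di y) (fun y _ => dj y) (fun y _ => dij y) (cij x)).
Qed.

Lemma derive_off (K : set V) (f f1 : V -> R) (v : V) : closed K -> (forall x, ~ K x -> f x = 0) ->
  (forall x, is_derive x v f (f1 x)) -> forall x, ~ K x -> f1 x = 0.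
Proof.
move=> cK f0 d1 x Kx; have [r r0 hr] := off_closed cK Kx.
apply: is_derive_unique (d1 x) _.
by apply: (@is_derive_near _ _ (fun=> 0) _ x _ _ r r0) => y yr; rewrite f0//; exact: hr.
Qed.

Lemma test_flux (O : set V) (eta f : V -> R) k l : test_function O eta -> con O f ->
  Cc (fun x => f x * pd2 k l eta x) /\ forall x, ~ O x -> pd2 k l eta x = 0.
Proof.
move=> [/smooth_onTP De cK KO] cf; set K := closure _ in cK KO.
have clK : closed K by exact: closed_closure.
have e0 x : ~ K x -> eta x = 0.
  by move=> Kx; apply: contrapT => /eqP ex; apply: Kx; exact: subset_closure.
have [dk Dk_] := Dk_derive k De; have [dl Dl] := Dk_derive l Dk_.
have p0 : forall x, ~ K x -> pd2 k l eta x = 0 := derive_off clK (derive_off clK e0 dk) dl.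
split; last by move=> x Ox; apply: p0 => /KO.
split; first exact: (glue_cont clK KO p0 cf (Dk_cont (Dl 0%N))).
have [M [_ hM]] := compact_bounded cK; exists (M + 2) => x xM; rewrite p0 ?mulr0// => Kx.
have /hM /(_ x Kx) : M < M + 1 by rewrite ltrDl.
rewrite /=; lra.
Qed.

Variables (O : set V).

(** The equation is tested with the m-th derivative of [eta]. Derivatives of [eta] commute, so the
    m-th derivative of Phi eta_kl, which has integral 0, moves the derivative onto the flux. *)
Lemma WE_derive (Phi Phi1 : 'I_n -> 'I_n -> V -> R) (m : 'I_n) :
  (forall k l, con O (Phi k l)) -> (forall k l, con O (Phi1 k l)) ->
  (forall k l x, O x -> is_derive x (e m) (Phi k l) (Phi1 k l x)) ->
  WE O Phi -> WE O Phi1.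
Proof.
move=> cP cP1 dP we eta te; have [/smooth_onTP De cK KO] := te.
set K := closure _ in cK KO.
have clK : closed K by exact: closed_closure.
have e0 x : ~ K x -> eta x = 0.
  by move=> Kx; apply: contrapT => /eqP ex; apply: Kx; exact: subset_closure.
have [dm Dm] := Dk_derive m De.
pose etam x := 'D_(e m) eta x.
have m0 : forall x, ~ K x -> etam x = 0 := derive_off clK e0 dm.
have sub : closure [set x | etam x != 0] `<=` K.
  rewrite closureE => x; apply; split=> // y /= my.
  by apply: contrapT => /m0 h; rewrite h eqxx in my.
have tm : test_function O etam.
  split; [exact/smooth_onTP| |exact: subset_trans KO].
  by apply: (@subclosed_compact _ _ K) => //; exact: closed_closure.
have Deta k := Dk_derive k De.
have pE k l x : is_derive x (e m) (pd2 k l eta) (pd2 k l etam x).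
  have [dk Dk_] := Deta k.
  have E : (fun y => 'D_(e k) etam y) = (fun y => 'D_(e m) (fun y => 'D_(e k) eta y) y).
    apply/funext => y; have [dkm _] := Dk_derive m Dk_.
    exact: is_derive_unique (Dk_comm m k De y) (dkm y).
  have -> : pd2 k l etam x = 'D_(e l) (fun y => 'D_(e m) (fun y => 'D_(e k) eta y) y) x.
    exact: (congr1 (fun g : V -> R => 'D_(e l) g x) E).
  exact: (Dk_comm m l Dk_ x).
have p0 k l : forall x, ~ K x -> pd2 k l eta x = 0.
  have [dk Dk_] := Deta k; have [dl Dl] := Dk_derive l Dk_.
  exact: derive_off clK (derive_off clK e0 dk) dl.
have pm0 k l : forall x, ~ K x -> pd2 k l etam x = 0 := derive_off clK (p0 k l) (pE k l).
have CP k l := (test_flux k l te (cP k l)).1.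
have CPm k l := (test_flux k l tm (cP k l)).1.
have CP1 k l := (test_flux k l te (cP1 k l)).1.
have key k l : I (fun x => Phi1 k l x * pd2 k l eta x) = - I (fun x => Phi k l x * pd2 k l etam x).
  apply/eqP; rewrite -subr_eq0 opprK addrC -ID//; apply/eqP.
  apply: (@I_derive0 _ _ (fun x => Phi k l x * pd2 k l eta x) _ (e m) (CP k l)).
    by apply: contD; [exact: (CPm k l).1|exact: (CP1 k l).1].
  exact: (glue_derive clK KO (p0 k l) (dP k l) (pE k l) (pm0 k l)).
have := we _ tm.
rewrite I_sum; last by move=> k; apply: Cc_sum => l; exact: CPm.
rewrite I_sum; last by move=> k; apply: Cc_sum => l; exact: CP1.
move=> h; rewrite -[RHS]oppr0 -[X in - X]h -sumrN; apply: eq_bigr => k _.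
rewrite I_sum; last by move=> l; exact: CP1.
rewrite I_sum; last by move=> l; exact: CPm.
by rewrite -sumrN; apply: eq_bigr => l _; exact: key.
Qed.

End differentiated_equation.

(** * Bootstrap for linear equations *)

Section bootstrap.
Context {R : realType} {n : nat}.
Local Notation V := 'rV[R]_n.
Local Notation e i := (delta_mx ord0 i : V).
Variables (alpha : R) (O : set V).
Hypotheses (alpha0 : 0 < alpha) (alpha1 : alpha < 1) (oO : open O).
Local Notation cka := (cka alpha O).

Lemma cka_lh k (f : V -> R) : cka k f -> lh alpha O f. Proof. exact: Cls_base. Qed.

Lemma cka_con k (f : V -> R) : cka k f -> con O f.
Proof. by move=> /cka_lh; exact: lh_con. Qed.

Lemma ckaS k (f : V -> R) : cka k.+1 f -> cka k f. Proof. exact: ClsS. Qed.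

Lemma cka_intro k (f : V -> R) (f1 : 'I_n -> V -> R) : lh alpha O f ->
  (forall i x, O x -> is_derive x (e i) f (f1 i x)) -> (forall i, cka k (f1 i)) -> cka k.+1 f.
Proof. by move=> hf d1 h1; split=> // _ [i _ <-]; exists (f1 i); [exact: d1|exact: h1]. Qed.

(** Only derivatives of the second derivatives in the direction [m] are given. The remaining ones,
    which make [v2 m] the gradient of a C^1 map, come from commuting derivatives by
    [mixed_derivative_on]. *)
Lemma C2on_derive v v1 v2 (v3 : 'I_n -> 'I_n -> 'I_n -> V -> R) m : C2on O v v1 v2 ->
  (forall i j x, O x -> is_derive x (e m) (v2 i j) (v3 m i j x)) -> (forall i j, con O (v3 m i j)) ->
  C2on O (v1 m) (v2 m) (v3 m).
Proof.
move=> C2v d3 c3; have [cv c1 c2 d1 d2] := C2v.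
split; [exact: c1|exact: c2|exact: c3|exact: d2|move=> i j x Ox].
have h := mixed_derivative_on oO (d2 i j) (d2 i m) (d3 i j) (c3 i j) Ox.
by apply: (is_derive_on oO _ Ox h) => y Oy; exact: C2on_sym C2v _ _ _ Oy.
Qed.

(** The induction ranges over all solutions and all right-hand sides: the m-th derivative of a
    solution solves the equation with the same [b] and the right-hand side f_m - b_m v2. *)
Lemma bootstrap lam k v v1 v2 (b : 'I_n -> 'I_n -> 'I_n -> 'I_n -> V -> R) (f : 'I_n -> 'I_n -> V -> R) :
  0 < lam -> C2on O v v1 v2 -> (forall i j, lh alpha O (v2 i j)) ->
  (forall i j k' l, cka k (b i j k' l)) -> (forall k' l, cka k (f k' l)) ->
  (forall x w, O x -> (forall i j, w i j = w j i) ->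
    lam * sqs w <= \sum_k \sum_l contr (fun i j k l => b i j k l x) w k l * w k l) ->
  WE O (fun k l x => \sum_i \sum_j b i j k l x * v2 i j x - f k l x) ->
  forall i j, cka k (v2 i j).
Proof.
move=> lam0; elim: k v v1 v2 f => [|k IH] v v1 v2 f C2v hv2 cb cf el we.
  by move=> i j; split.
(* The induction hypothesis serves twice: here for [v] itself, since [v2] enters the right-hand side
   of the differentiated equation, and later for the derivatives of [v]. *)
have hv2k := IH v v1 v2 f C2v hv2 (fun i j k' l => ckaS (cb i j k' l)) (fun k' l => ckaS (cf k' l)) el we.
pose T := ('I_n * 'I_n * 'I_n * 'I_n * 'I_n)%type.
have [b1 hb1] := choice (fun t : T =>
  let: ex_intro2 g d c := cka_derive t.1.1.1.1 (cb t.1.1.1.2 t.1.1.2 t.1.2 t.2) in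
  ex_intro (fun g => (forall x, O x -> is_derive x (e t.1.1.1.1) (b t.1.1.1.2 t.1.1.2 t.1.2 t.2) (g x)) /\
    cka k g) g (conj d c)).
have [f1 hf1] := choice (fun t : 'I_n * 'I_n * 'I_n =>
  let: ex_intro2 g d c := cka_derive t.1.1 (cf t.1.2 t.2) in
  ex_intro (fun g => (forall x, O x -> is_derive x (e t.1.1) (f t.1.2 t.2) (g x)) /\
    cka k g) g (conj d c)).
have cPhi k' l : con O (fun x => \sum_i \sum_j b i j k' l x * v2 i j x - f k' l x).
  apply: (@cka_con k); apply: ckaB => //; last exact: ckaS.
  apply: cka_sum => i; apply: cka_sum => j.
  by apply: ckaM => //; exact: ckaS.
have third m k' l : exists2 g : V -> R, (forall x, O x -> is_derive x (e m) (v2 k' l) (g x)) & lh alpha O g.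
  apply: (third_derivative alpha0 alpha1 oO C2v hv2 cPhi we) => x0 Ox0.
  apply: (@linear_almost_linear _ _ alpha O alpha0 oO b (fun i j k l => b1 (m, i, j, k, l)) f
    (fun k l => f1 (m, k, l)) v2 _ m lam x0) => //.
  - by move=> *; exact: cka_lh (cb _ _ _ _).
  - by move=> i j k'' l'; exact: cka_lh (hb1 (m, i, j, k'', l')).2.
  - by move=> k'' l'; exact: cka_lh (hf1 (m, k'', l')).2.
  - by move=> i j k'' l'; exact: (hb1 (m, i, j, k'', l')).1.
  - by move=> k'' l'; exact: (hf1 (m, k'', l')).1.
have [v3' hv3'] := choice (fun t : 'I_n * 'I_n * 'I_n =>
  let: ex_intro2 g d c := third t.1.1 t.1.2 t.2 in
  ex_intro (fun g => (forall x, O x -> is_derive x (e t.1.1) (v2 t.1.2 t.2) (g x)) /\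
    lh alpha O g) g (conj d c)).
pose v3 m i j := v3' (m, i, j).
have d3 m i j x : O x -> is_derive x (e m) (v2 i j) (v3 m i j x) by exact: (hv3' (m, i, j)).1.
have h3 m i j : lh alpha O (v3 m i j) by exact: (hv3' (m, i, j)).2.
have ck3 m : forall i j, cka k (v3 m i j).
  have C2v' : C2on O (v1 m) (v2 m) (v3 m).
    by apply: C2on_derive C2v (d3 m) _ => i j; exact (lh_con alpha0 (h3 m i j)).
  pose f' k' l x := f1 (m, k', l) x - \sum_i \sum_j b1 (m, i, j, k', l) x * v2 i j x.
  have cf' k' l : cka k (f' k' l).
    apply: ckaB; [by []|exact: (hf1 (m, k', l)).2|].
    apply: cka_sum => i; apply: cka_sum => j.
    by apply: ckaM => //; exact: (hb1 (m, i, j, k', l)).2.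
  apply: (IH _ _ _ f' C2v') => //; first by move=> i j k' l; exact: ckaS (cb i j k' l).
  apply: WE_derive (m) cPhi _ _ we => k' l.
    apply: (@lh_con _ _ alpha) => //; apply: (@cka_lh 0); apply: ckaB => //; last by split=> //; exact: cka_lh (cf' k' l).
    apply: cka_sum => i; apply: cka_sum => j.
    by apply: ckaM => //; split=> //; exact: cka_lh (cb i j k' l).
  move=> x Ox.
  have -> : \sum_i \sum_j b i j k' l x * v3 m i j x - f' k' l x =
     \sum_i \sum_j (b i j k' l x * v3 m i j x + b1 (m, i, j, k', l) x * v2 i j x) - f1 (m, k', l) x.
    rewrite /f'; under [in RHS]eq_bigr do rewrite big_split /=.
    by rewrite big_split /=; ring.
  apply: is_deriveB; last exact: (hf1 (m, k', l)).1.
  apply: is_derive_sum1 => i; apply: is_derive_sum1 => j.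
  by apply: is_deriveM1; [exact: (hb1 (m, i, j, k', l)).1|exact: d3].
move=> i j; exact: (cka_intro (hv2 i j) (fun m => d3 m i j) (fun m => ck3 m i j)).
Qed.

End bootstrap.

(** * Functions of symmetric matrices *)

Section matrix_norm.
Context {R : realType} {m n : nat}.
Implicit Types x y : 'M[R]_(m, n).

Lemma normM_coord x i j : `|x i j| <= `|x|.
Proof.
rewrite [leRHS]/normr /= mx_normrE.
by apply/bigmax_geP; right => /=; exists (i, j).
Qed.

Lemma normM_leP x (c : R) : 0 <= c -> (forall i j, `|x i j| <= c) -> `|x| <= c.
Proof.
move=> c0 h; rewrite [leLHS]/normr /= mx_normrE.
by apply/bigmax_leP; split => // -[i j] _ /=.
Qed.

End matrix_norm.

Section symmetric_calculus.
Context {R : realType} {n : nat}.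
Local Notation W := 'M[R]_n.
Variable U : set W.
Hypothesis oU : open_in_symm U.

(** The direction in which [dsym p q] differentiates. *)
Definition symu (p q : 'I_n) : W := 2^-1 *: (delta_mx p q + delta_mx q p).

Lemma symm_symu p q : symm (symu p q).
Proof. by rewrite /symm /symu /= linearZ /= linearD /= !trmx_delta addrC. Qed.

Lemma symmD (M N : W) : symm M -> symm N -> symm (M + N).
Proof. by rewrite /symm /= => {2}<- {2}<-; rewrite linearD. Qed.

Lemma symmZ c (M : W) : symm M -> symm (c *: M).
Proof. by rewrite /symm /= => {2}<-; rewrite linearZ. Qed.

Lemma symmB (M N : W) : symm M -> symm N -> symm (M - N).
Proof. by move=> h k; apply: symmD => //; rewrite -scaleN1r; exact: symmZ. Qed.

Lemma U_symm M : U M -> symm M.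
Proof. by have [Z [_ ->]] := oU => -[]. Qed.

Lemma U_ball M0 : U M0 -> exists2 r : R, 0 < r & forall M, symm M -> `|M - M0| <= r -> U M.
Proof.
have [Z [oZ ->]] := oU => -[ZM _].
have /nbhs_ballP[r /= r0 hr] : nbhs M0 Z by exact: open_nbhs_nbhs.
exists (r / 2); first by rewrite divr_gt0.
move=> M sM Mr; split=> //; apply: hr; rewrite -ball_normE /= distrC; lra.
Qed.

Definition cU (G : W -> R) := forall M, U M -> G N @[N --> within U (nbhs M)] --> G M.

Lemma cUP G : cU G <-> forall M (d : R), U M -> 0 < d -> exists2 r : R, 0 < r &
  forall N, U N -> `|N - M| < r -> `|G N - G M| < d.
Proof.
split=> [h M d UM d0|h M UM].
  have := h M UM; move=> /cvgrPdist_lt /(_ _ d0); rewrite near_withinE => /nbhs_ballP[r /= r0 hr].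
  exists r => // N UN Nr; rewrite distrC; apply: hr => //.
  by rewrite -ball_normE /= distrC.
apply/cvgrPdist_lt => d d0; have [r r0 hr] := h M d UM d0.
rewrite near_withinE; apply/nbhs_ballP; exists r => //= N.
by rewrite -ball_normE /= distrC => Nr UN; rewrite distrC; exact: hr.
Qed.

Lemma cU_cst (c : R) : cU (fun=> c). Proof. by move=> M _; exact: cvg_cst. Qed.

Lemma cUD G G' : cU G -> cU G' -> cU (fun M => G M + G' M).
Proof. by move=> h k M UM; apply: cvgD; [exact: h|exact: k]. Qed.

Lemma cUM G G' : cU G -> cU G' -> cU (fun M => G M * G' M).
Proof. by move=> h k M UM; apply: cvgM; [exact: h|exact: k]. Qed.

Definition CU := Cls cU (@symm R n) U.

Lemma smooth_CU G : smooth (@symm R n) U G -> forall k, CU k G.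
Proof.
move=> sG k; elim: k G {sG}(sG k) => [|k IH] G [cG h].
  by split=> //; exact/subspace_continuousP.
split; first exact/subspace_continuousP.
move=> v sv; have [dG cG'] := h v sv; exists (fun M => 'D_v G M); last exact: IH.
by move=> M UM; apply/derivableP; exact: dG.
Qed.

Lemma CU_coord k (i j : 'I_n) : CU k (fun M => M i j).
Proof.
have c0 : cU (fun M : W => M i j).
  by move=> M UM; apply: cvg_within_filter; exact: coord_continuous.
case: k => [|k]; split=> // v _; exists (fun=> v i j); last exact: Cls_cst cU_cst.
move=> M _; apply/is_deriveP => d d0; exists 1 => // h h0 _.
by rewrite !mxE [M i j + _]addrC addrK mulrC mulKf// subrr normr0.
Qed.

Lemma pair_sum (F : 'I_n * 'I_n -> R) : \sum_pq F pq = \sum_p \sum_q F (p, q).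
Proof. by rewrite pair_bigA; apply: eq_bigr => -[]. Qed.

(* The expansion of a symmetric matrix along the [symu p q], with truncated
   coefficients [c], stays entrywise bounded by [c]: hence the path that changes
   one coefficient at a time stays in a ball of symmetric matrices. *)
Definition symX (c : 'I_n * 'I_n -> R) : W := \matrix_(i, j) (2^-1 * (c (i, j) + c (j, i))).

Lemma symm_symX c : symm (symX c).
Proof. by apply/matrixP => i j; rewrite !mxE addrC. Qed.

Lemma symX_norm c (C : R) : 0 <= C -> (forall pq, `|c pq| <= C) -> `|symX c| <= C.
Proof.
move=> C0 hc; apply: normM_leP => // i j; rewrite mxE normrM ger0_norm ?invr_ge0//.
have := ler_normD (c (i, j)) (c (j, i)).
by have := hc (i, j); have := hc (j, i); lra.
Qed.

(** Only derivatives along the [symu], at points of [U], are available. An exact increment formula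
    by the mean value theorem, with one intermediate point per coefficient, takes the place of
    Frechet differentiability. *)
Lemma increment (G : W -> R) (G1 : 'I_n -> 'I_n -> W -> R) M (xi : W) :
  (forall p q N, U N -> is_derive N (symu p q) G (G1 p q N)) ->
  symm M -> symm xi -> (forall N, symm N -> `|N - M| <= `|xi| -> U N) ->
  exists N : 'I_n * 'I_n -> W, (forall pq, symm (N pq) /\ `|N pq - M| <= `|xi|) /\
    G (M + xi) - G M = \sum_pq xi pq.1 pq.2 * G1 pq.1 pq.2 (N pq).
Proof.
move=> dG sM sxi hU.
pose T := ('I_n * 'I_n)%type.
(* After [t] steps the first [t] pairs of the enumeration have received their coefficient; [c' t s]
   gives the intermediate value [s] to the pair of rank [t]. *)
pose c (t : nat) (pq : T) : R := if (enum_rank pq < t)%N then xi pq.1 pq.2 else 0.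
pose c' (t : nat) (s : R) (pq : T) : R := c t pq + (if (enum_rank pq == t :> nat) then s else 0).
have cs t s pq : `|s| <= `|xi pq.1 pq.2| -> enum_rank pq = t :> nat ->
    symX (c' t s) = symX (c t) + s *: symu pq.1 pq.2.
  move=> _ pt; apply/matrixP => i j; rewrite !mxE /c' -pt.
  have E (a b : 'I_n) : (enum_rank (a, b) == enum_rank pq :> nat) = (a == pq.1) && (b == pq.2).
    by rewrite -[LHS]/(enum_rank (a, b) == enum_rank pq) (inj_eq enum_rank_inj); case: pq {pt}.
  rewrite !E [(i == pq.2) && _]andbC.
  by case: (_ && _); case: (_ && _); rewrite /= ?mulr1n ?mulr0n; ring.
have step pq : exists N, (symm N /\ `|N - M| <= `|xi|) /\
    G (M + symX (c (enum_rank pq).+1)) - G (M + symX (c (enum_rank pq))) = xi pq.1 pq.2 * G1 pq.1 pq.2 N.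
  set t : nat := enum_rank pq.
  have Xn s : `|s| <= `|xi pq.1 pq.2| -> `|symX (c t) + s *: symu pq.1 pq.2| <= `|xi|.
    move=> sx; rewrite -(cs t s pq sx erefl); apply: symX_norm => // ab.
    rewrite /c' /c; case: ltngtP => ht; rewrite ?addr0 ?add0r ?normr0//; first exact: normM_coord.
    by apply: le_trans sx _; exact: normM_coord.
  have sX s : symm (M + (symX (c t) + s *: symu pq.1 pq.2)).
    by apply: symmD => //; apply: symmD; [exact: symm_symX|apply: symmZ; exact: symm_symu].
  have [|s sx E] := @MVT_line R _ G (G1 pq.1 pq.2) (M + symX (c t)) (symu pq.1 pq.2) (xi pq.1 pq.2).
    move=> s sx; apply: dG; rewrite -addrA; apply: hU => //.
    by rewrite [M + _]addrC addrK; exact: Xn.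
  exists (M + symX (c t) + s *: symu pq.1 pq.2); split.
    by rewrite -addrA; split=> //; rewrite [M + _]addrC addrK; exact: Xn.
  rewrite -E; congr (G _ - _); rewrite -addrA -(cs t _ pq _ erefl)//; congr (_ + symX _).
  apply/funext => ab; rewrite /c' /c ltnS leq_eqVlt.
  have [E'|] /= := eqVneq; last by rewrite addr0.
  have -> : ab = pq by apply/enum_rank_inj/val_inj.
  by rewrite ltnn add0r.
have [N hN] := choice step; exists N; split=> [pq|]; first exact: (hN pq).1.
transitivity (\sum_(pq : T) (G (M + symX (c (enum_rank pq).+1)) - G (M + symX (c (enum_rank pq))))); last first.
  by apply: eq_bigr => pq _; exact: (hN pq).2.
rewrite (reindex_onto (@enum_val T predT) enum_rank) /=; last by move=> pq _; exact: enum_rankK.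
rewrite (eq_bigl predT); last by move=> t /=; rewrite enum_valK eqxx.
under eq_bigr do rewrite enum_valK.
pose f (t : nat) := G (M + symX (c t)).
rewrite -(big_mkord predT (fun t => f t.+1 - f t)) telescope_sumr//.
congr (_ - _); congr (G _).
  rewrite (_ : symX _ = xi)//; apply/matrixP => i j; rewrite mxE /c !ltn_ord /=.
  by have /matrixP/(_ i j) := sxi; rewrite mxE => ->; field.
rewrite (_ : symX _ = 0) ?addr0//; apply/matrixP => i j.
by rewrite !mxE /c !ltn0 addr0 mulr0.
Qed.

Lemma cU_family (J : finType) (G : J -> W -> R) M0 : (forall j, cU (G j)) -> U M0 ->
  exists r B : R, [/\ 0 < r, 0 <= B, forall M, symm M -> `|M - M0| <= r -> U M &
    forall j M, symm M -> `|M - M0| <= r -> `|G j M| <= B].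
Proof.
move=> cG UM; have [R0 R00 hU] := U_ball UM.
have [||r r0 h1] := @finite_lower R J (fun j r => forall M, U M -> `|M - M0| <= r -> `|G j M| <= `|G j M0| + 1).
- by move=> j r r' r'0 rr h M UM' Mr; apply: h => //; exact: le_trans rr.
- move=> j; have [r r0 hr] := (cUP (G j)).1 (cG j) M0 1 UM ltr01.
  exists (r / 2); first by rewrite divr_gt0.
  move=> M UM' Mr; have Mr' : `|M - M0| < r by lra.
  by have := hr M UM' Mr'; have := ler_normD (G j M - G j M0) (G j M0); rewrite subrK; lra.
have [||B B0 hB] := @finite_upper R J (fun j B => `|G j M0| + 1 <= B).
- by move=> j B B' BB h; exact: le_trans BB.
- by move=> j; exists (`|G j M0| + 1).
exists (minr R0 r), B; split=> //; first by rewrite lt_min R00.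
- by move=> M sM; rewrite le_min => /andP[Mr _]; exact: hU.
- move=> j M sM; rewrite le_min => /andP[Mr Mr']; apply: le_trans (hB j).
  by apply: h1 => //; exact: hU.
Qed.

Lemma cU_lipschitz (G : W -> R) (G1 : 'I_n -> 'I_n -> W -> R) M0 (r B : R) M M' :
  (forall p q N, U N -> is_derive N (symu p q) G (G1 p q N)) ->
  (forall N, symm N -> `|N - M0| <= 3 * r -> U N) ->
  (forall p q N, symm N -> `|N - M0| <= 3 * r -> `|G1 p q N| <= B) ->
  symm M -> symm M' -> `|M - M0| <= r -> `|M' - M0| <= r ->
  `|G M' - G M| <= n%:R ^+ 2 * B * `|M' - M|.
Proof.
move=> dG hU hB sM sM' Mr M'r.
have d2 : `|M' - M| <= 2 * r.
  by have := ler_normB (M' - M0) (M - M0); rewrite opprB addrA subrK; lra.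
have near N : `|N - M| <= `|M' - M| -> `|N - M0| <= 3 * r.
  by have := ler_normD (N - M) (M - M0); rewrite addrA subrK; lra.
have [|N [hN E]] := @increment G G1 M (M' - M) dG sM (symmB sM' sM).
  by move=> N sN /near; exact: hU.
rewrite subrKC in E; rewrite E pair_sum /=.
rewrite -mulrA; apply: sum2_norm_le => p q; rewrite normrM mulrC.
have [sN hNr] := hN (p, q).
by apply: ler_pM => //; [apply: hB => //; exact: near|exact: normM_coord].
Qed.

End symmetric_calculus.

(** * Composition with the Hessian *)

Section composition.
Context {R : realType} {n : nat}.
Local Notation V := 'rV[R]_n.
Local Notation W := 'M[R]_n.
Local Notation e i := (delta_mx ord0 i : V).
Variables (alpha : R) (O : set V) (U : set W) (H : V -> W).
Hypotheses (alpha0 : 0 < alpha) (oO : open O) (oU : open_in_symm U)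
  (HU : forall x, O x -> U (H x)).

Lemma coord_lh_near (x0 : V) (r : R) : (forall i j, lh alpha O (fun x => H x i j)) -> O x0 -> 0 < r ->
  exists s C : R, [/\ 0 < s, 0 <= C, forall x, `|x - x0| <= s -> O x /\ `|H x - H x0| <= r &
    forall x y, `|x - x0| <= s -> `|y - x0| <= s -> `|H x - H y| <= C * `|x - y| `^ alpha].
Proof.
move=> hH Ox r0.
have [s [C [s0 C0 hO _ hC]]] := lh_family alpha0 oO (fun t : 'I_n * 'I_n => hH t.1 t.2) Ox.
have holC x y : `|x - x0| <= s -> `|y - x0| <= s -> `|H x - H y| <= C * `|x - y| `^ alpha.
  move=> xs ys; apply: normM_leP => [|i j]; first by rewrite mulr_ge0// powR_ge0.
  by have := hC (i, j) x y xs ys; rewrite !mxE.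
have [|d [d0 d1 hd]] := @small_powR R alpha (r / (C + 1)) alpha0.
  by rewrite divr_gt0// ltr_wpDl.
exists (minr s d), C; split=> //; first by rewrite lt_min s0.
- move=> x; rewrite le_min => /andP[xs xd]; split; first exact: hO.
  apply: le_trans (holC x x0 xs _) _; first by rewrite subrr normr0 ltW.
  have h : `|x - x0| `^ alpha <= d `^ alpha by apply: ler_powR_base => //; exact: ltW.
  have c1 : 0 <= C + 1 by rewrite addr_ge0.
  have := ler_wpM2l c1 (le_trans h hd); rewrite [(C + 1) * (_ / _)]mulrC divfK ?gt_eqF ?ltr_wpDl//.
  by have := powR_ge0 `|x - x0| alpha; lra.
- by move=> x y; rewrite !le_min => /andP[xs _] /andP[ys _]; exact: holC.
Qed.

(** The quotient of G o H is expanded by [increment]; the intermediate points tend to H(x) because H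
    is continuous, and [G1] is continuous there within [U]. *)
Lemma chain_rule (G : W -> R) (G1 : 'I_n -> 'I_n -> W -> R) (H1 : 'I_n -> 'I_n -> R) (x : V) m :
  (forall p q N, U N -> is_derive N (symu p q) G (G1 p q N)) -> (forall p q, cU U (G1 p q)) ->
  (forall i j, lh alpha O (fun x => H x i j)) -> O x ->
  (forall i j, is_derive x (e m) (fun x => H x i j) (H1 i j)) ->
  is_derive x (e m) (fun x => G (H x)) (\sum_p \sum_q G1 p q (H x) * H1 p q).
Proof.
move=> dG cG hH Ox dH; apply/is_deriveP => d d0.
have [||B B0 hB] := @finite_upper R ('I_n * 'I_n)%type (fun pq B => `|G1 pq.1 pq.2 (H x)| + `|H1 pq.1 pq.2| <= B).
- by move=> pq B B' BB h; exact: le_trans BB.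
- by move=> pq; exists (`|G1 pq.1 pq.2 (H x)| + `|H1 pq.1 pq.2|).
pose K : R := n%:R ^+ 2 * (2 * B + 1) + 1.
have K0 : 0 < K by rewrite ltr_wpDl//; nneg.
(* Tolerance for both factors of each term: as [t] is at most 1, a product of two quantities known
   up to [t] is known up to t (2B + 1), and n^2 such terms stay below [d]. *)
pose t : R := minr 1 (d / 2 / K).
have t0 : 0 < t by rewrite lt_min ltr01 !divr_gt0.
have t1 : t <= 1 by rewrite ge_min lexx.
have tK : K * t <= d / 2.
  have : t <= d / 2 / K by rewrite ge_min lexx orbT.
  by rewrite ler_pdivlMr// mulrC.
have [||r r0 hr] := @finite_lower R ('I_n * 'I_n)%type (fun pq r =>
  (forall N, U N -> `|N - H x| < r -> `|G1 pq.1 pq.2 N - G1 pq.1 pq.2 (H x)| < t) /\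
  (forall h, h != 0 -> `|h| < r -> `|(H (x + h *: e m) pq.1 pq.2 - H x pq.1 pq.2) / h - H1 pq.1 pq.2| < t)).
- move=> pq r r' r'0 rr [h1 h2]; split=> [N UN Nr|h h0 hr]; first by apply: h1 => //; exact: lt_le_trans rr.
  by apply: h2 => //; exact: lt_le_trans rr.
- move=> pq; have [r1 r10 h1] := (cUP U (G1 pq.1 pq.2)).1 (cG _ _) _ t (HU Ox) t0.
  have /is_deriveP /(_ _ t0)[r2 r20 h2] := dH pq.1 pq.2.
  exists (minr r1 r2); first by rewrite lt_min r10.
  by split=> [N UN|h h0]; rewrite lt_min => /andP[? ?]; [exact: h1|exact: h2].
have [r1 r10 hU] := U_ball oU (HU Ox).
have r20 : 0 < minr (r / 2) r1 by rewrite lt_min divr_gt0.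
have [s [C [s0 _ hs _]]] := coord_lh_near hH Ox r20.
exists (minr s r); first by rewrite lt_min s0.
move=> h h0; rewrite lt_min => /andP[hs' hr'].
set y := x + h *: e m.
have [Oy Hy] : O y /\ `|H y - H x| <= minr (r / 2) r1.
  by apply: hs; rewrite /y addrAC subrr add0r normrZ normr_delta mulr1 ltW.
move: Hy; rewrite le_min => /andP[Hy1 Hy2].
have sHx := U_symm oU (HU Ox); have sHy := U_symm oU (HU Oy).
have [|N [hN E]] := increment dG sHx (symmB sHy sHx).
  by move=> N sN Nr; apply: hU => //; exact: le_trans Hy2.
rewrite subrKC in E; rewrite E pair_sum /=.
have -> : (\sum_p \sum_q (H y - H x) p q * G1 p q (N (p, q))) / h - \sum_p \sum_q G1 p q (H x) * H1 p q =
  \sum_p \sum_q ((H y p q - H x p q) / h * G1 p q (N (p, q)) - G1 p q (H x) * H1 p q).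
  rewrite mulr_suml -sumrB; apply: eq_bigr => p _; rewrite mulr_suml -sumrB; apply: eq_bigr => q _.
  by rewrite !mxE; congr (_ - _); rewrite mulrAC.
apply: le_lt_trans (_ : n%:R ^+ 2 * (t * (2 * B + 1)) < d).
  apply: sum2_norm_le => p q; have [h1 h2] := hr (p, q).
  set w := (H y p q - H x p q) / h; set g := G1 p q (N (p, q)).
  have [sN Nr] := hN (p, q).
  have a1 : `|g - G1 p q (H x)| < t.
    apply: h1; first by apply: hU => //; exact: le_trans Hy2.
    by apply: le_lt_trans (le_trans Nr Hy1) _; lra.
  have a2 : `|w - H1 p q| < t by apply: h2.
  have a3 := hB (p, q); rewrite /= in a3.
  have -> : w * g - G1 p q (H x) * H1 p q =
    (w - H1 p q) * (g - G1 p q (H x)) + ((w - H1 p q) * G1 p q (H x) + H1 p q * (g - G1 p q (H x))) by ring.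
  have b1 : `|(w - H1 p q) * (g - G1 p q (H x))| <= t * 1.
    by rewrite normrM; apply: ler_pM => //; [exact: ltW|lra].
  have b2 : `|(w - H1 p q) * G1 p q (H x)| <= t * B.
    by rewrite normrM; apply: ler_pM => //; [exact: ltW|have := normr_ge0 (H1 p q); lra].
  have b3 : `|H1 p q * (g - G1 p q (H x))| <= t * B.
    by rewrite normrM mulrC; apply: ler_pM => //; [exact: ltW|have := normr_ge0 (G1 p q (H x)); lra].
  apply: le_trans (ler_normD _ _) _.
  by have := ler_normD ((w - H1 p q) * G1 p q (H x)) (H1 p q * (g - G1 p q (H x))); lra.
have -> : n%:R ^+ 2 * (t * (2 * B + 1)) = K * t - t by rewrite /K; ring.
lra.
Qed.

Lemma CU_derive k (G : W -> R) : CU U k.+1 G -> exists2 G1 : 'I_n -> 'I_n -> W -> R,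
  (forall p q N, U N -> is_derive N (symu p q) G (G1 p q N)) & forall p q, CU U k (G1 p q).
Proof.
move=> [_ h].
have [G1 hG1] := choice (fun pq : 'I_n * 'I_n =>
  let: ex_intro2 g d c := h (symu pq.1 pq.2) (symm_symu pq.1 pq.2) in
  ex_intro (fun g => (forall N, U N -> is_derive N (symu pq.1 pq.2) G (g N)) /\ CU U k g) g (conj d c)).
by exists (fun p q => G1 (p, q)) => p q; have [] := hG1 (p, q).
Qed.

Lemma CU_cU k (G : W -> R) : CU U k G -> cU U G. Proof. exact: Cls_base. Qed.

Lemma CUS k (G : W -> R) : CU U k.+1 G -> CU U k G. Proof. exact: ClsS. Qed.

Lemma CU1 k (G : W -> R) : CU U k.+1 G -> CU U 1 G.
Proof. by elim: k => // k IH h; apply: IH; exact: CUS. Qed.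

Lemma comp_lh (G : W -> R) : CU U 1 G -> (forall i j, lh alpha O (fun x => H x i j)) ->
  lh alpha O (fun x => G (H x)).
Proof.
move=> /CU_derive[G1 dG cG1] hH x0 Ox.
have [r [B [r0 B0 hU hB]]] := cU_family oU (fun t : 'I_n * 'I_n => CU_cU (cG1 t.1 t.2)) (HU Ox).
have r30 : 0 < r / 3 by rewrite divr_gt0.
have [s [C [s0 C0 hs hC]]] := coord_lh_near hH Ox r30.
have E : 3 * (r / 3) = r by field.
exists s, (n%:R ^+ 2 * B * C); split=> //; first by nneg.
move=> x y xs ys; have [Ox' Hx] := hs x xs; have [Oy Hy] := hs y ys.
have sH z (Oz : O z) := U_symm oU (HU Oz).
apply: le_trans (cU_lipschitz (M0 := H x0) (r := r / 3) dG _ _ (sH y Oy) (sH x Ox') Hy Hx) _.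
- by rewrite E.
- by rewrite E => p q N; exact: (hB (p, q)).
by rewrite -[leRHS]mulrA; apply: ler_wpM2l; [nneg|exact: hC].
Qed.

(** One order more is asked of [G] because at the bottom, Hoelder continuity of the composition uses
    that [G] is C^1. *)
Lemma comp_cka k (G : W -> R) : CU U k.+1 G -> (forall i j, cka alpha O k (fun x => H x i j)) ->
  cka alpha O k (fun x => G (H x)).
Proof.
elim: k G => [|k IH] G CG hH.
  by split=> //; apply: comp_lh => // i j; exact: cka_lh (hH i j).
have [G1 dG cG1] := CU_derive CG.
have hH0 i j : lh alpha O (fun x => H x i j) by exact: cka_lh (hH i j).
have [H1 hH1] := choice (fun t : 'I_n * 'I_n * 'I_n =>
  let: ex_intro2 g d c := cka_derive t.1.1 (hH t.1.2 t.2) in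
  ex_intro (fun g => (forall x, O x -> is_derive x (e t.1.1) (fun x => H x t.1.2 t.2) (g x)) /\
    cka alpha O k g) g (conj d c)).
apply: (@cka_intro _ _ _ _ _ _ (fun m x => \sum_p \sum_q G1 p q (H x) * H1 (m, p, q) x)).
- exact: comp_lh (CU1 CG) hH0.
- move=> m x Ox; apply: chain_rule => //.
    by move=> p q; exact: CU_cU (cG1 p q).
  by move=> i j; exact: (hH1 (m, i, j)).1.
- move=> m; apply: cka_sum => p; apply: cka_sum => q; apply: ckaM => //; last exact: (hH1 (m, p, q)).2.
  by apply: IH => // i j; exact: ckaS (hH i j).
Qed.

End composition.

(** * Means of coefficients along segments *)

Section segment_means.
Context {R : realType} {n : nat}.
Local Notation W := 'M[R]_n.

Lemma ellip_mean lam Lam Q (b : 'I_Q.+1 -> 'I_n -> 'I_n -> 'I_n -> 'I_n -> R) :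
  (forall t, ellip lam Lam (b t)) ->
  ellip lam Lam (fun i j k l => Q.+1%:R^-1 * \sum_t b t i j k l).
Proof.
move=> hb; have Q0 : 0 < Q.+1%:R :> R by rewrite ltr0Sn.
split=> [w ws|i j k l]; last first.
  rewrite normrM normfV (gtr0_norm Q0) [leLHS]mulrC ler_pdivrMr//.
  apply: le_trans (ler_norm_sum _ _ _) _; apply: (@le_trans _ _ (\sum_(t < Q.+1) Lam)).
    by apply: ler_sum => t _; exact: (hb t).2.
  by rewrite sumr_const card_ord -[leLHS]mulr_natr.
have E : \sum_k \sum_l contr (fun i j k l => Q.+1%:R^-1 * \sum_t b t i j k l) w k l * w k l =
    Q.+1%:R^-1 * \sum_t \sum_k \sum_l contr (b t) w k l * w k l.
  rewrite [in RHS]exchange_big /= mulr_sumr; apply: eq_bigr => k _.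
  rewrite [in RHS]exchange_big /= mulr_sumr; apply: eq_bigr => l _.
  rewrite -mulr_suml mulrA; congr (_ * _); rewrite /contr.
  rewrite [in RHS]exchange_big /= mulr_sumr; apply: eq_bigr => i _.
  rewrite [in RHS]exchange_big /= mulr_sumr; apply: eq_bigr => j _.
  by rewrite -mulr_suml mulrA.
rewrite E [leRHS]mulrC ler_pdivlMr//.
apply: (@le_trans _ _ (\sum_(t < Q.+1) lam * sqs w)).
  by rewrite sumr_const card_ord -[leRHS]mulr_natr.
by apply: ler_sum => t _; exact: (hb t).1.
Qed.

Lemma convex_norm (A B : W) (c s : R) : `|A| <= c -> `|B| <= c -> 0 <= s -> s <= 1 ->
  `|A + s *: (B - A)| <= c.
Proof.
move=> Ac Bc s0 s1.
have -> : A + s *: (B - A) = (1 - s) *: A + s *: B by rewrite scalerBr scalerBl scale1r addrCA addrC addrAC.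
apply: le_trans (ler_normD _ _) _; rewrite !normrZ (ger0_norm s0) ger0_norm ?subr_ge0//.
have s1' : 0 <= 1 - s by rewrite subr_ge0.
have := ler_wpM2l s1' Ac; have := ler_wpM2l s0 Bc; lra.
Qed.

Definition seg (Q : nat) (M M' : W) (t : nat) : W := M + (t%:R / Q.+1%:R) *: (M' - M).

Let ratio01 (Q t : nat) : (t <= Q.+1)%N -> 0 <= t%:R / Q.+1%:R :> R /\ t%:R / Q.+1%:R <= 1 :> R.
Proof. by move=> tQ; rewrite divr_ge0//= ler_pdivrMr ?ltr0Sn// mul1r ler_nat. Qed.

Lemma seg_symm Q M M' t : symm M -> symm M' -> symm (seg Q M M' t).
Proof. by move=> sM sM'; apply: symmD => //; apply: symmZ; exact: symmB. Qed.

Lemma seg_ball Q (M M' M0 : W) (r : R) t : (t <= Q.+1)%N -> `|M - M0| <= r -> `|M' - M0| <= r ->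
  `|seg Q M M' t - M0| <= r.
Proof.
move=> tQ Mr M'r; have [t0 t1] := ratio01 tQ.
have := convex_norm Mr M'r t0 t1; congr (`|_| <= r).
by rewrite /seg opprB addrA subrK addrAC.
Qed.

Lemma seg_close Q (M M' N N' : W) (c : R) t : (t <= Q.+1)%N -> `|M - N| <= c -> `|M' - N'| <= c ->
  `|seg Q M M' t - seg Q N N' t| <= c.
Proof.
move=> tQ Mr M'r; have [t0 t1] := ratio01 tQ.
have := convex_norm Mr M'r t0 t1; congr (`|_| <= c).
apply/matrixP => i j; rewrite /seg !mxE; ring.
Qed.

(* Riemann sum for the mean of [g] on the segment from [M] to [M'].  Means over the
   segments from D^2 u(x) to D^2 u(x + h e_m) are Hoelder continuous in x
   uniformly in h, which is what makes the quotients almost linear. *)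
Definition smean (Q : nat) (M M' : W) (g : W -> R) : R := Q.+1%:R^-1 * \sum_(t < Q.+1) g (seg Q M M' t).

Variables (U : set W) (M0 : W) (r L : R).
Hypotheses (r0 : 0 < r) (L0 : 0 <= L) (hU : forall N, symm N -> `|N - M0| <= 3 * r -> U N).

Definition lip_near (g : W -> R) := forall N N', symm N -> symm N' ->
  `|N - M0| <= 3 * r -> `|N' - M0| <= 3 * r -> `|g N - g N'| <= L * `|N - N'|.

Lemma smean_lip Q M M' N N' c g : lip_near g -> symm M -> symm M' -> symm N -> symm N' ->
  `|M - M0| <= r -> `|M' - M0| <= r -> `|N - M0| <= r -> `|N' - M0| <= r ->
  `|M - N| <= c -> `|M' - N'| <= c -> `|smean Q M M' g - smean Q N N' g| <= L * c.
Proof.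
move=> lg sM sM' sN sN' Mr M'r Nr N'r MN M'N'.
have Q0 : 0 < Q.+1%:R :> R by rewrite ltr0Sn.
have r3 (x : R) : x <= r -> x <= 3 * r by have := r0; lra.
rewrite /smean -mulrBr -sumrB normrM normfV (gtr0_norm Q0) [leLHS]mulrC ler_pdivrMr//.
apply: le_trans (ler_norm_sum _ _ _) _; apply: (@le_trans _ _ (\sum_(t < Q.+1) L * c)); last first.
  by rewrite sumr_const card_ord -[leLHS]mulr_natr.
apply: ler_sum => t _; have tQ := ltnW (ltn_ord t).
apply: le_trans (lg _ _ (seg_symm _ _ sM sM') (seg_symm _ _ sN sN') _ _) _.
- by apply: r3; exact: seg_ball.
- by apply: r3; exact: seg_ball.
- by apply: ler_wpM2l => //; exact: seg_close.
Qed.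

(** Discrete fundamental theorem of calculus. On each of the Q + 1 pieces [increment] is exact, and
    moving its intermediate points to the left end costs the Lipschitz constant times the length of
    a piece. *)
Lemma smean_increment Q M M' (G : W -> R) (B : 'I_n -> 'I_n -> W -> R) :
  (forall p q N, U N -> is_derive N (symu p q) G (B p q N)) -> (forall p q, lip_near (B p q)) ->
  symm M -> symm M' -> `|M - M0| <= r -> `|M' - M0| <= r ->
  `|G M' - G M - \sum_p \sum_q smean Q M M' (B p q) * (M' - M) p q| <=
    n%:R ^+ 2 * (`|M' - M| * (L * (2 * r / Q.+1%:R))).
Proof.
move=> dG lB sM sM' Mr M'r.
have Q0 : 0 < Q.+1%:R :> R by rewrite ltr0Sn.
have Q1 : 1 <= Q.+1%:R :> R by rewrite ler1n.
pose D := M' - M; have sD : symm D by exact: symmB.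
have Dr : `|D| <= 2 * r.
  by have := ler_normB (M' - M0) (M - M0); rewrite opprB addrA subrK; lra.
pose xi : W := Q.+1%:R^-1 *: D.
have sxi : symm xi by exact: symmZ.
have nxi : `|xi| = `|D| / Q.+1%:R by rewrite normrZ normfV (gtr0_norm Q0) mulrC.
have xir : `|xi| <= 2 * r / Q.+1%:R by rewrite nxi; apply: ler_wpM2r; rewrite // invr_ge0 ltW.
have xi2r : `|xi| <= 2 * r.
  by apply: le_trans xir _; rewrite ler_pdivrMr// ler_peMr//; have := r0; lra.
have near t N : (t <= Q.+1)%N -> `|N - seg Q M M' t| <= `|xi| -> `|N - M0| <= 3 * r.
  move=> tQ Nr; have := seg_ball tQ Mr M'r.
  by have := ler_normD (N - seg Q M M' t) (seg Q M M' t - M0); rewrite addrA subrK; lra.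
have segS t : seg Q M M' t.+1 = seg Q M M' t + xi.
  by rewrite /seg /xi -addrA -scalerDl -natr1 mulrDl mul1r.
have E1 : G M' - G M = \sum_(t < Q.+1) (G (seg Q M M' t.+1) - G (seg Q M M' t)).
  rewrite -(big_mkord predT (fun t => G (seg Q M M' t.+1) - G (seg Q M M' t))) telescope_sumr//.
  by rewrite /seg mulfV ?gt_eqF// scale1r mul0r scale0r addr0 subrKC.
have E2 : \sum_p \sum_q smean Q M M' (B p q) * D p q =
    \sum_(t < Q.+1) \sum_p \sum_q B p q (seg Q M M' t) * xi p q.
  rewrite [RHS]exchange_big; apply: eq_bigr => p _; rewrite [RHS]exchange_big; apply: eq_bigr => q _.
  by rewrite -mulr_suml /smean /xi !mxE; ring.
rewrite E1 E2 -sumrB; apply: le_trans (ler_norm_sum _ _ _) _.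
apply: (@le_trans _ _ (\sum_(t < Q.+1) n%:R ^+ 2 * (`|xi| * (L * (2 * r / Q.+1%:R))))); last first.
  rewrite sumr_const card_ord -[leLHS]mulr_natr nxi.
  have E (P : R) : P != 0 -> n%:R ^+ 2 * (`|D| / P * (L * (2 * r / P))) * P =
    n%:R ^+ 2 * (`|D| * (L * (2 * r / P))) by move=> P0; field.
  by rewrite E// gt_eqF.
apply: ler_sum => t _; have tQ := ltnW (ltn_ord t).
have sN := @seg_symm Q M M' t sM sM'.
have [|N [hN E]] := increment dG sN sxi.
  by move=> N sN' Nr; apply: hU => //; exact: near Nr.
rewrite segS E pair_sum -sumrB; under eq_bigr do rewrite -sumrB.
apply: sum2_norm_le => p q /=; have [sN' Nr] := hN (p, q).
rewrite [B p q _ * _]mulrC -mulrBr normrM; apply: ler_pM => //; first exact: normM_coord.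
apply: le_trans (lB p q _ _ sN' sN _ _) _; [exact: near Nr|by have := seg_ball tQ Mr M'r; have := r0; lra|].
by apply: ler_wpM2l => //; exact: le_trans xir.
Qed.

End segment_means.

(** * Difference quotients of the nonlinear equation *)

Section nonlinear_equation.
Context {R : realType} {n : nat}.
Local Notation V := 'rV[R]_n.
Local Notation W := 'M[R]_n.
Local Notation e i := (delta_mx ord0 i : V).
Variables (alpha : R) (O : set V) (U : set W) (H : V -> W).
Hypotheses (alpha0 : 0 < alpha) (oO : open O) (oU : open_in_symm U)
  (HU : forall x, O x -> U (H x)).

(** Up to the Riemann sum error, the quotient of the flux at z is the segment mean of the
    coefficients B between H(z) and H(z + h e_m), contracted with the quotient of H. Replacing z by
    x in this mean costs rho^alpha by the Lipschitz bound on B and the Hoelder bound on H. *)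
Lemma nonlinear_almost_linear (F : 'I_n -> 'I_n -> W -> R) (B : 'I_n -> 'I_n -> 'I_n -> 'I_n -> W -> R)
    (B1 : 'I_n -> 'I_n -> 'I_n -> 'I_n -> 'I_n -> 'I_n -> W -> R) (m : 'I_n) lam x0 : 0 < lam ->
  (forall k l p q N, U N -> is_derive N (symu p q) (F k l) (B p q k l N)) ->
  (forall k l p q i j N, U N -> is_derive N (symu i j) (B p q k l) (B1 p q k l i j N)) ->
  (forall p q k l, cU U (B p q k l)) -> (forall p q k l i j, cU U (B1 p q k l i j)) ->
  (forall N w, U N -> (forall i j, w i j = w j i) ->
    lam * sqs w <= \sum_k \sum_l contr (fun i j k l => B i j k l N) w k l * w k l) ->
  (forall i j, lh alpha O (fun x => H x i j)) ->
  O x0 -> exists lam Lam Kc r0 h0 A0 : R,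
    [/\ 0 < lam, 0 <= Kc, 0 < r0, 0 < h0 & 0 <= A0 /\
    forall h, 0 < h -> h <= h0 -> almost_linear lam Lam alpha Kc r0 x0
     (fun i j => quot (fun x => H x i j) m h) (fun k l => quot (fun x => F k l (H x)) m h) A0].
Proof.
move=> lam0 dF dB cB cB1 el hH Ox0.
have [r1 [C1 [r10 C10 hU hC1]]] :=
  cU_family oU (fun t : 'I_n * 'I_n * 'I_n * 'I_n => cB t.1.1.1 t.1.1.2 t.1.2 t.2) (HU Ox0).
have [r2 [C2 [r20 C20 _ hC2]]] :=
  cU_family oU (fun t : 'I_n * 'I_n * 'I_n * 'I_n * 'I_n * 'I_n =>
    cB1 t.1.1.1.1.1 t.1.1.1.1.2 t.1.1.1.2 t.1.1.2 t.1.2 t.2) (HU Ox0).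
(* Segment means need Lipschitz coefficients on the ball of radius 3r, and [cU_lipschitz] asks for
   control on three times that radius. *)
pose r := minr r1 r2 / 9.
have r0 : 0 < r by rewrite divr_gt0// lt_min r10.
have rr1 : 9 * r <= r1 by rewrite mulrC divfK// ge_min lexx.
have rr2 : 9 * r <= r2 by rewrite mulrC divfK// ge_min lexx orbT.
have r3E : 3 * (3 * r) = 9 * r by ring.
pose L := n%:R ^+ 2 * C2; have L0 : 0 <= L by rewrite /L; nneg.
have lipB p q k l : lip_near (H x0) r L (B p q k l).
  move=> N N' sN sN' Nr N'r.
  apply: (cU_lipschitz (M0 := H x0) (r := 3 * r) (dB k l p q)) => //.
    by rewrite r3E => M sM Mr; apply: hU => //; exact: le_trans rr1.
  by rewrite r3E => i j M sM Mr; apply: (hC2 (p, q, k, l, i, j)) => //; exact: le_trans rr2.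
have hU3 N : symm N -> `|N - H x0| <= 3 * r -> U N by move=> sN Nr; apply: hU => //; lra.
have [s [C [s0 C0 hs hC]]] := coord_lh_near alpha0 oO hH Ox0 r0.
have sH x (Ox : O x) : symm (H x) := U_symm oU (HU Ox).
exists lam, C1, (n%:R ^+ 2 * L * (1 + C)), (s / 2), (s / 2), 0.
split; [by []|by nneg|by lra|by lra|split=> // h h0 hs2 x rho xr rho0].
pose sh (z : V) := z + h *: e m.
have near z : `|z - x0| <= s / 2 -> `|z - x0| <= s /\ `|sh z - x0| <= s.
  move=> zr; split; first lra; rewrite addrAC; apply: le_trans (ler_normD _ _) _.
  by rewrite normrZ normr_delta mulr1 gtr0_norm//; lra.
have rho1 : 0 < rho `^ alpha by exact: powR_gt0.
(* The subdivision may depend on the scale, since no constant depends on [Q]; this choice makes the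
   Riemann sum error of the admissible order rho^alpha. *)
pose Q := Num.truncn (2 * r / rho `^ alpha).
have Qr : 2 * r / Q.+1%:R <= rho `^ alpha.
  by rewrite ler_pdivrMr ?ltr0Sn// [leRHS]mulrC -ler_pdivrMr//; exact/ltW/truncnS_gt.
have [xs hxs] := near x xr.
have [Ox Hx] := hs x xs; have [Ohx Hhx] := hs _ hxs.
exists (fun p q k l => smean Q (H x) (H (sh x)) (B p q k l)); exists (fun _ _ => 0).
  apply: ellip_mean => t; have tQ := ltnW (ltn_ord t).
  have sN := @seg_symm _ _ Q (H x) (H (sh x)) t (sH x Ox) (sH _ Ohx).
  have Nr := seg_ball tQ Hx Hhx.
  split; first by move=> w ws; apply: el => //; apply: hU3 => //; lra.
  by move=> i j k l; apply: (hC1 (i, j, k, l)) => //; lra.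
move=> k l z w zr zx hw; rewrite subr0.
have [zs hzs] := near z zr; have [Oz Hz] := hs z zs; have [Ohz Hhz] := hs _ hzs.
pose q i j := quot (fun x => H x i j) m h z.
have Dq i j : (H (sh z) - H z) i j = h * q i j.
  by rewrite !mxE /q /quot -/(sh z) mulrC divfK// gt_eqF.
have w0 : 0 <= w by exact: le_trans (normr_ge0 _) (hw k l).
have D0 : `|H (sh z) - H z| <= h * `|w|.
  apply: normM_leP => [|i j]; first by rewrite mulr_ge0// ltW.
  rewrite Dq normrM (gtr0_norm h0); apply: ler_wpM2l; first exact: ltW.
  by rewrite (ger0_norm w0); exact: hw.
have ww : `|w| = w by exact: ger0_norm.
rewrite ww in D0.
have inc := smean_increment r0 L0 hU3 Q (dF k l) (fun p q => lipB p q k l) (sH z Oz) (sH _ Ohz) Hz Hhz.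
have -> : quot (fun x => F k l (H x)) m h z -
    contr (fun p q k l => smean Q (H x) (H (sh x)) (B p q k l)) q k l =
  (F k l (H (sh z)) - F k l (H z) -
    \sum_i \sum_j smean Q (H z) (H (sh z)) (B i j k l) * (H (sh z) - H z) i j) / h +
  \sum_i \sum_j (smean Q (H z) (H (sh z)) (B i j k l) - smean Q (H x) (H (sh x)) (B i j k l)) * q i j.
  have -> : \sum_i \sum_j smean Q (H z) (H (sh z)) (B i j k l) * (H (sh z) - H z) i j =
      h * \sum_i \sum_j smean Q (H z) (H (sh z)) (B i j k l) * q i j.
    rewrite mulr_sumr; apply: eq_bigr => i _; rewrite mulr_sumr; apply: eq_bigr => j _.
    by rewrite Dq mulrCA.
  under [\sum_i \sum_j (_ - _) * _]eq_bigr do (under eq_bigr do rewrite mulrBl; rewrite sumrB).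
  by rewrite sumrB /contr /quot -/(sh z); field; rewrite gt_eqF.
have pz : `|z - x| `^ alpha <= rho `^ alpha by apply: ler_powR_base => //; exact: ltW.
have T2 i j : `|(smean Q (H z) (H (sh z)) (B i j k l) - smean Q (H x) (H (sh x)) (B i j k l)) * q i j| <=
    L * (C * rho `^ alpha) * w.
  rewrite normrM; apply: ler_pM => //; last exact: hw.
  apply: (smean_lip r0 L0 Q (lipB i j k l) (sH z Oz) (sH _ Ohz) (sH x Ox) (sH _ Ohx) Hz Hhz Hx Hhx).
    by apply: le_trans (hC z x zs xs) _; exact: ler_wpM2l.
  apply: le_trans (hC _ _ hzs hxs) _; apply: ler_wpM2l => //.
  by rewrite /sh opprD addrACA subrr addr0.
apply: le_trans (ler_normD _ _) _.
have T1 : `|(F k l (H (sh z)) - F k l (H z) -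
    \sum_i \sum_j smean Q (H z) (H (sh z)) (B i j k l) * (H (sh z) - H z) i j) / h| <=
    n%:R ^+ 2 * L * rho `^ alpha * w.
  rewrite normrM normfV (gtr0_norm h0) ler_pdivrMr//; apply: le_trans inc _.
  have h1 : L * (2 * r / Q.+1%:R) <= L * rho `^ alpha by exact: ler_wpM2l.
  have h2 : `|H (sh z) - H z| * (L * (2 * r / Q.+1%:R)) <= h * w * (L * rho `^ alpha).
    by apply: ler_pM => //; rewrite mulr_ge0// divr_ge0// mulr_ge0// ltW.
  have n0 : 0 <= n%:R ^+ 2 :> R by nneg.
  apply: le_trans (ler_wpM2l n0 h2) _.
  by rewrite (_ : n%:R ^+ 2 * (h * w * (L * rho `^ alpha)) = n%:R ^+ 2 * L * rho `^ alpha * w * h)//; ring.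
apply: le_trans (lerD T1 (sum2_norm_le T2)) _.
rewrite (_ : rho `^ alpha * (0 + n%:R ^+ 2 * L * (1 + C) * w) =
  n%:R ^+ 2 * L * rho `^ alpha * w + n%:R ^+ 2 * (L * (C * rho `^ alpha) * w))//; ring.
Qed.

End nonlinear_equation.

(** * Regularity of the Hessian *)

Section regularity.
Context {R : realType} {n : nat}.
Local Notation V := 'rV[R]_n.
Local Notation W := 'M[R]_n.
Local Notation e i := (delta_mx ord0 i : V).
Variables (alpha : R) (O : set V) (U : set W) (H : V -> W).
Hypotheses (alpha0 : 0 < alpha) (alpha1 : alpha < 1) (oO : open O) (oU : open_in_symm U)
  (HU : forall x, O x -> U (H x)).

(** Ellipticity is stated for every array of derivatives of [F], because such arrays are obtained
    anew, by choice, for each order of smoothness. *)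
Lemma hessian_regularity lam u u1 (F : 'I_n -> 'I_n -> W -> R) : 0 < lam ->
  C2on O u u1 (fun i j x => H x i j) -> (forall i j, lh alpha O (fun x => H x i j)) ->
  (forall k l m, CU U m (F k l)) ->
  (forall N w b, U N -> (forall i j, w i j = w j i) ->
    (forall p q k l, is_derive N (symu p q) (F k l) (b p q k l)) ->
    lam * sqs w <= \sum_k \sum_l contr b w k l * w k l) ->
  WE O (fun k l x => F k l (H x)) ->
  forall k i j, cka alpha O k (fun x => H x i j).
Proof.
move=> lam0 C2u hH cF el we.
have derB k : exists B : 'I_n -> 'I_n -> 'I_n -> 'I_n -> W -> R,
    (forall k' l p q N, U N -> is_derive N (symu p q) (F k' l) (B p q k' l N)) /\
    forall p q k' l, CU U k (B p q k' l).
  have [B hB] := choice (fun t : 'I_n * 'I_n =>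
    let: ex_intro2 G d c := CU_derive (cF t.1 t.2 k.+1) in
    ex_intro (fun G => (forall p q N, U N -> is_derive N (symu p q) (F t.1 t.2) (G p q N)) /\
      forall p q, CU U k (G p q)) G (conj d c)).
  by exists (fun p q k' l => B (k', l) p q); split=> [k' l p q N|p q k' l];
    [exact: (hB (k', l)).1|exact: (hB (k', l)).2].
have elB B N w : (forall k' l p q N, U N -> is_derive N (symu p q) (F k' l) (B p q k' l N)) ->
    U N -> (forall i j, w i j = w j i) ->
    lam * sqs w <= \sum_k \sum_l contr (fun i j k l => B i j k l N) w k l * w k l.
  by move=> dB UN ws; apply: (el _ _ _ UN ws) => p q k l; exact: (dB k l p q N UN).
have cPhi k l : con O (fun x => F k l (H x)).
  exact (lh_con alpha0 (comp_lh alpha0 oO oU HU (cF k l 1%N) hH)).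
have third m i j : exists2 g : V -> R,
    (forall x, O x -> is_derive x (e m) (fun x => H x i j) (g x)) & lh alpha O g.
  apply: (third_derivative alpha0 alpha1 oO C2u hH cPhi we) => x0 Ox0.
  have [B [dB cB]] := derB 1%N.
  have [B1 hB1] := choice (fun t : 'I_n * 'I_n * 'I_n * 'I_n =>
    let: ex_intro2 G d c := CU_derive (cB t.1.1.1 t.1.1.2 t.1.2 t.2) in
    ex_intro (fun G => (forall p q N, U N -> is_derive N (symu p q) (B t.1.1.1 t.1.1.2 t.1.2 t.2) (G p q N)) /\
      forall p q, CU U 0 (G p q)) G (conj d c)).
  apply: (@nonlinear_almost_linear _ _ alpha O U H alpha0 oO oU HU F B
    (fun p q k l => B1 (p, q, k, l)) m lam x0) => //.
  - by move=> k l p q; exact: (hB1 (p, q, k, l)).1.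
  - by move=> p q k l; exact: CU_cU (cB p q k l).
  - by move=> p q k l i' j'; exact: CU_cU ((hB1 (p, q, k, l)).2 i' j').
  - by move=> N w UN ws; exact: (elB B N w dB UN ws).
have [u3' hu3] := choice (fun t : 'I_n * 'I_n * 'I_n =>
  let: ex_intro2 g d c := third t.1.1 t.1.2 t.2 in
  ex_intro (fun g => (forall x, O x -> is_derive x (e t.1.1) (fun x => H x t.1.2 t.2) (g x)) /\
    lh alpha O g) g (conj d c)).
pose u3 m i j := u3' (m, i, j).
have d3 m i j x : O x -> is_derive x (e m) (fun x => H x i j) (u3 m i j x) by exact: (hu3 (m, i, j)).1.
have h3 m i j : lh alpha O (u3 m i j) by exact: (hu3 (m, i, j)).2.
(* If the Hessian is of class k, so are the coefficients of the linear equation solved by the first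
   derivatives; [bootstrap], with right-hand side 0, gives class k for their Hessians, that is one
   order more for that of [u]. *)
elim=> [i j|k IH]; first by split.
have [B [dB cB]] := derB k.+1.
have cBH p q k' l : cka alpha O k (fun x => B p q k' l (H x)).
  exact: comp_cka alpha0 oO oU HU _ _ (cB p q k' l) IH.
have ck3 m : forall i j, cka alpha O k (u3 m i j).
  have C2v : C2on O (u1 m) (fun i x => H x m i) (u3 m).
    by apply: (C2on_derive oO C2u (d3 m)) => i j; exact (lh_con alpha0 (h3 m i j)).
  apply: (bootstrap alpha0 alpha1 oO lam0 (f := fun _ _ _ => 0) C2v (h3 m)
    (fun i j k' l => cBH i j k' l) (fun _ _ => cka_cst alpha O k 0)).
    by move=> x w Ox ws; exact: (elB B (H x) w dB (HU Ox) ws).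
  apply: WE_derive (m) cPhi _ _ we => k' l.
    apply: (lh_con alpha0); apply: (@cka_lh _ _ alpha O 0).
    apply: ckaB => //; last exact: cka_cst.
    apply: cka_sum => i; apply: cka_sum => j.
    by apply: ckaM => //; split=> //; exact: cka_lh (cBH i j k' l).
  move=> x Ox; rewrite subr0.
  apply: (chain_rule alpha0 oO oU HU (dB k' l) _ hH Ox) => [p q|i j]; last exact: d3.
  exact: CU_cU (cB p q k' l).
move=> i j; exact: (cka_intro (hH i j) (fun m => d3 m i j) (fun m => ck3 m i j)).
Qed.

Lemma cka_ck (D : set V) k (f g : V -> R) : D `<=` O -> cka alpha O k f ->
  (forall x, O x -> f x = g x) -> ck (@coord_dirs R n) D k g.
Proof.
move=> DO; have c0 f' g' : lh alpha O f' -> (forall x, O x -> f' x = g' x) -> {within D, continuous g'}.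
  move=> hf fg; apply/subspace_continuousP => x Dx; apply: cvg_within_filter.
  have [r r0 hr] := open_ballV oO (DO x Dx).
  by apply: (cont_near r0 _ (lh_con alpha0 hf (DO x Dx))) => y /ltW /hr /fg.
elim: k f g => [|k IH] f g [hf h] fg; first by split=> //; exact: c0 hf fg.
split=> [|v dv]; first exact: c0 hf fg.
have [f1 d1 c1] := h v dv.
have d1' x : O x -> is_derive x v g (f1 x) by move=> Ox; apply: (is_derive_on oO fg Ox); exact: d1.
split=> [x Dx|]; first exact: (@ex_derive _ _ _ _ _ _ _ (d1' x (DO x Dx))).
by apply: IH c1 _ => x Ox; rewrite (@derive_val _ _ _ _ _ _ _ (d1' x Ox)).
Qed.

End regularity.

(** * Euclidean balls and the given equation *)

Section euclidean_ball.
Context {R : realType} {n : nat}.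
Local Notation V := 'rV[R]_n.
Local Notation e i := (delta_mx ord0 i : V).

Lemma ckS (dirs D : set V) k (f : V -> R) : ck dirs D k.+1 f -> ck dirs D k f.
Proof.
elim: k f => [|k IH] f [cf h]; split=> // v dv.
by have [d1 c1] := h v dv; split=> //; exact: IH.
Qed.

Lemma cont_enorm : continuous (@enorm R n).
Proof.
apply: (cont_comp (f := fun x : V => \sum_i x ord0 i ^+ 2)); first exact: sqrt_continuous.
by apply: cont_sum => i; apply: contX; exact: cont_coord.
Qed.

Lemma open_eball r : open (@eball R n r).
Proof.
rewrite (_ : eball r = @enorm R n @^-1` [set s | s < r])//.
by apply: open_comp; [move=> x _; exact: cont_enorm|exact: open_lt].
Qed.

Lemma enorm_le (x : V) : enorm x <= n%:R * `|x|.
Proof.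
have h : \sum_i x ord0 i ^+ 2 <= (n%:R * `|x|) ^+ 2.
  apply: (@le_trans _ _ (\sum_(i < n) `|x| ^+ 2)).
    by apply: ler_sum => i _; rewrite -[leLHS]sqr_normr lerXn2r ?nnegrE//; exact: normrV_coord.
  rewrite sumr_const card_ord -[leLHS]mulr_natl exprMn; apply: ler_wpM2r; first exact: exprn_ge0.
  by rewrite expr2 -natrM ler_nat; case: (n) => // m; rewrite leq_pmulr.
by apply: le_trans (ler_wsqrtr h) _; rewrite sqrtr_sqr ger0_norm ?mulr_ge0.
Qed.

Lemma holder_on_lh alpha (O : set V) (f : V -> R) : 0 < alpha -> open O -> holder_on alpha O f -> lh alpha O f.
Proof.
move=> alpha0 oO hf x0 Ox; have [r r0 hr] := open_ballV oO Ox.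
have [C hC] := hf _ (@closed_ball_compactrV R n x0 r) hr.
exists r, (`|C| * n%:R `^ alpha); split=> //.
move=> x y xr yr; apply: le_trans (hC x y xr yr) _.
apply: (@le_trans _ _ (`|C| * enorm (x - y) `^ alpha)).
  by apply: ler_wpM2r; [exact: powR_ge0|exact: ler_norm].
rewrite -mulrA -powRM//; apply: ler_wpM2l => //.
by apply: ler_powR_base; [exact: ltW|exact: sqrtr_ge0|exact: enorm_le].
Qed.

Lemma C2on_ck (O : set V) (u : V -> R) : open O -> ck (@coord_dirs R n) O 2 u ->
  C2on O u (fun i x => 'D_(e i) u x) (fun i j x => hessian u x i j).
Proof.
move=> oO [c0 h].
have con_within f : {within O, continuous f} -> con O f.
  move=> /subspace_continuousP cf x Ox; have := cf x Ox.
  by rewrite within_interior// (interior_id _).1.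
have dirs i : @coord_dirs R n (e i) by exists i.
have hE i j : (fun x => hessian u x i j) = pd2 i j u by apply/funext => x; rewrite mxE.
split.
- exact: con_within.
- by move=> i; have [_ [c1 _]] := h _ (dirs i); exact: con_within.
- move=> i j; rewrite hE; have [_ [_ /(_ _ (dirs j))[_ [c2 _]]]] := h _ (dirs i).
  exact: con_within.
- by move=> i x Ox; have [d1 _] := h _ (dirs i); apply/derivableP; exact: d1.
- move=> i j x Ox; have [_ [_ /(_ _ (dirs j))[d2 _]]] := h _ (dirs i).
  by rewrite mxE; apply/derivableP; exact: d2.
Qed.

Lemma sum4_exchange (X : 'I_n -> 'I_n -> 'I_n -> 'I_n -> R) :
  \sum_i \sum_j \sum_k \sum_l X i j k l = \sum_k \sum_l \sum_i \sum_j X i j k l.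
Proof.
under eq_bigr do (rewrite exchange_big /=; under eq_bigr do rewrite exchange_big /=).
by rewrite exchange_big /=; apply: eq_bigr => k _; rewrite exchange_big.
Qed.

(** The integrals over [O] and over the whole space agree since derivatives of test functions vanish
    off [O]. The sign [c] is removed by multiplying by it once more. *)
Lemma WE_weak_solution (a : coeffs R n) (O : set V) (u : V -> R) (c : R) (F : 'I_n -> 'I_n -> 'M[R]_n -> R) :
  c * c = 1 -> weak_solution a O u -> (forall k l, con O (fun x => F k l (hessian u x))) ->
  (forall k l M, F k l M = c * \sum_i \sum_j a i j k l M * M i j) ->
  WE O (fun k l x => F k l (hessian u x)).
Proof.
move=> cc ws cF eF eta teta.
pose G x := \sum_k \sum_l F k l (hessian u x) * pd2 k l eta x.
have CG : Cc G by apply: Cc_sum2 => k l; exact: (test_flux k l teta (cF k l)).1.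
suff : c * I G = 0 by move=> h; rewrite -[LHS]mul1r -cc -mulrA h mulr0.
rewrite -IZ//.
have := ws eta teta; rewrite /rint => /(congr1 fine) /= h; rewrite -[RHS]h.
rewrite /I /Rintegral; congr fine; rewrite [RHS]integral_mkcond.
apply: eq_integral => t _; rewrite patchE; case: ifPn => [/set_mem /= Ox|nO].
  congr EFin; rewrite sum4_exchange /G mulr_sumr; apply: eq_bigr => k _.
  rewrite mulr_sumr; apply: eq_bigr => l _.
  rewrite eF mulrA mulrA cc mul1r mulr_suml; apply: eq_bigr => i _.
  by rewrite mulr_suml; apply: eq_bigr => j _; rewrite mxE.
have nOx : ~ O (row_of_tuple t) by move=> Ox; move/negP: nO; apply; exact: mem_set.
rewrite (_ : G _ = 0) ?mulr0// /G big1// => k _; rewrite big1// => l _.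
by rewrite (test_flux k l teta (cF k l)).2// mulr0.
Qed.

Lemma sum_symu (N : 'M[R]_n) (w : 'I_n -> 'I_n -> R) i j : (forall i j, w i j = w j i) ->
  \sum_p \sum_q (symu p q : 'M[R]_n) i j * w p q = w i j.
Proof.
move=> ws.
have E (i' j' : 'I_n) : \sum_p \sum_q ((i' == p) && (j' == q))%:R * w p q = w i' j'.
  rewrite (bigD1 i') //= (bigD1 j') //= !eqxx mul1r big1 => [|q qj]; last first.
    by rewrite eq_sym (negbTE qj) mul0r.
  rewrite addr0 big1 ?addr0// => p pi; rewrite big1// => q _.
  by rewrite eq_sym (negbTE pi) mul0r.
transitivity (2^-1 * (w i j + w j i)); last by rewrite (ws j i); field.
rewrite -(E i j) -(E j i) -big_split /= mulr_sumr; apply: eq_bigr => p _.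
rewrite -big_split /= mulr_sumr; apply: eq_bigr => q _.
rewrite !mxE [(i == q) && _]andbC; ring.
Qed.

(** By the product rule the derivative of the flux along [symu p q] is [c] times the coefficient b,
    except that its first term is symmetrised in p and q; against the symmetric [w] this makes no
    difference. *)
Lemma contr_flux (a : coeffs R n) (c : R) (F : 'I_n -> 'I_n -> 'M[R]_n -> R) N (w : 'I_n -> 'I_n -> R) b :
  (forall p q i j k l, derivable (a i j k l) N (symu p q)) ->
  (forall k l M, F k l M = c * \sum_i \sum_j a i j k l M * M i j) ->
  (forall i j, w i j = w j i) ->
  (forall p q k l, is_derive N (symu p q) (F k l) (b p q k l)) ->
  \sum_k \sum_l contr b w k l * w k l = c * qform (bcoeffs a) N (\matrix_(i, j) w i j).
Proof.
move=> da eF ws db.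
have bE p q k l : b p q k l = c * \sum_i \sum_j (a i j k l N * (symu p q : 'M[R]_n) i j + dsym p q (a i j k l) N * N i j).
  apply: is_derive_unique (db p q k l) _.
  rewrite (_ : F k l = (fun M => c * \sum_i \sum_j a i j k l M * M i j)); last exact/funext.
  apply: is_deriveZ; apply: is_derive_sum1 => i; apply: is_derive_sum1 => j.
  apply: is_deriveM1; first exact/derivableP/da.
  apply/is_deriveP => d d0; exists 1 => // h h0 _.
  by rewrite !mxE [N i j + _]addrC addrK mulrC mulKf// subrr normr0.
rewrite /qform sum4_exchange mulr_sumr; apply: eq_bigr => k _; rewrite mulr_sumr; apply: eq_bigr => l _.
transitivity (c * (\sum_i \sum_j bcoeffs a i j k l N * w i j) * w k l); last first.
  rewrite -mulrA mulr_suml; congr (c * _); apply: eq_bigr => i _.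
  by rewrite mulr_suml; apply: eq_bigr => j _; rewrite !mxE.
congr (_ * _); rewrite /contr.
under eq_bigr do under eq_bigr do rewrite bE -mulrA.
under eq_bigr do rewrite -mulr_sumr.
rewrite -mulr_sumr; congr (c * _).
have E1 : \sum_i \sum_j a i j k l N * w i j =
    \sum_p \sum_q (\sum_i \sum_j a i j k l N * (symu p q : 'M[R]_n) i j) * w p q.
  rewrite [RHS](_ : _ = \sum_p \sum_q \sum_i \sum_j a i j k l N * ((symu p q : 'M[R]_n) i j * w p q)).
    rewrite sum4_exchange; apply: eq_bigr => i _; apply: eq_bigr => j _.
    rewrite -[in LHS](sum_symu N i j ws) mulr_sumr; apply: eq_bigr => p _.
    by rewrite mulr_sumr.
  apply: eq_bigr => p _; apply: eq_bigr => q _; rewrite mulr_suml; apply: eq_bigr => i _.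
  by rewrite mulr_suml; apply: eq_bigr => j _; rewrite mulrA.
under [RHS]eq_bigr do under eq_bigr do rewrite /bcoeffs mulrDl.
under [RHS]eq_bigr do rewrite big_split /=.
rewrite [RHS]big_split /= E1 -big_split /=; apply: eq_bigr => p _.
rewrite -big_split /=; apply: eq_bigr => q _; rewrite -mulrDl; congr (_ * _).
by rewrite -big_split /=; apply: eq_bigr => i _; rewrite big_split.
Qed.

End euclidean_ball.

Theorem theorem1p2 (R : realType) (n : nat) (alpha : R)
  (u : 'rV[R]_n -> R) (a : coeffs R n) (U : set 'M[R]_n)
  (n_ge1 : (1 <= n)%N) (alpha_gt0 : 0 < alpha) (alpha_lt1 : alpha < 1)
  (u_c2alpha : c2_alpha alpha (eball 1) u)
  (u_solution : weak_solution a (eball 1) u)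
  (U_open : open_in_symm U)
  (hessian_in_U : forall x, eball 1 x -> U (hessian u x))
  (a_regular : regular U a) :
  forall r : R, r < 1 -> smooth_on (eball r) u.
Proof.
have [ck2 hol] := u_c2alpha; have oO := @open_eball R n 1.
have [sa _ [Lam1 [Lam0 hb]]] := a_regular.
(* The two alternatives of the last regularity condition are merged into one by the sign [c]. *)
have [c [cc hel]] : exists c : R, c * c = 1 /\ forall M xi, U M -> symm xi ->
    Lam1 * sqnorm xi <= c * qform (bcoeffs a) M xi.
  case: hb => h; [exists 1|exists (-1)]; split; rewrite ?mulrNN ?mulr1// => M xi UM sxi.
    by rewrite mul1r; exact: h.
  by rewrite mulN1r; exact: h.
pose F k l (M : 'M[R]_n) := c * \sum_i \sum_j a i j k l M * M i j.
have C2u := C2on_ck oO ck2.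
have hH i j : lh alpha (eball 1) (fun x => hessian u x i j).
  rewrite (_ : (fun x => _) = pd2 i j u); first exact: holder_on_lh.
  by apply/funext => x; rewrite mxE.
have Ca i j k l m : CU U m (a i j k l) by exact: smooth_CU.
have cF k l m : CU U m (F k l).
  apply: (ClsM (@cUD R n U) (@cUM R n U)); first exact: Cls_cst (@cU_cst R n U).
  apply: (Cls_sum _ (@cU_cst R n U) (@cUD R n U)) => i.
  apply: (Cls_sum _ (@cU_cst R n U) (@cUD R n U)) => j.
  by apply: (ClsM (@cUD R n U) (@cUM R n U)); [exact: Ca|exact: CU_coord].
have we : WE (eball 1) (fun k l x => F k l (hessian u x)).
  apply: WE_weak_solution cc u_solution _ _ => // k l.
  exact (lh_con alpha_gt0 (comp_lh alpha_gt0 oO U_open hessian_in_U (cF k l 1%N) hH)).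
have el N w b : U N -> (forall i j, w i j = w j i) ->
    (forall p q k l, is_derive N (symu p q) (F k l) (b p q k l)) ->
    Lam1 * sqs w <= \sum_k \sum_l contr b w k l * w k l.
  move=> UN ws db; have da p q i j k l : derivable (a i j k l) N (symu p q).
    by have [_ /(_ _ (symm_symu p q))[g dg _]] := Ca i j k l 1%N; exact: (@ex_derive _ _ _ _ _ _ _ (dg N UN)).
  rewrite (contr_flux (c := c) da (fun _ _ _ => erefl) ws db).
  have := hel N (\matrix_(i, j) w i j) UN; rewrite (_ : sqnorm _ = sqs w); last first.
    by apply: eq_bigr => i _; apply: eq_bigr => j _; rewrite mxE.
  by apply; apply/matrixP => i j; rewrite !mxE.
have key := hessian_regularity alpha_gt0 alpha_lt1 oO U_open hessian_in_U Lam0 C2u hH cF el we.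
move=> r r1 k; have sub : eball r `<=` @eball R n 1 by move=> x; rewrite /eball /=; lra.
(* Smoothness of the Hessian to order k is smoothness of [u] to order k + 2, which is more than
   asked. *)
suff : ck (@coord_dirs R n) (eball r) k.+2 u by move=> h; do 2 apply: ckS.
have [c0 c1 _ d1 d2] := C2u.
have within f : con (eball 1) f -> {within @eball R n r, continuous f}.
  by move=> cf; apply/subspace_continuousP => x /sub Ox; apply: cvg_within_filter; exact: cf.
split=> [|_ [i _ <-]]; first exact: within.
split=> [x /sub Ox|]; first exact: (@ex_derive _ _ _ _ _ _ _ (d1 i x Ox)).
split=> [|_ [j _ <-]]; first exact/within/c1.
split=> [x /sub Ox|]; first exact: (@ex_derive _ _ _ _ _ _ _ (d2 i j x Ox)).
apply: (cka_ck alpha_gt0 oO sub (key k i j)) => x _.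
by rewrite mxE.
Qed.
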